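(* Let $\mathbb{P}$ be a finite quantum space and $\mathbb{O}$ a compact quantum space such that $C(\mathbb{O})$ is separable. Let $\mathbb{S}_{\mathbb{P},\mathbb{O}}\subset C(\mathbb{M}_{\mathbb{P},\mathbb{O}})$ be the operator system $$\mathbb{S}_{\mathbb{P},\mathbb{O}}=\overline{\mathrm{span}}\{(\omega\otimes\mathrm{id})\boldsymbol{\Phi}_{\mathbb{P},\mathbb{O}}(x) : x\in C(\mathbb{O}),\ \omega\in C(\mathbb{P})^*\}$$ and let $\boldsymbol{\varphi}_{\mathbb{P},\mathbb{O}}\colon C(\mathbb{O})\to C(\mathbb{P})\otimes\mathbb{S}_{\mathbb{P},\mathbb{O}}$ be the unital completely positive map given by $\boldsymbol{\Phi}_{\mathbb{P},\mathbb{O}}$ viewed as a map into $C(\mathbb{P})\otimes\mathbb{S}_{\mathbb{P},\mathbb{O}}$. Then for any operator system $S$ and any unital completely positive map $\psi\colon C(\mathbb{O})\to C(\mathbb{P})\otimes S$ there exists a unique unital completely positive map $\lambda\colon\mathbb{S}_{\mathbb{P},\mathbb{O}}\to S$ such that $\psi=(\mathrm{id}\otimes\lambda)\circ\boldsymbol{\varphi}_{\mathbb{P},\mathbb{O}}$.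
   Context: A quantum space $\mathbb{X}$ is an object of the category dual to the category of C*-algebras; the corresponding C*-algebra is denoted $C_0(\mathbb{X})$, or $C(\mathbb{X})$ when it is unital. $\mathbb{X}$ is compact if $C(\mathbb{X})$ is unital and finite if $C(\mathbb{X})$ is finite-dimensional. For C*-algebras $A,B$, $\mathrm{Mor}(A,B)$ is the set of non-degenerate $*$-homomorphisms from $A$ to the multiplier algebra $M(B)$ (unital $*$-homomorphisms $A\to B$ if both are unital). $\otimes$ is the minimal tensor product. For $\mathbb{P}$ finite and $\mathbb{O}$ compact, $(C(\mathbb{M}_{\mathbb{P},\mathbb{O}}),\boldsymbol{\Phi}_{\mathbb{P},\mathbb{O}})$ denotes the (existing, unique up to isomorphism) pair consisting of a unital C*-algebra and a unital $*$-homomorphism $\boldsymbol{\Phi}_{\mathbb{P},\mathbb{O}}\colon C(\mathbb{O})\to C(\mathbb{P})\otimes C(\mathbb{M}_{\mathbb{P},\mathbb{O}})$ with the universal property: for every quantum space $\mathbb{X}$ and every $\Psi\in\mathrm{Mor}(C(\mathbb{O}),C(\mathbb{P})\otimes C_0(\mathbb{X}))$ there is a unique $\Lambda\in\mathrm{Mor}(C(\mathbb{M}_{\mathbb{P},\mathbb{O}}),C_0(\mathbb{X}))$ with $\Psi=(\mathrm{id}\otimes\Lambda)\circ\boldsymbol{\Phi}_{\mathbb{P},\mathbb{O}}$. The C*-algebra $C(\mathbb{M}_{\mathbb{P},\mathbb{O}})$ is generated by $\{(\omega\otimes\mathrm{id})\boldsymbol{\Phi}_{\mathbb{P},\mathbb{O}}(a)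 : a\in C(\mathbb{O}),\ \omega\in C(\mathbb{P})^*\}$. An operator system is a unital self-adjoint subspace of a unital C*-algebra with the inherited matrix order; since $C(\mathbb{P})$ is finite-dimensional, $C(\mathbb{P})\otimes S$ is the algebraic tensor product, viewed as an operator system inside $C(\mathbb{P})\otimes A$ for $S\subset A$. *)

(* Defs.v *)
From HB Require Import structures.
From mathcomp Require Import all_boot all_order all_algebra.
From mathcomp Require Import complex.
From mathcomp Require Import all_classical all_reals all_analysis.

Set Implicit Arguments.
Unset Strict Implicit.
Unset Printing Implicit Defensive.

Import Order.TTheory GRing.Theory Num.Theory.
Import numFieldNormedType.Exports.

Local Open Scope classical_set_scope.
Local Open Scope ring_scope.

Reserved Notation "x *c y" (at level 40, left associativity).

(* The norm of a normed module over R[i] takes its values in R[i] (in its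
   nonnegative real part). No unit is assumed. *)
HB.mixin Record isCStar (R : realType) A of CompleteNormedModule R[i] A := {
  cmul : A -> A -> A;
  cstar : A -> A;
  cmulA : associative cmul;
  cmulDl : left_distributive cmul +%R;
  cmulDr : right_distributive cmul +%R;
  cscaleAl : forall (a : R[i]) (x y : A), a *: cmul x y = cmul (a *: x) y;
  cscaleAr : forall (a : R[i]) (x y : A), a *: cmul x y = cmul x (a *: y);
  cstarK : involutive cstar;
  cstarD : {morph cstar : x y / x + y};
  cstarZ : forall (a : R[i]) (x : A), cstar (a *: x) = (a^*)%R *: cstar x;
  cstarM : forall x y, cstar (cmul x y) = cmul (cstar y) (cstar x);
  cnormM : forall x y, `|cmul x y| <= `|x| * `|y|;
  cnorm_star : forall x, `|cmul (cstar x) x| = `|x| ^+ 2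
}.

#[short(type="cstarType")]
HB.structure Definition CStar (R : realType) :=
  {A of CompleteNormedModule R[i] A & isCStar R A}.

Notation "x *c y" := (cmul x y) : ring_scope.

HB.mixin Record isUnitalCStar (R : realType) A of CStar R A := {
  cone : A;
  cmul1x : left_id cone cmul;
  cmulx1 : right_id cone cmul
}.

(* The zero algebra is allowed. *)
#[short(type="ucstarType")]
HB.structure Definition UnitalCStar (R : realType) :=
  {A of CStar R A & isUnitalCStar R A}.

#[short(type="finCstarType")]
HB.structure Definition FinCStar (R : realType) :=
  {A of UnitalCStar R A & Vector R[i] A}.

Definition separable_space (T : topologicalType) :=
  exists2 D : set T, countable D & dense D.

Section CStarTheory.
Context {R : realType} {A : cstarType R}.
Implicit Types x y : A.

Lemma cmul0x y : 0 *c y = 0 :> A.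
Proof. by rewrite -(scale0r (0 : A)) -cscaleAl !scale0r. Qed.

Lemma cmulx0 y : y *c 0 = 0 :> A.
Proof. by rewrite -(scale0r (0 : A)) -cscaleAr !scale0r. Qed.

Lemma cstar0 : cstar 0 = 0 :> A.
Proof. by rewrite -(scale0r (0 : A)) cstarZ conjC0 !scale0r. Qed.

Lemma cstarB x y : cstar (x - y) = cstar x - cstar y.
Proof. by rewrite cstarD -scaleN1r cstarZ rmorphN1 scaleN1r. Qed.

Lemma cmul_suml (I : Type) (r : seq I) (P : pred I) (F : I -> A) y :
  (\sum_(i <- r | P i) F i) *c y = \sum_(i <- r | P i) F i *c y.
Proof. by apply: (big_morph (fun x => x *c y)) => [u v|]; rewrite ?cmulDl ?cmul0x. Qed.

Lemma cmul_sumr (I : Type) (r : seq I) (P : pred I) (F : I -> A) y :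
  y *c (\sum_(i <- r | P i) F i) = \sum_(i <- r | P i) y *c F i.
Proof. by apply: (big_morph (cmul y)) => [u v|]; rewrite ?cmulDr ?cmulx0. Qed.

Lemma cstar_sum (I : Type) (r : seq I) (P : pred I) (F : I -> A) :
  cstar (\sum_(i <- r | P i) F i) = \sum_(i <- r | P i) cstar (F i).
Proof. by apply: (big_morph cstar); [exact: cstarD|exact: cstar0]. Qed.

Lemma cnorm_starE x : `|cstar x| = `|x|.
Proof.
have le y : `|y| <= `|cstar y|.
  have [->|y0] := eqVneq y 0; first by rewrite cstar0.
  have ny : 0 < `|y| by rewrite normr_gt0.
  by rewrite -(ler_pM2r ny) -expr2 -cnorm_star cnormM.
by apply/eqP; rewrite eq_le le andbT -[X in _ <= `|X|]cstarK le.
Qed.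

End CStarTheory.

Lemma cstar1 (R : realType) (A : ucstarType R) : cstar cone = cone :> A.
Proof. by rewrite -[LHS]cmul1x -[X in X *c _]cstarK -cstarM cmul1x cstarK. Qed.

Section Span.
Context {K : numFieldType} {V : normedModType K}.

Definition lspan (X : set V) : set V :=
  [set y | exists (n : nat) (c : 'I_n -> K) (v : 'I_n -> V),
     (forall i, X (v i)) /\ y = \sum_i c i *: v i].

Lemma sub_lspan (X : set V) : X `<=` lspan X.
Proof.
move=> x Xx; exists 1%N, (fun=> 1), (fun=> x); split=> //.
by rewrite big_ord1 scale1r.
Qed.

Lemma lspan_lin (X : set V) a x y :
  lspan X x -> lspan X y -> lspan X (a *: x + y).
Proof.
move=> [n [c [v [Xv ->]]]] [m [d [w [Xw ->]]]].
exists (n + m)%N, (fun i : 'I_(n + m) => match fintype.split i with inl j => a * c j | inr j => d j end),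
  (fun i : 'I_(n + m) => match fintype.split i with inl j => v j | inr j => w j end); split.
  by move=> i; case: (fintype.split i).
rewrite big_split_ord /= scaler_sumr; congr (_ + _); apply: eq_bigr => i _.
  by rewrite (unsplitK (inl _ i)) scalerA.
by rewrite (unsplitK (inr _ i)).
Qed.

Lemma closure_normP (X : set V) x :
  closure X x <-> forall e : K, 0 < e -> exists2 y, X y & `|x - y| < e.
Proof.
split=> [cx e e0|H B /nbhs_ballP[e /= e0 eB]].
  have [y [Xy]] := cx _ (nbhsx_ballx x e e0).
  by rewrite -ball_normE /= => xy; exists y.
have [y Xy xy] := H e e0; exists y; split=> //; apply: eB.
by rewrite -ball_normE.
Qed.

Lemma closure_lin (X : set V) a x y :
  (forall b u v, X u -> X v -> X (b *: u + v)) ->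
  closure X x -> closure X y -> closure X (a *: x + y).
Proof.
move=> Xlin /closure_normP cx /closure_normP cy; apply/closure_normP => e e0.
have na : 0 < `|a| + 1 by rewrite ltr_wpDl.
have [u Xu xu] := cx (e / 2 / (`|a| + 1)) (divr_gt0 (divr_gt0 e0 (ltr0Sn _ 1)) na).
have [v Xv yv] := cy (e / 2) (divr_gt0 e0 (ltr0Sn _ 1)).
exists (a *: u + v); first exact: Xlin.
rewrite opprD addrACA -scalerBr (le_lt_trans (ler_normD _ _))//.
rewrite [ltRHS](splitr e) ler_ltD// normrZ.
rewrite (le_trans (ler_wpM2l (normr_ge0 _) (ltW xu)))//.
rewrite mulrCA -[leRHS]mulr1 ler_wpM2l ?(ltW (divr_gt0 e0 (ltr0Sn _ 1)))//.
by rewrite ler_pdivrMr// mul1r lerDl.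
Qed.

End Span.

(* Double centralizers: (L, R) with x (L y) = (R x) y. Over a C*-algebra such
   L and R are automatically linear, bounded, and determine each other. *)
Section Multiplier.
Context {R : realType}.

Record multiplier (B : cstarType R) := Multiplier {
  mulL : B -> B;
  mulR : B -> B;
  mulLR : forall x y, x *c mulL y = mulR x *c y
}.

Context {B : cstarType R}.
Implicit Types m n : multiplier B.

Lemma mult_lin_subproof a m n x y :
  x *c (a *: mulL m y + mulL n y) = (a *: mulR m x + mulR n x) *c y.
Proof. by rewrite cmulDr cmulDl -cscaleAr -cscaleAl !mulLR. Qed.

Definition mult_lin a m n := Multiplier (mult_lin_subproof a m n).

Lemma mult_mul_subproof m n x y :
  x *c mulL m (mulL n y) = mulR n (mulR m x) *c y.
Proof. by rewrite !mulLR. Qed.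

Definition mult_mul m n := Multiplier (mult_mul_subproof m n).

Lemma mult_star_subproof m x y :
  x *c cstar (mulR m (cstar y)) = cstar (mulL m (cstar x)) *c y.
Proof. by rewrite -[x in LHS]cstarK -cstarM -mulLR cstarM cstarK. Qed.

Definition mult_star m := Multiplier (mult_star_subproof m).

(* Mor(A, B); f non-degenerate: f(A)B spans a dense subspace of B. *)
Definition is_mor (A : cstarType R) (f : A -> multiplier B) : Prop :=
  [/\ forall a x y, f (a *: x + y) = mult_lin a (f x) (f y),
      forall x y, f (x *c y) = mult_mul (f x) (f y),
      forall x, f (cstar x) = mult_star (f x)
    & dense (lspan [set z | exists x y, z = mulL (f x) y])].

End Multiplier.

Definition is_unital_starhom (R : realType) (A B : ucstarType R) (f : A -> B) :=
  [/\ linear f, {morph f : x y / x *c y}, {morph f : x / cstar x}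
    & f cone = cone].

Section FinBasis.
Context {R : realType} (P : finCstarType R).

Definition pdim := \dim (fullv : {vspace P}).

Definition pbase (i : 'I_pdim) : P := (vbasis fullv)`_i.

Definition pcoord (i : 'I_pdim) : {linear P -> R[i]^o} := coord (vbasis fullv) i.

Lemma pcoordE (p : P) : p = \sum_i (pcoord i p : R[i]) *: pbase i.
Proof. exact: (coord_vbasis (memvf p)). Qed.

Lemma pcoord_base i j : pcoord i (pbase j) = ((j == i)%:R : R[i]).
Proof. exact: (coord_free _ _ (basis_free (vbasisP _))). Qed.

End FinBasis.

(* [tensor P A T]: T is the C*-tensor product of P and A. As P is
   finite-dimensional, the algebraic tensor product of P and A carries a unique
   C*-norm and is complete for it, so T is the algebraic tensor product
   equipped with a structure of C*-algebra. It is described through the basis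
   [pbase] of P: every z in T is \sum_i pbase i (x) z_i for unique z_i. *)
Record tensor (R : realType) (P : finCstarType R) (A T : cstarType R) := Tensor {
  tens : P -> A -> T;
  tcoord : T -> 'I_(pdim P) -> A;
  tensDl : forall a p q x, tens (a *: p + q) x = a *: tens p x + tens q x;
  tensDr : forall a p x y, tens p (a *: x + y) = a *: tens p x + tens p y;
  tensM : forall p q x y, tens p x *c tens q y = tens (p *c q) (x *c y);
  tens_star : forall p x, cstar (tens p x) = tens (cstar p) (cstar x);
  tcoordK : forall z : T, \sum_i tens (pbase i) (tcoord z i) = z;
  tensK : forall f : 'I_(pdim P) -> A, tcoord (\sum_i tens (pbase i) (f i)) = f
}.

Section TensorTheory.
Context {R : realType} {P : finCstarType R} {A T : cstarType R}.
Variable t : tensor P A T.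

Lemma tens0l x : tens t 0 x = 0.
Proof.
have := tensDl t 1 0 0 x; rewrite !scale1r addr0 => /eqP.
by rewrite -[X in X == _]addr0 (inj_eq (addrI _)) => /eqP.
Qed.

Lemma tens0r p : tens t p 0 = 0.
Proof.
have := tensDr t 1 p 0 0; rewrite !scale1r addr0 => /eqP.
by rewrite -[X in X == _]addr0 (inj_eq (addrI _)) => /eqP.
Qed.

Lemma tensZl a p x : tens t (a *: p) x = a *: tens t p x.
Proof. by rewrite -[a *: p]addr0 tensDl tens0l addr0. Qed.

Lemma tensZr a p x : tens t p (a *: x) = a *: tens t p x.
Proof. by rewrite -[a *: x]addr0 tensDr tens0r addr0. Qed.

Lemma tens_suml (I : Type) (r : seq I) (Q : pred I) (F : I -> P) x :
  tens t (\sum_(i <- r | Q i) F i) x = \sum_(i <- r | Q i) tens t (F i) x.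
Proof.
apply: (big_morph (fun p => tens t p x)) => [p q|]; last exact: tens0l.
by rewrite -[p in LHS]scale1r tensDl scale1r.
Qed.

Lemma tcoord_lin a x y i :
  tcoord t (a *: x + y) i = a *: tcoord t x i + tcoord t y i.
Proof.
rewrite -[x in LHS](tcoordK t) -[y in LHS](tcoordK t) scaler_sumr -big_split /=.
under eq_bigr do rewrite -tensDr.
by rewrite (tensK t (fun i => a *: tcoord t x i + tcoord t y i)).
Qed.

Lemma tcoord_tens p x i :
  tcoord t (tens t p x) i = (pcoord i p : R[i]) *: x.
Proof.
rewrite [p in LHS](pcoordE p) tens_suml.
under eq_bigr do rewrite tensZl -tensZr.
by rewrite (tensK t (fun i => (pcoord i p : R[i]) *: x)).
Qed.

Lemma tcoord0 i : tcoord t 0 i = 0.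
Proof. by rewrite -(tens0l 0) tcoord_tens scaler0. Qed.

Lemma tcoord_sum (I : Type) (r : seq I) (Q : pred I) (F : I -> T) i :
  tcoord t (\sum_(j <- r | Q j) F j) i = \sum_(j <- r | Q j) tcoord t (F j) i.
Proof.
apply: (big_morph (fun z => tcoord t z i)) => [x y|]; last exact: tcoord0.
by rewrite -[x in LHS]scale1r tcoord_lin scale1r.
Qed.

Definition slice (w : {linear P -> R[i]^o}) (x : T) : A :=
  \sum_i (w (pbase i) : R[i]) *: tcoord t x i.

Lemma slice_tens w p x : slice w (tens t p x) = (w p : R[i]) *: x.
Proof.
rewrite /slice; under eq_bigr do rewrite tcoord_tens scalerA.
rewrite -scaler_suml; congr (_ *: _).
rewrite [p in RHS](pcoordE p) linear_sum.
by apply: eq_bigr => i _; rewrite linearZ mulrC.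
Qed.

Lemma slice_sum w (I : Type) (r : seq I) (Q : pred I) (F : I -> T) :
  slice w (\sum_(j <- r | Q j) F j) = \sum_(j <- r | Q j) slice w (F j).
Proof.
rewrite /slice exchange_big; apply: eq_bigr => i _ /=.
by rewrite tcoord_sum scaler_sumr.
Qed.

(* (id (x) f)(p (x) m) is the multiplier
   q (x) b |-> pq (x) f(m)b of T, extended linearly. *)
Lemma mult_id_tensor_subproof (M : cstarType R) (PM : cstarType R)
    (tM : tensor P M PM) (f : M -> multiplier A) (x : PM) (z y : T) :
  z *c (\sum_i \sum_j tens t (pbase i *c pbase j)
          (mulL (f (tcoord tM x i)) (tcoord t y j))) =
  (\sum_i \sum_j tens t (pbase j *c pbase i)
          (mulR (f (tcoord tM x i)) (tcoord t z j))) *c y.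
Proof.
rewrite cmul_sumr cmul_suml; apply: eq_bigr => i _.
rewrite -[z in LHS](tcoordK t) -[y in RHS](tcoordK t).
rewrite !cmul_suml; apply: eq_bigr => k _.
rewrite !cmul_sumr; apply: eq_bigr => j _.
by rewrite !tensM cmulA mulLR.
Qed.

Definition mult_id_tensor (M PM : cstarType R) (tM : tensor P M PM)
    (f : M -> multiplier A) (x : PM) : multiplier T :=
  Multiplier (mult_id_tensor_subproof tM f x).

End TensorTheory.

Section TensorUnital.
Context {R : realType} {P : finCstarType R} {A T : ucstarType R}.
Variable t : tensor P A T.

Lemma tens11 : tens t cone cone = cone.
Proof.
rewrite -[LHS]cmulx1 -[X in _ *c X](tcoordK t) cmul_sumr.
under eq_bigr do rewrite tensM !cmul1x.
by rewrite tcoordK.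
Qed.

End TensorUnital.

Definition all_maps_universal (R : realType) (P : finCstarType R)
    (O M PM : ucstarType R) (tM : tensor P M PM) (Phi : O -> PM) : Prop :=
  forall (X PX : cstarType R) (tX : tensor P X PX) (Psi : O -> multiplier PX),
    is_mor Psi ->
    exists! L : M -> multiplier X,
      is_mor L /\ Psi = mult_id_tensor tX tM L \o Phi.

(* Unital self-adjoint subspaces; not assumed to be closed. *)
Record opSystem (R : realType) (A : ucstarType R) := OpSystem {
  os_set : set A;
  os_one_mem : os_set cone;
  os_star_mem : forall x, os_set x -> os_set (cstar x);
  os_lin_mem : forall (a : R[i]) x y, os_set x -> os_set y -> os_set (a *: x + y)
}.

Section OpSystemType.
Context {R : realType} {A : ucstarType R} (S : opSystem A).

Definition os_pred : {pred A} := fun x => x \in os_set S.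

Lemma os_predP x : reflect (os_set S x) (x \in os_pred).
Proof. by apply: (iffP idP) => [/set_mem|/mem_set]. Qed.

Fact os_submod_closed : submod_closed os_pred.
Proof.
split=> [|a x y /os_predP Sx /os_predP Sy]; apply/os_predP.
  by rewrite -(addNr cone) -scaleN1r; apply: os_lin_mem; exact: os_one_mem.
exact: os_lin_mem.
Qed.

HB.instance Definition _ :=
  GRing.isSubmodClosed.Build R[i] A os_pred os_submod_closed.

Definition os_type := {x : A | x \in os_pred}.

HB.instance Definition _ := SubChoice.on os_type.
HB.instance Definition _ := [SubChoice_isSubLmodule of os_type by <:].

Definition os_in x (Sx : os_set S x) : os_type := exist _ x (introT (os_predP x) Sx).

Definition os_one : os_type := os_in (os_one_mem S).

Lemma os_valP (x : os_type) : os_set S (val x).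
Proof. exact/os_predP/(valP x). Qed.

End OpSystemType.

Coercion os_type : opSystem >-> Sortclass.

Definition mx_nneg (R : realType) (A : cstarType R) (k : nat) (X : 'M[A]_k) :=
  exists Y : 'M[A]_k, X = \matrix_(i, j) \sum_l cstar (Y l i) *c Y l j.

Definition is_ucp (R : realType) (A B : ucstarType R)
    (S : opSystem A) (S' : opSystem B) (f : S -> S') : Prop :=
  [/\ linear f,
      f (os_one S) = os_one S'
    & forall (k : nat) (X : 'M[S]_k),
        mx_nneg (map_mx val X) -> mx_nneg (map_mx (val \o f) X)].

Definition os_full (R : realType) (A : ucstarType R) : opSystem A :=
  @OpSystem R A setT I (fun _ _ => I) (fun _ _ _ _ _ => I).

Section TensorOpSystem.
Context {R : realType} {P : finCstarType R} {A T : ucstarType R}.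
Variables (t : tensor P A T) (S : opSystem A).

(* The algebraic tensor product of P and S inside T: as (pbase i) is a basis of
   P, it consists of the elements with all their coordinates in S. *)
Definition os_tensor_set : set T := [set z | forall i, os_set S (tcoord t z i)].

Lemma os_scale_mem (a : R[i]) x : os_set S x -> os_set S (a *: x).
Proof. by move=> /os_predP Sx; apply/os_predP; rewrite rpredZ. Qed.

Lemma os_sum_mem (I : Type) (r : seq I) (Q : pred I) (F : I -> A) :
  (forall i, os_set S (F i)) -> os_set S (\sum_(i <- r | Q i) F i).
Proof. by move=> SF; apply/os_predP/rpred_sum => i _; apply/os_predP. Qed.

Lemma os_tensor_one : os_tensor_set cone.
Proof.
by move=> i; rewrite -(tens11 t) tcoord_tens; apply/os_scale_mem/os_one_mem.
Qed.

Lemma os_tensor_star z : os_tensor_set z -> os_tensor_set (cstar z).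
Proof.
move=> Sz i; rewrite -[z](tcoordK t) cstar_sum tcoord_sum.
by apply: os_sum_mem => j; rewrite tens_star tcoord_tens; apply/os_scale_mem/os_star_mem.
Qed.

Lemma os_tensor_lin (a : R[i]) x y :
  os_tensor_set x -> os_tensor_set y -> os_tensor_set (a *: x + y).
Proof. by move=> Sx Sy i; rewrite tcoord_lin; exact: os_lin_mem. Qed.

Definition os_tensor : opSystem T :=
  OpSystem os_tensor_one os_tensor_star os_tensor_lin.

Definition os_tcoord (z : os_tensor) i : S := os_in (os_valP z i).

End TensorOpSystem.

Section TensorMap.
Context {R : realType} {P : finCstarType R} {A T B U : ucstarType R}.
Variables (t : tensor P A T) (u : tensor P B U).
Variables (S : opSystem A) (S' : opSystem B) (f : S -> S').

Lemma os_id_tensor_subproof (z : os_tensor t S) :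
  os_tensor_set u S' (\sum_i tens u (pbase i) (val (f (os_tcoord z i)))).
Proof.
by move=> i; rewrite (tensK u (fun i => val (f (os_tcoord z i)))); exact: os_valP.
Qed.

Definition os_id_tensor (z : os_tensor t S) : os_tensor u S' :=
  @os_in R U (os_tensor u S') _ (os_id_tensor_subproof z).

End TensorMap.

Arguments os_id_tensor {R P A T B U} t u {S S'} f z.

Section SliceSystem.
Context {R : realType} {P : finCstarType R} {O M PM : ucstarType R}.
Variables (tM : tensor P M PM) (Phi : O -> PM).

(* [{linear P -> R[i]^o}] is the whole dual of P, which is finite-dimensional. *)
Definition slices_set : set M :=
  closure (lspan [set y | exists (w : {linear P -> R[i]^o}) (x : O),
                            y = slice tM w (Phi x)]).

Hypothesis P1 : (cone : P) != 0.
Hypothesis PhiP : is_unital_starhom Phi.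

Lemma slices_lin (a : R[i]) x y :
  slices_set x -> slices_set y -> slices_set (a *: x + y).
Proof. by apply: closure_lin => b u v; exact: lspan_lin. Qed.

Lemma slices_one : slices_set cone.
Proof.
apply: (@subset_closure M); apply: sub_lspan.
have [i ci] : exists i : 'I_(pdim P), pcoord i cone != 0.
  apply: contrapT => /forallNP H; move/eqP: P1; apply.
  rewrite (pcoordE (cone : P)) big1// => i _.
  by have /negP/negPn/eqP -> := H i; rewrite scale0r.
exists ((pcoord i cone : R[i])^-1 \*: pcoord i : {linear P -> R[i]^o}), cone.
case: PhiP => _ _ _ ->; rewrite -(tens11 tM) slice_tens /=.
by rewrite [X in X *: _](_ : _ = 1) ?scale1r//; exact: (mulVf ci).
Qed.

Section ConjFunctional.
Variable w : {linear P -> R[i]^o}.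

Definition conj_functional (p : P) : R[i]^o := ((w (cstar p) : R[i])^*)%R.

Fact conj_functional_linear : linear conj_functional.
Proof.
move=> a p q; rewrite /conj_functional cstarD cstarZ linearP.
by rewrite /GRing.scale /= rmorphD rmorphM /= conjCK.
Qed.

HB.instance Definition _ := GRing.isLinear.Build R[i] P R[i]^o *:%R
  conj_functional conj_functional_linear.

Lemma slice_star (x : PM) :
  cstar (slice tM w x) = slice tM conj_functional (cstar x).
Proof.
rewrite -[x in RHS](tcoordK tM) cstar_sum slice_sum /slice cstar_sum.
apply: eq_bigr => i _; rewrite cstarZ tens_star.
by have := slice_tens tM conj_functional; rewrite /slice => ->; rewrite /= /conj_functional cstarK.
Qed.

End ConjFunctional.

Lemma slices_star x : slices_set x -> slices_set (cstar x).
Proof.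
move=> /closure_normP cx; apply/closure_normP => e e0; have [y Xy xy] := cx e e0.
exists (cstar y); last first.
  by rewrite -cstarB cnorm_starE.
have [n [c [v [Xv ->]]]] := Xy.
exists n, (fun i => ((c i)^*)%R), (fun i => cstar (v i)); split; last first.
  by rewrite cstar_sum; apply: eq_bigr => i _; rewrite cstarZ.
move=> i; have [w [z ->]] := Xv i.
exists (conj_functional w), (cstar z); rewrite slice_star.
by case: PhiP => _ _ PhiS _; rewrite PhiS.
Qed.

Definition slices_system : opSystem M := OpSystem slices_one slices_star slices_lin.

Lemma slices_map_subproof (x : O) : os_tensor_set tM slices_system (Phi x).
Proof.
move=> i; apply: (@subset_closure M); apply: sub_lspan.
exists (pcoord i), x.
rewrite /slice (bigD1 i)//= big1 => [|j ji]; rewrite pcoord_base.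
  by rewrite eqxx scale1r addr0.
by rewrite (negPf ji) scale0r.
Qed.

Definition slices_map (x : os_full O) : os_tensor tM slices_system :=
  @os_in R PM (os_tensor tM slices_system) _ (@slices_map_subproof (val x)).

Lemma slices_map_ucp : is_ucp slices_map.
Proof.
have [Phil PhiM PhiS Phi1] := PhiP.
split=> [a x y||k X [Y XY]]; first by apply: val_inj; exact: Phil.
  by apply: val_inj; exact: Phi1.
have Phi0 : Phi 0 = 0.
  by have := Phil (-1) 0 0; rewrite scaler0 addr0 scaleN1r addNr.
exists (map_mx Phi Y); apply/matrixP => i j; rewrite !mxE /=.
have := congr1 (fun Z : 'M[O]_k => Z i j) XY; rewrite !mxE => ->.
have PhiD : {morph Phi : x y / x + y} by move=> x y; rewrite -[x in LHS]scale1r Phil scale1r.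
rewrite (big_morph Phi PhiD Phi0).
by apply: eq_bigr => l _; rewrite PhiM PhiS !mxE.
Qed.

End SliceSystem.

(* Main.v *)
Require Import Defs.
From HB Require Import structures.
From mathcomp Require Import all_boot all_order all_algebra.
From mathcomp Require Import complex lra ring.
From mathcomp Require Import all_classical all_reals all_analysis.

Set Implicit Arguments.
Unset Strict Implicit.
Unset Printing Implicit Defensive.

Import Order.TTheory GRing.Theory Num.Theory.
Import numFieldNormedType.Exports.

Local Open Scope classical_set_scope.
Local Open Scope ring_scope.
Local Open Scope complex_scope.

(* Let [V] be the [O]-representation obtained by GNS from [psi : O -> P (x) A] (the
   module [O (x)_psi (P (x) A)]), with the [A]-valued inner product sliced by the
   trace [tau] of the regular representation of [P], for which an orthonormal basis
   [b_k] satisfies [sum_k b_k b_k^* = 1]. The vectors [xi_k = 1 (x) b_k] are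
   orthonormal in [V], and so [1 (x) xi_g |-> sum_k b_k^* (x) xi_k], with [xi_g] a unit
   vector in their span, extends to a self-adjoint unitary [s] (a Householder
   reflection) in [P (x) X], where [X] is the completion of the adjointable operators
   on [V]. Then [Psi x = s (1 (x) x) s] is a *-homomorphism [O -> P (x) X] whose
   compression by the state [<xi_g, _ xi_g> : X -> A] is [psi]. By universality [Psi]
   comes from a *-homomorphism [M -> X], and its compression to [M -> A] restricts to
   the required map on the slices. It takes its values in [S], which need not be
   closed, because the linear span of the slices of [Phi] is already closed: extending
   in the same way the ucp maps [x |-> h (x) x + (1 - h) (x) s(x) 1], with [s] a state
   of [O] and [0 <= h <= 1], gives bounded maps on [M] that recover the coordinates
   of the elements of the span. *)

(** * Real-valued norms *)

(** With [W = sum_k b_k^* (x) xi_k] the representation [pi] of [O] on [V] satisfies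
    [psi x = W^* (1 (x) pi x) W]. Universality cannot be applied to this directly: [W] involves [P],
    while a *-homomorphism [M -> X] can only be followed by a map [E] on [X] alone, acting as
    [id (x) E]. Hence [W] has to be written as [s (1 (x) xi_g)] with [s] unitary in [P (x) X]. Here
    [xi_g] is chosen so that [<1 (x) xi_g, W> = c 1] with [c] a real number. The difference
    [D = W - 1 (x) xi_g] then has the scalar square [2 (1 - c) 1], and the reflection along [D] is
    given by a closed formula. Both scalars come from [g = c 1] and from [sum_k b_k b_k^* = 1]; the
    trace of the regular representation supplies a basis with this identity without splitting [P]
    into matrix blocks. The Hilbert modules involved have coefficients in an arbitrary C*-algebra,
    so they rest on the positivity of [x^* x]. This is obtained without spectra: square roots are
    limits of an iteration, and positivity is compared with a norm condition. *)

Section RealNorm.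
Context {R : realType}.
Implicit Types a b : R[i].

(** Norms take values in [R[i]]; [cabs] and [nrm] extract the underlying real number, so that
    estimates take place in [R], within reach of [lra] and [nra]. *)
Definition cabs a : R := complex.Re `|a|.

Lemma cabsE a : `|a| = (cabs a)%:C.
Proof. by rewrite /cabs normc_def. Qed.

Lemma cabs_real (t : R) : cabs t%:C = `|t|.
Proof. by rewrite /cabs normc_def /= expr0n /= addr0 sqrtr_sqr. Qed.

Lemma cabs_ge0 a : 0 <= cabs a.
Proof. by rewrite -ler0c -cabsE. Qed.

Context {V : normedModType R[i]}.
Implicit Types x y z : V.

Definition nrm x : R := complex.Re `|x|.

Lemma nrmE x : `|x| = (nrm x)%:C.
Proof. by have := normr_ge0 x; rewrite /nrm lecE; case: `|x| => u v /= /andP[/eqP -> _]. Qed.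

Lemma nrm_ge0 x : 0 <= nrm x.
Proof. by rewrite -ler0c -nrmE. Qed.

Lemma nrm0 : nrm (0 : V) = 0.
Proof. by rewrite /nrm normr0. Qed.

Lemma nrm_eq0 x : nrm x = 0 -> x = 0.
Proof. by move=> x0; apply/eqP; rewrite -normr_eq0 nrmE x0. Qed.

Lemma nrmD x y : nrm (x + y) <= nrm x + nrm y.
Proof. by rewrite -lecR rmorphD /= -!nrmE ler_normD. Qed.

Lemma nrmN x : nrm (- x) = nrm x.
Proof. by rewrite /nrm normrN. Qed.

Lemma nrmB x y : nrm (x - y) <= nrm x + nrm y.
Proof. by rewrite -(nrmN y) nrmD. Qed.

Lemma nrmC x y : nrm (x - y) = nrm (y - x).
Proof. by rewrite -nrmN opprB. Qed.

Lemma nrmZ a x : nrm (a *: x) = cabs a * nrm x.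
Proof. by apply: complexI; rewrite -nrmE normrZ cabsE nrmE rmorphM. Qed.

Lemma nrmZr (t : R) x : nrm (t%:C *: x) = `|t| * nrm x.
Proof. by rewrite nrmZ cabs_real. Qed.

Lemma nrm_tri x y z : nrm (x - z) <= nrm (x - y) + nrm (y - z).
Proof. by rewrite (le_trans _ (nrmD _ _))// addrA subrK. Qed.

Lemma nrm_sum (I : Type) (r : seq I) (Q : pred I) (F : I -> V) :
  nrm (\sum_(i <- r | Q i) F i) <= \sum_(i <- r | Q i) nrm (F i).
Proof.
elim/big_rec2: _ => [|i y x _ xy]; first by rewrite nrm0.
by rewrite (le_trans (nrmD _ _))// lerD2l.
Qed.

Definition lims (u : nat -> V) x :=
  forall e : R, 0 < e -> exists N, forall n, (N <= n)%N -> nrm (u n - x) < e.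

Lemma lims_uniq u x y : lims u x -> lims u y -> x = y.
Proof.
move=> ux uy; apply/eqP; rewrite -subr_eq0; apply/eqP/nrm_eq0/eqP.
rewrite eq_le nrm_ge0 andbT leNgt; apply/negP => xy0.
have [N uN] := ux _ (divr_gt0 xy0 (ltr0Sn _ 1)).
have [M uM] := uy _ (divr_gt0 xy0 (ltr0Sn _ 1)).
have := nrm_tri x (u (maxn N M)) y.
have := uN _ (leq_maxl N M); have := uM _ (leq_maxr N M).
by rewrite [nrm (x - u _)]nrmC; lra.
Qed.

Lemma lims_cst x : lims (fun=> x) x.
Proof. by move=> e e0; exists 0%N => n _; rewrite subrr nrm0. Qed.

End RealNorm.

Section Limits.
Context {R : realType} {V W : normedModType R[i]}.

Lemma limsD (u v : nat -> V) x y :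
  lims u x -> lims v y -> lims (fun n => u n + v n) (x + y).
Proof.
move=> ux vy e e0; have [N uN] := ux _ (divr_gt0 e0 (ltr0Sn _ 1)).
have [M vM] := vy _ (divr_gt0 e0 (ltr0Sn _ 1)).
exists (maxn N M) => n; rewrite geq_max => /andP[/uN un /vM vn].
by rewrite opprD addrACA (le_lt_trans (nrmD _ _))//; lra.
Qed.

Lemma lims_lip (f : V -> W) (c : R) u x :
  (forall y z, nrm (f y - f z) <= c * nrm (y - z)) ->
  lims u x -> lims (fun n => f (u n)) (f x).
Proof.
move=> fc ux e e0.
have c0 : 0 < `|c| + 1 by rewrite ltr_wpDl.
have [N uN] := ux _ (divr_gt0 e0 c0); exists N => n /uN; rewrite ltr_pdivlMr// mulrC => un.
apply: le_lt_trans (fc _ _) (le_lt_trans _ un).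
by rewrite ler_wpM2r ?nrm_ge0//; have := ler_norm c; lra.
Qed.

Lemma lims_sum (I : Type) (r : seq I) (u : I -> nat -> V) x :
  (forall i, lims (u i) (x i)) ->
  lims (fun n => \sum_(i <- r) u i n) (\sum_(i <- r) x i).
Proof.
move=> ux; elim: r => [|i r IH].
  by rewrite big_nil; under eq_fun do rewrite big_nil; exact: lims_cst.
by rewrite big_cons; under eq_fun do rewrite big_cons; exact: limsD.
Qed.

End Limits.

Lemma inv_small {R : realType} (e : R) :
  0 < e -> exists N, forall n, (N <= n)%N -> n.+1%:R^-1 < e.
Proof.
move=> e0; exists (Num.truncn e^-1) => n Nn.
rewrite invf_plt ?posrE//.
have := truncnS_gt e^-1; move/lt_le_trans; apply.
by rewrite ler_nat ltnS.
Qed.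

Section Completeness.
Context {R : realType}.

Lemma lims_complete {V : completeNormedModType R[i]} (u : nat -> V) :
  (forall e : R, 0 < e -> exists N, forall m n, (N <= m)%N -> (N <= n)%N ->
     nrm (u m - u n) < e) ->
  exists x, lims u x.
Proof.
move=> uC.
have /cvg_ex[x ux] : cvg (u @ \oo).
  apply/cauchy_cvgP/cauchy_ballP => e e0.
  have [er eE e0r] : exists2 r : R, e = r%:C & 0 < r.
    by move: e0; rewrite ltcE; case: e => er ei /= /andP[/eqP -> ?]; exists er.
  have [N uN] := uC _ e0r.
  exists ([set u n | n in [set n | (N <= n)%N]], [set u n | n in [set n | (N <= n)%N]]).
    by split => /=; exists N => // n /= Nn; exists n.
  move=> [_ _] /= [[m mN <-] [n nN <-]].
  by rewrite -ball_normE /= nrmE eE ltcR uN.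
exists x => e e0; have e0' : 0 < e%:C by rewrite ltcR.
move/cvgrPdist_lt : ux => /(_ _ e0')[N _ uN]; exists N => n Nn.
by have := uN n Nn; rewrite nrmE ltcR nrmC.
Qed.

Lemma lims_bound_ev {V : normedModType R[i]} (u : nat -> V) x (c : R) N :
  lims u x -> (forall n, (N <= n)%N -> nrm (u n) <= c) -> nrm x <= c.
Proof.
move=> ux uc; rewrite leNgt; apply/negP => cx.
have [M uM] := ux (nrm x - c) ltac:(by rewrite subr_gt0).
have := uM _ (leq_maxl M N); have := uc _ (leq_maxr M N).
have := nrm_tri x (u (maxn M N)) 0.
by rewrite !subr0 [nrm (x - _)]nrmC; lra.
Qed.

Lemma lims_bound {V : normedModType R[i]} (u : nat -> V) x (c : R) :
  lims u x -> (forall n, nrm (u n) <= c) -> nrm x <= c.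
Proof. by move=> ux uc; apply: (@lims_bound_ev _ u x c 0%N). Qed.

End Completeness.

(** * Pre-C*-algebras *)

(** The axioms of a unital C*-algebra except definiteness of the norm and completeness. Operators on
    a degenerate module, their completion and finite amplifications all pass through this interface;
    [mkCStar] turns an instance into a C*-algebra once the two missing properties are known. *)
Record precstar (R : realType) := PreCStar {
  pc_car :> lmodType R[i];
  pmul : pc_car -> pc_car -> pc_car;
  pstar : pc_car -> pc_car;
  pone : pc_car;
  pnm : pc_car -> R;
  pmulA : associative pmul;
  pmulDl : left_distributive pmul +%R;
  pmulDr : right_distributive pmul +%R;
  pscaleAl : forall (a : R[i]) x y, a *: pmul x y = pmul (a *: x) y;
  pscaleAr : forall (a : R[i]) x y, a *: pmul x y = pmul x (a *: y);
  pmul1x : left_id pone pmul;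
  pmulx1 : right_id pone pmul;
  pstarK : involutive pstar;
  pstarD : {morph pstar : x y / x + y};
  pstarZ : forall (a : R[i]) x, pstar (a *: x) = (a^*)%R *: pstar x;
  pstarM : forall x y, pstar (pmul x y) = pmul (pstar y) (pstar x);
  pnmD : forall x y, pnm (x + y) <= pnm x + pnm y;
  pnmZ : forall (a : R[i]) x, pnm (a *: x) = cabs a * pnm x;
  pnmM : forall x y, pnm (pmul x y) <= pnm x * pnm y;
  pnm_star : forall x, pnm (pmul (pstar x) x) = pnm x ^+ 2
}.

Definition pcauchy (R : realType) (B : precstar R) (u : nat -> B) :=
  forall e : R, 0 < e -> exists N, forall m n, (N <= m)%N -> (N <= n)%N ->
     pnm (u m - u n) < e.

Definition plims (R : realType) (B : precstar R) (u : nat -> B) x :=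
  forall e : R, 0 < e -> exists N, forall n, (N <= n)%N -> pnm (u n - x) < e.

Section PreTheory.
Context {R : realType} {B : precstar R}.
Implicit Types x y z : B.

Lemma pnm0 : pnm (0 : B) = 0.
Proof. by rewrite -(scale0r (0 : B)) pnmZ cabs_real normr0 mul0r. Qed.

Lemma pnmN x : pnm (- x) = pnm x.
Proof. by rewrite -scaleN1r -(rmorphN1 (real_complex R)) pnmZ cabs_real normrN1 mul1r. Qed.

Lemma pnm_ge0 x : 0 <= pnm x.
Proof. by have := pnmD x (- x); rewrite subrr pnm0 pnmN; lra. Qed.

Lemma pnmC x y : pnm (x - y) = pnm (y - x).
Proof. by rewrite -pnmN opprB. Qed.

Lemma pnm_tri x y z : pnm (x - z) <= pnm (x - y) + pnm (y - z).
Proof. by rewrite (le_trans _ (pnmD _ _))// addrA subrK. Qed.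

Lemma pmulNx x y : pmul (- x) y = - pmul x y.
Proof. by rewrite -scaleN1r -pscaleAl scaleN1r. Qed.

Lemma pmulxN x y : pmul x (- y) = - pmul x y.
Proof. by rewrite -scaleN1r -pscaleAr scaleN1r. Qed.

Lemma pstarN x : pstar (- x) = - pstar x.
Proof. by rewrite -scaleN1r pstarZ rmorphN1 scaleN1r. Qed.

Lemma pnm_pstar x : pnm (pstar x) = pnm x.
Proof.
have le y : pnm y <= pnm (pstar y).
  have [y0|ny] := leP (pnm y) 0; first exact: le_trans y0 (pnm_ge0 _).
  by rewrite -(ler_pM2r ny) -expr2 -pnm_star pnmM.
by apply/eqP; rewrite eq_le le andbT -[X in _ <= pnm X]pstarK le.
Qed.

End PreTheory.

(** * From separated and complete pre-C*-algebras to C*-algebras *)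

Section Builder.
Context {R : realType} (B : precstar R).
Hypothesis sepB : forall x : B, pnm x = 0 -> x = 0.
Hypothesis complB : forall u : nat -> B, pcauchy u -> exists x, plims u x.

(* The proofs are parameters of the type so that the instances on it can use them. *)
Definition cst_of (sep : forall x : B, pnm x = 0 -> x = 0)
  (compl : forall u : nat -> B, pcauchy u -> exists x, plims u x) : Type := B.

Local Notation T := (cst_of sepB complB).

HB.instance Definition _ := GRing.Lmodule.copy T B.

Definition cst_norm (x : T) : R[i] := (pnm (x : B))%:C.

Fact cst_normD x y : cst_norm (x + y) <= cst_norm x + cst_norm y.
Proof. by rewrite /cst_norm -rmorphD lecR pnmD. Qed.

Fact cst_normZ a x : cst_norm (a *: x) = `|a| * cst_norm x.
Proof. by rewrite /cst_norm cabsE -rmorphM -pnmZ. Qed.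

Fact cst_norm0 x : cst_norm x = 0 -> x = 0.
Proof. by move=> /(@complexI _ _ 0) /sepB. Qed.

HB.instance Definition _ := @Lmodule_isNormed.Build R[i] T cst_norm
  cst_normD cst_normZ cst_norm0.

Fact cst_nrmE (x : T) : nrm x = pnm (x : B).
Proof. by []. Qed.

(** A Cauchy filter contains a ball of radius [1/(n+1)] around some [u n]. Two such balls meet, so
    the centres form a Cauchy sequence, and sequential completeness suffices. *)
Fact cst_complete (F : set_system T) : ProperFilter F -> cauchy F -> cvg F.
Proof.
move=> FF /cauchy_ballP Fc.
have FN (n : nat) : exists x : T, F (ball x (n.+1%:R^-1)%:C).
  have e0 : 0 < (n.+1%:R^-1 / 2 : R)%:C by rewrite ltcR divr_gt0.
  have [[A C] /= [FA FC] AC] := Fc _ e0.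
  have [x [Ax Cx]] := filter_ex (filterI FA FC).
  exists x; apply: filterS FC => y Cy.
  have := AC (x, y) (conj Ax Cy); apply: le_ball.
  by rewrite lecR ler_pdivrMr// ler_peMr// ler1n.
have [u uF] := choice FN.
have ulim m n : pnm (u m - u n : B) <= m.+1%:R^-1 + n.+1%:R^-1.
  have [y [/= my ny]] := filter_ex (filterI (uF m) (uF n)).
  move: my ny; rewrite -!ball_normE /= !nrmE !ltcR !cst_nrmE => um un.
  apply: (le_trans (pnm_tri _ (y : B) _)); apply: lerD; first exact: ltW.
  by rewrite pnmC ltW.
have uC : pcauchy (u : nat -> B).
  move=> e e0; have [N hN] := inv_small (divr_gt0 e0 (ltr0Sn _ 1)).
  exists N => m n /hN hm /hN hn; apply: le_lt_trans (ulim m n) _.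
  by rewrite [ltRHS]splitr ltrD.
have [x ux] := complB uC.
apply/cvg_ex; exists (x : T); apply/cvgrPdist_lt => e e0.
have [er eE e0r] : exists2 r : R, e = r%:C & 0 < r.
  by move: e0; rewrite ltcE; case: e => er ei /= /andP[/eqP -> ?]; exists er.
have [N hN] := inv_small (divr_gt0 e0r (ltr0Sn _ 1)).
have [M hM] := ux _ (divr_gt0 e0r (ltr0Sn _ 1)).
have := uF (maxn N M); apply: filterS => y.
rewrite -ball_normE /= !nrmE eE !ltcR !cst_nrmE => uy.
apply: le_lt_trans (pnm_tri _ (u (maxn N M) : B) _) _.
have := hN _ (leq_maxl N M); have := hM _ (leq_maxr N M); rewrite pnmC => h1 h2.
by rewrite [ltRHS]splitr ltrD// (lt_trans uy).
Qed.

HB.instance Definition _ := Uniform_isComplete.Build T cst_complete.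

Fact cst_nM (x y : T) : `|pmul (x : B) y : T| <= `|x| * `|y|.
Proof. by rewrite !nrmE -rmorphM lecR pnmM. Qed.

Fact cst_nS (x : T) : `|pmul (pstar (x : B)) x : T| = `|x| ^+ 2.
Proof. by rewrite !nrmE -rmorphXn /= !cst_nrmE pnm_star. Qed.

HB.instance Definition _ := @isCStar.Build R T (@pmul R B) (@pstar R B)
  (@pmulA R B) (@pmulDl R B) (@pmulDr R B) (@pscaleAl R B) (@pscaleAr R B)
  (@pstarK R B) (@pstarD R B) (@pstarZ R B) (@pstarM R B) cst_nM cst_nS.

HB.instance Definition _ := @isUnitalCStar.Build R T (pone B)
  (@pmul1x R B) (@pmulx1 R B).

Definition mkCStar : ucstarType R := T.

End Builder.

(** * Norm estimates and limits in a C*-algebra *)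

Section CStarNorm.
Context {R : realType} {A : cstarType R}.
Implicit Types x y z : A.

Lemma nrmM x y : nrm (x *c y) <= nrm x * nrm y.
Proof. by rewrite -lecR rmorphM /= -!nrmE cnormM. Qed.

Lemma nrm_star x : nrm (cstar x) = nrm x.
Proof. by rewrite /nrm cnorm_starE. Qed.

Lemma nrm_cstar x : nrm (cstar x *c x) = nrm x ^+ 2.
Proof. by apply: complexI; rewrite rmorphXn /= -!nrmE cnorm_star. Qed.

Lemma cmulNl x y : (- x) *c y = - (x *c y).
Proof. by rewrite -scaleN1r -cscaleAl scaleN1r. Qed.

Lemma cmulNr x y : x *c (- y) = - (x *c y).
Proof. by rewrite -scaleN1r -cscaleAr scaleN1r. Qed.

Lemma cmulBl x y z : (x - y) *c z = x *c z - y *c z.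
Proof. by rewrite cmulDl cmulNl. Qed.

Lemma cmulBr x y z : x *c (y - z) = x *c y - x *c z.
Proof. by rewrite cmulDr cmulNr. Qed.

Lemma cstarN x : cstar (- x) = - cstar x.
Proof. by rewrite -[- x]add0r cstarB cstar0 add0r. Qed.

Lemma cstarZr (t : R) x : cstar (t%:C *: x) = t%:C *: cstar x.
Proof. by rewrite cstarZ; congr (_ *: _); exact: conjc_real. Qed.

Lemma nrm_sa2 x : cstar x = x -> nrm (x *c x) = nrm x ^+ 2.
Proof. by move=> xs; rewrite -nrm_cstar xs. Qed.

Lemma sa2_eq0 x : cstar x = x -> x *c x = 0 -> x = 0.
Proof.
move=> xs x2; apply: nrm_eq0; apply/eqP.
by rewrite -sqrf_eq0 -nrm_sa2// x2 nrm0.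
Qed.

Lemma cstar_eq0 x : cstar x *c x = 0 -> x = 0.
Proof.
by move=> x2; apply: nrm_eq0; apply/eqP; rewrite -sqrf_eq0 -nrm_cstar x2 nrm0.
Qed.

Lemma limsM (u v : nat -> A) x y :
  lims u x -> lims v y -> lims (fun n => u n *c v n) (x *c y).
Proof.
move=> ux vy e e0.
pose k := nrm x + nrm y + 1.
have k0 : 0 < k by rewrite ltr_wpDl ?addr_ge0 ?nrm_ge0.
have d0 : 0 < Num.min 1 (e / 2 / k) by rewrite lt_min ltr01 !divr_gt0.
have [N uN] := ux _ d0; have [M vM] := vy _ d0.
exists (maxn N M) => n; rewrite geq_max => /andP[/uN un /vM vn].
have -> : u n *c v n - x *c y = (u n - x) *c v n + x *c (v n - y).
  by rewrite cmulBl cmulBr addrA subrK.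
rewrite (le_lt_trans (nrmD _ _))// (le_lt_trans (lerD (nrmM _ _) (nrmM _ _)))//.
move: un vn; rewrite !lt_min => /andP[un1 un2] /andP[vn1 vn2].
have vb : nrm (v n) <= nrm y + 1.
  by have := nrmD (v n - y) y; rewrite subrK; lra.
have y0 := nrm_ge0 y; have x0 := nrm_ge0 x.
have h1 : nrm (u n - x) * nrm (v n) <= e / 2 / k * (nrm y + 1).
  by apply: ler_pM; rewrite ?nrm_ge0//; exact: ltW.
have h2 : nrm x * nrm (v n - y) <= nrm x * (e / 2 / k).
  by rewrite ler_wpM2l// ltW.
have h3 : e / 2 / k * k = e / 2 by rewrite divfK ?gt_eqF.
by move: h3; rewrite {2}/k; move: (e / 2 / k) h1 h2 => q; nra.
Qed.

Lemma lims_star (u : nat -> A) x : lims u x -> lims (fun n => cstar (u n)) (cstar x).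
Proof.
by apply: (@lims_lip _ _ _ _ 1) => y z; rewrite mul1r -cstarB nrm_star.
Qed.

End CStarNorm.

Lemma limsZ {R : realType} {V : normedModType R[i]} (a : R[i]) (u : nat -> V) x :
  lims u x -> lims (fun n => a *: u n) (a *: x).
Proof.
by apply: (@lims_lip _ _ _ _ (cabs a)) => y z; rewrite -scalerBr nrmZ.
Qed.

(** * Positive elements *)

Section SqrtSeq.
Context {R : realType}.

Fixpoint tseq (n : nat) : R := if n is n'.+1 then (1 + tseq n' ^+ 2) / 2 else 0.

Lemma tseq_bnd n : 0 <= tseq n /\ tseq n <= tseq n.+1 /\ tseq n <= 1.
Proof.
elim: n => [|n [t0 [tl t1]]] /=; first by rewrite expr0n /= addr0; lra.
move: (tseq n) t0 tl t1 => t t0 /= tl t1; split; first by nra.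
split; last by nra.
have : t ^+ 2 <= ((1 + t ^+ 2) / 2) ^+ 2 by rewrite ler_sqr ?nnegrE //; nra.
by lra.
Qed.

(** For [d = 1 - tseq n] the recursion reads [d |-> d - d^2 / 2], whose decay is of order [2/n]. The
    explicit rate makes [yseq] a Cauchy sequence. *)
Lemma tseq_lim n : n.+2%:R * (1 - tseq n) <= 2.
Proof.
elim: n => [|n IH]; first by rewrite /= subr0 mulr1.
have /= [t0 [_ t1]] := tseq_bnd n.
rewrite /= -[n.+3%:R]natr1; move: IH.
have : (2 : R) <= n.+2%:R by rewrite ler_nat.
move: (tseq n) n.+2%:R t0 t1 => t m t0 t1 m2 mt.
have -> : (m + 1) * (1 - (1 + t ^+ 2) / 2) = (m + 1) * (1 - t) * (1 + t) / 2 by field.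
set d := 1 - t; have -> : 1 + t = 2 - d by rewrite /d; ring.
have d0 : 0 <= d by rewrite subr_ge0.
have {}mt : m * d <= 2 by [].
have -> : (m + 1) * d * (2 - d) / 2 = (m * d) + d - (m * d) * d / 2 - d ^+ 2 / 2 by field.
have : d * (2 - m * d) <= 2 - m * d.
  rewrite -[leRHS]mul1r ler_wpM2r ?subr_ge0//; rewrite /d; lra.
have : 0 <= d ^+ 2 by rewrite sqr_ge0.
nra.
Qed.

Context {A : ucstarType R}.
Implicit Types x y z h : A.

(** Only an inequality, because [cone = 0] in the zero algebra. *)
Lemma nrm1_le1 : nrm (cone : A) <= 1.
Proof.
have := nrm_cstar (cone : A); rewrite cstar1 cmul1x.
by have [//|] := leP (nrm (cone : A)) 1; nra.
Qed.

Fixpoint yseq x (n : nat) : A :=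
  if n is n'.+1 then (2^-1 : R)%:C *: (x + yseq x n' *c yseq x n') else 0.

Lemma yseq_bnd x n : nrm x <= 1 -> nrm (yseq x n) <= tseq n.
Proof.
move=> x1; elim: n => [|n IH] /=; first by rewrite nrm0.
rewrite nrmZr ger0_norm ?invr_ge0// mulrC ler_pM2r ?invr_gt0//.
rewrite (le_trans (nrmD _ _))// lerD//.
by rewrite (le_trans (nrmM _ _))// expr2 ler_pM ?nrm_ge0.
Qed.

Lemma csub_sqr y z : y *c y - z *c z = y *c (y - z) + (y - z) *c z.
Proof. by rewrite cmulBr cmulBl addrA subrK. Qed.

Lemma yseq_step x n : nrm x <= 1 ->
  nrm (yseq x n.+1 - yseq x n) <= tseq n.+1 - tseq n.
Proof.
move=> x1; elim: n => [|n IH].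
  rewrite /= !subr0 cmul0x addr0 expr0n /= addr0 nrmZr ger0_norm ?invr_ge0//.
  by rewrite mulrC ler_pM2r ?invr_gt0.
have -> : yseq x n.+2 - yseq x n.+1 =
    (2^-1 : R)%:C *: (yseq x n.+1 *c yseq x n.+1 - yseq x n *c yseq x n).
  transitivity ((2^-1 : R)%:C *: (x + yseq x n.+1 *c yseq x n.+1) -
    (2^-1 : R)%:C *: (x + yseq x n *c yseq x n)); first by [].
  by rewrite -scalerBr opprD addrACA subrr add0r.
rewrite nrmZr ger0_norm ?invr_ge0// csub_sqr.
have -> : tseq n.+2 = (1 + tseq n.+1 ^+ 2) / 2 by [].
have ts : tseq n.+1 = (1 + tseq n ^+ 2) / 2 by [].
have := yseq_bnd n x1; have := yseq_bnd n.+1 x1.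
move: (yseq x n.+1) (yseq x n) IH => y z.
move: (tseq n.+1) (tseq n) ts => t s ts IH yt zs.
have := nrmD (y *c (y - z)) ((y - z) *c z).
have := nrmM y (y - z); have := nrmM (y - z) z.
have : nrm y * nrm (y - z) <= t * (t - s) by rewrite ler_pM ?nrm_ge0.
have : nrm (y - z) * nrm z <= (t - s) * s by rewrite ler_pM ?nrm_ge0.
lra.
Qed.

Lemma yseq_dist x m n : nrm x <= 1 -> (m <= n)%N ->
  nrm (yseq x n - yseq x m) <= tseq n - tseq m.
Proof.
move=> x1 /subnK <-; elim: (n - m)%N => [|k IH]; first by rewrite !subrr nrm0.
rewrite addSn (le_trans (nrm_tri _ (yseq x (k + m)) _))//.
by have := yseq_step (k + m) x1; move: IH; lra.
Qed.

(* The iteration [y <- (x + y^2)/2] converges to [1 - sqrt (1 - x)]: its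
   increments are dominated by those of the scalar iteration at [x = 1]. *)
Lemma sqrt_fix x : nrm x <= 1 -> exists y,
  [/\ y + y = x + y *c y, nrm y <= 1, cstar x = x -> cstar y = y
    & forall z, x *c z = z *c x -> y *c z = z *c y].
Proof.
move=> x1.
have [y ly] : exists y, lims (yseq x) y.
  apply: lims_complete => e e0.
  have [N hN] := inv_small (divr_gt0 e0 (ltr0Sn _ 1)).
  have H m n : (N <= m)%N -> (m <= n)%N -> nrm (yseq x n - yseq x m) < e.
    move=> Nm mn; apply: (le_lt_trans (yseq_dist x1 mn)).
    have [_ [_ tn]] := tseq_bnd n; have tm := tseq_lim m.
    have := hN m.+1 (leqW Nm); rewrite invf_plt ?posrE ?divr_gt0// invf_div.
    rewrite ltr_pdivrMr// => me; have : 1 - tseq m < e; last by lra.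
    rewrite -(@ltr_pM2l _ m.+2%:R)//; exact: le_lt_trans tm _.
  exists N => m n Nm Nn; have [mn|/ltnW nm] := leqP m n; last exact: H.
  by rewrite nrmC; exact: H.
exists y; split.
- have lim2 : lims (fun n => yseq x n.+1) ((2^-1 : R)%:C *: (x + y *c y)).
    by apply: limsZ; apply: limsD; [exact: lims_cst|exact: limsM].
  have yE : y = (2^-1 : R)%:C *: (x + y *c y).
    apply: lims_uniq lim2 => e e0; have [N hN] := ly e e0.
    by exists N => n Nn; apply: hN; exact: leqW.
  rewrite {1 2}yE -scalerDl -rmorphD /=.
  have -> : (2^-1 + 2^-1 : R) = 1 by field.
  by rewrite scale1r.
- apply: lims_bound ly _ => n; apply: le_trans (yseq_bnd n x1) _.
  by have [_ []] := tseq_bnd n.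
- move=> xs; apply: lims_uniq (lims_star ly) _.
  rewrite (_ : (fun n => _) = yseq x)//; apply/funext; elim=> [|n IH] /=.
    exact: cstar0.
  by rewrite cstarZr cstarD cstarM IH xs.
- move=> z xz; apply: lims_uniq (limsM ly (lims_cst z)) _.
  rewrite (_ : (fun n => _) = fun n => z *c yseq x n).
    exact: limsM (lims_cst z) ly.
  apply/funext; elim=> [|n IH] /=; first by rewrite cmul0x cmulx0.
  by rewrite -cscaleAl -cscaleAr cmulDl cmulDr xz -cmulA IH cmulA IH cmulA.
Qed.

(** The root is [1 - y] with [y] from [sqrt_fix]. The bound on [cone - s] is what remains of the
    positivity of the root; it lets roots be extracted again. *)
Lemma sqrt1B x : cstar x = x -> nrm x <= 1 -> exists s,
  [/\ cstar s = s, s *c s = cone - x, nrm (cone - s) <= 1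
    & forall z, x *c z = z *c x -> s *c z = z *c s].
Proof.
move=> xs /sqrt_fix[y [y2 y1 /(_ xs) ys yc]]; exists (cone - y); split.
- by rewrite cstarB cstar1 ys.
- rewrite cmulBl !cmulBr !cmul1x !cmulx1.
  have -> : x = y + y - y *c y by rewrite y2 addrK.
  by rewrite -addrA -opprD addrA.
- by rewrite opprB addrC subrK.
- by move=> z /yc yz; rewrite cmulBl cmulBr cmul1x cmulx1 yz.
Qed.

End SqrtSeq.

Section Positivity.
Context {R : realType} {A : ucstarType R}.
Implicit Types a b h k x y z : A.

Lemma addxx x : x + x = (2 : R)%:C *: x.
Proof.
rewrite -{1 2}[x]scale1r -scalerDl; congr (_ *: _).
by apply/eqP; rewrite eq_complex /= addr0 !eqxx.
Qed.

(** Positivity without spectra. [pos_ball] and [ball_pos] tie it to the condition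
    [nrm (t - a) <= t], which, unlike being a square, is visibly stable under sums and limits. *)
Definition pos a := exists2 h, cstar h = h & a = h *c h.

Lemma pos_sa a : pos a -> cstar a = a.
Proof. by move=> [h hs ->]; rewrite cstarM hs. Qed.

(* [h + i sqrt (1 - h^2)] is unitary. *)
Lemma sa_ball h : cstar h = h -> nrm h <= 1 -> nrm (cone - h *c h) <= 1.
Proof.
move=> hs h1.
have x1 : nrm (h *c h) <= 1 by rewrite nrm_sa2// expr_le1// nrm_ge0.
have xs : cstar (h *c h) = h *c h by rewrite cstarM hs.
have [s [ss s2 _ sc]] := sqrt1B xs x1.
have {}sc : s *c h = h *c s by apply: sc; rewrite cmulA.
pose u := h + 'i%C *: s.
have us : cstar u = h - 'i%C *: s.
  rewrite cstarD cstarZ hs ss -scaleNr; congr (_ + _ *: _).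
  by apply/eqP; rewrite eq_complex /= oppr0 !eqxx.
have uu : cstar u *c u = cone.
  rewrite us cmulBl !cmulDr -!cscaleAl -!cscaleAr scalerA -expr2 sqr_i scaleN1r sc.
  by rewrite opprD opprK addrA addrK s2 addrC subrK.
have u1 : nrm u <= 1.
  by rewrite -(@expr_le1 _ 2)// ?nrm_ge0// -nrm_cstar uu nrm1_le1.
have s1 : nrm s <= 1.
  have : nrm (u - cstar u) <= 2.
    by have := nrmB u (cstar u); rewrite nrm_star; lra.
  rewrite us opprB addrC addrA subrK -scalerDl nrmZ.
  have -> : cabs ('i + 'i) = 2 :> R.
    rewrite /cabs normc_def /= addr0 expr0n add0r sqrtr_sqr ger0_norm; lra.
  by lra.
by rewrite -s2 nrm_sa2// expr_le1// nrm_ge0.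
Qed.

Lemma pos_ball a (t : R) : pos a -> nrm a <= t -> nrm (t%:C *: cone - a) <= t.
Proof.
move=> [h hs ->]; rewrite nrm_sa2// => ht.
have t0 : 0 <= t by apply: le_trans ht; exact: sqr_ge0.
have [t1|t1|t0'] := ltgtP t 0; first by move: t0; rewrite leNgt t1.
  pose r := Num.sqrt t.
  have r0 : 0 < r by rewrite sqrtr_gt0.
  have rt : r ^+ 2 = t by rewrite sqr_sqrtr.
  have := @sa_ball ((r^-1)%:C *: h); rewrite cstarZr hs nrmZr => /(_ erefl).
  rewrite gtr0_norm ?invr_gt0// [_ * nrm h]mulrC ler_pdivrMr// mul1r.
  rewrite -(@ler_sqr _ _ r) ?nnegrE ?nrm_ge0 ?(ltW r0)// rt => /(_ ht) H.
  have -> : t%:C *: cone - h *c h = t%:C *: (cone - ((r^-1)%:C *: h) *c ((r^-1)%:C *: h)).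
    rewrite scalerBr -cscaleAl -cscaleAr !scalerA -!rmorphM /= -rt.
    by rewrite expr2 -mulrA mulVKf ?gt_eqF// divff ?gt_eqF// scale1r.
  by rewrite nrmZr gtr0_norm// -[leRHS]mulr1 ler_pM2l.
move: ht; rewrite t0' => ht.
have : nrm h = 0 by apply/eqP; rewrite -sqrf_eq0 eq_le ht sqr_ge0.
by move/nrm_eq0 => ->; rewrite cmul0x scale0r subrr nrm0.
Qed.

(** After scaling, [a = t (1 - x)] with [nrm x <= 1], and [sqrt1B] applies. The root satisfies a
    ball condition of its own, so it is again positive. *)
Lemma ball_sqrt a (t : R) : cstar a = a -> nrm (t%:C *: cone - a) <= t ->
  exists k, [/\ cstar k = k, k *c k = a,
     exists r : R, nrm (r%:C *: cone - k) <= r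
    & forall z, a *c z = z *c a -> k *c z = z *c k].
Proof.
move=> as_ at_; have t0 : 0 <= t by apply: le_trans at_; exact: nrm_ge0.
have [t1|t1|t0'] := ltgtP t 0; first by move: t0; rewrite leNgt t1.
  pose x := cone - (t^-1)%:C *: a.
  have xs : cstar x = x by rewrite cstarB cstar1 cstarZr as_.
  have x1 : nrm x <= 1.
    have -> : x = (t^-1)%:C *: (t%:C *: cone - a).
      by rewrite scalerBr scalerA -rmorphM /= mulVf ?gt_eqF// scale1r.
    by rewrite nrmZr ger0_norm ?invr_ge0// mulrC ler_pdivrMr// mul1r.
  have [s [ss s2 s1 sc]] := sqrt1B xs x1.
  pose r := Num.sqrt t; have rt : r ^+ 2 = t by rewrite sqr_sqrtr.
  exists (r%:C *: s); split.
  - by rewrite cstarZr ss.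
  - rewrite -cscaleAl -cscaleAr scalerA s2 /x opprB addrC subrK scalerA.
    by rewrite -!rmorphM /= -expr2 rt divff ?gt_eqF// scale1r.
  - exists r; rewrite -scalerBr nrmZr ger0_norm ?sqrtr_ge0//.
    by rewrite -[leRHS]mulr1 ler_wpM2l ?sqrtr_ge0.
  - move=> z az; rewrite -cscaleAl -cscaleAr sc// /x.
    by rewrite cmulBl cmulBr cmul1x cmulx1 -cscaleAl -cscaleAr az.
move: at_; rewrite t0' scale0r add0r nrmN => a0.
have -> : a = 0 by apply: nrm_eq0; apply/eqP; rewrite eq_le a0 nrm_ge0.
exists 0; split; rewrite ?cstar0 ?cmul0x//.
by exists 0; rewrite scale0r subrr nrm0.
Qed.

Lemma ball_pos a (t : R) : cstar a = a -> nrm (t%:C *: cone - a) <= t -> pos a.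
Proof. by move=> as_ /(ball_sqrt as_)[k [ks <- _ _]]; exists k. Qed.

Lemma pos_sqrt a : pos a -> exists k, [/\ pos k, k *c k = a
    & forall z, a *c z = z *c a -> k *c z = z *c k].
Proof.
move=> pa; have [k [ks ka [r kr] kc]] := ball_sqrt (pos_sa pa) (pos_ball pa (lexx _)).
by exists k; split=> //; exact: ball_pos kr.
Qed.

Lemma pos0 : pos 0.
Proof. by exists 0; rewrite ?cstar0 ?cmul0x. Qed.

Lemma posZ (t : R) a : 0 <= t -> pos a -> pos (t%:C *: a).
Proof.
move=> t0 [h hs ->]; exists ((Num.sqrt t)%:C *: h); first by rewrite cstarZr hs.
by rewrite -cscaleAl -cscaleAr scalerA -rmorphM /= -expr2 sqr_sqrtr.
Qed.

Lemma posD a b : pos a -> pos b -> pos (a + b).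
Proof.
move=> pa pb; apply: (@ball_pos _ (nrm a + nrm b)).
  by rewrite cstarD !pos_sa.
rewrite rmorphD /= scalerDl opprD addrACA (le_trans (nrmD _ _))//.
by rewrite lerD// pos_ball.
Qed.

Lemma pos_sum (I : Type) (r : seq I) (Q : pred I) (F : I -> A) :
  (forall i, pos (F i)) -> pos (\sum_(i <- r | Q i) F i).
Proof. by move=> pF; elim/big_ind: _ => //; [exact: pos0|exact: posD]. Qed.

Lemma pos_lims (u : nat -> A) a : (forall n, pos (u n)) -> lims u a -> pos a.
Proof.
move=> pu ua.
have as_ : cstar a = a.
  apply: lims_uniq (lims_star ua) _; rewrite (_ : (fun n => _) = u)//.
  by apply/funext => n; exact: pos_sa.
apply: (@ball_pos _ (nrm a)) => //; apply/ler_addgt0Pr => e e0.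
have [N uN] := ua _ (divr_gt0 e0 (ltr0Sn _ 2)); have {}uN := uN _ (leqnn N).
have h : nrm (u N) <= nrm a + e / 3.
  by have := nrmD (u N - a) a; rewrite subrK; lra.
have := pos_ball (pu N) h; rewrite rmorphD /= scalerDl.
move=> h2; have -> : (nrm a)%:C *: cone - a =
  ((nrm a)%:C *: cone + (e / 3)%:C *: cone - u N) + (u N - a) - (e / 3)%:C *: cone.
  by rewrite addrA subrK addrAC addrK.
have := nrmB ((nrm a)%:C *: cone + (e / 3)%:C *: cone - u N + (u N - a)) ((e / 3)%:C *: (cone : A)).
have := nrmD ((nrm a)%:C *: cone + (e / 3)%:C *: cone - u N) (u N - a).
rewrite [nrm ((e / 3)%:C *: _)]nrmZr ger0_norm ?divr_ge0// ?(ltW e0)//.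
have : e / 3 * nrm (cone : A) <= e / 3.
  by rewrite -[leRHS]mulr1 ler_wpM2l ?nrm1_le1// divr_ge0// ltW.
lra.
Qed.

(** Let [h^2 = a] and [k^2 = t - a] be commuting roots. Then [u = h + i k] has [u^* u = t], so its
    real part [h] has norm at most [sqrt t]. *)
Lemma pos_nrm_le a (t : R) : 0 <= t -> pos a -> pos (t%:C *: cone - a) -> nrm a <= t.
Proof.
move=> t0 pa pb; have [h [ph h2 hc]] := pos_sqrt pa.
have [k [pk k2 kc]] := pos_sqrt pb.
have kh : k *c h = h *c k.
  apply: kc; rewrite cmulBl cmulBr -cscaleAl -cscaleAr cmul1x cmulx1.
  by rewrite -h2 cmulA.
pose u := h + 'i%C *: k.
have us : cstar u = h - 'i%C *: k.
  rewrite cstarD cstarZ (pos_sa ph) (pos_sa pk) -scaleNr; congr (_ + _ *: _).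
  by apply/eqP; rewrite eq_complex /= oppr0 !eqxx.
have uu : cstar u *c u = t%:C *: cone.
  rewrite us cmulBl !cmulDr -!cscaleAl -!cscaleAr scalerA -expr2 sqr_i scaleN1r kh.
  by rewrite opprD opprK addrA addrK h2 k2 addrC subrK.
have u1 : nrm u <= Num.sqrt t.
  rewrite -(@ler_sqr _ _ _) ?nnegrE ?nrm_ge0 ?sqrtr_ge0//.
  rewrite -nrm_cstar uu sqr_sqrtr// nrmZr ger0_norm//.
  by rewrite -[leRHS]mulr1 ler_wpM2l// nrm1_le1.
have h1 : nrm h <= Num.sqrt t.
  have : nrm (u + cstar u) <= 2 * Num.sqrt t.
    by have := nrmD u (cstar u); rewrite nrm_star; lra.
  have -> : u + cstar u = (2 : R)%:C *: h.
    by rewrite us addrACA subrr addr0 addxx.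
  by rewrite nrmZr ger0_norm//; lra.
rewrite -h2 nrm_sa2 ?(pos_sa ph)//.
by rewrite -[leRHS]sqr_sqrtr// ler_sqr ?nnegrE ?nrm_ge0 ?sqrtr_ge0.
Qed.

Lemma pos_nrmB a : cstar a = a -> pos ((nrm a)%:C *: cone - a).
Proof.
move=> as_; apply: (@ball_pos _ (nrm a)); last by rewrite opprB addrC subrK.
by rewrite cstarB cstarZr cstar1 as_.
Qed.

Lemma pos_mono_nrm a b : pos a -> pos (b - a) -> nrm a <= nrm b.
Proof.
move=> pa pab; apply: (pos_nrm_le (nrm_ge0 b) pa).
have sb : cstar b = b by rewrite -[b](subrK a) cstarD (pos_sa pab) (pos_sa pa).
by have := posD (pos_nrmB sb) pab; rewrite addrA subrK.
Qed.

Lemma pos_anti a : pos a -> pos (- a) -> a = 0.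
Proof.
move=> pa pna; apply: nrm_eq0; apply/eqP; rewrite eq_le nrm_ge0 andbT.
by have := @pos_mono_nrm a 0 pa; rewrite sub0r nrm0; apply.
Qed.

(* If [y^*y = - e^2], then [yy^* >= 0] and [(1 + s e^2)^n e^2] has the norm of
   [y^* (1 - s yy^* )^n y], hence stays bounded; it dominates [n s e^4]. *)
Lemma neg_star_eq0 y e : cstar e = e -> cstar y *c y = - (e *c e) -> e = 0.
Proof.
move=> es ye.
pose D := y *c cstar y.
have pD : pos D.
  (* Up to sign, [p] and [q] are twice the real and imaginary parts of [y]. Since
     [p^2 + q^2 = 2 (y y^* + y^* y)] and [y^* y = - e^2], the element [2 D] is a sum of squares. *)
  pose p := y + cstar y; pose q := 'i%C *: (y - cstar y).
  have ps : cstar p = p by rewrite cstarD cstarK addrC.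
  have qs : cstar q = q.
    rewrite cstarZ cstarB cstarK -opprB scalerN -scaleNr; congr (_ *: _).
    by apply/eqP; rewrite eq_complex /= oppr0 opprK !eqxx.
  have pq : p *c p + q *c q = D + D + (cstar y *c y + cstar y *c y).
    rewrite /q -cscaleAl -cscaleAr scalerA -expr2 sqr_i scaleN1r.
    rewrite cmulBl !cmulBr !cmulDl !cmulDr -/D.
    move: (y *c y) (cstar y *c cstar y) (cstar y *c y) => u v w.
    have -> : u + D + (w + v) = (D + w) + (u + v) by rewrite [w + v]addrC addrACA addrC.
    have -> : u - D - (w - v) = (u + v) - (D + w) by rewrite opprB addrACA -opprD.
    by rewrite opprB addrACA subrr addr0 [RHS]addrACA.
  have -> : D = (2^-1 : R)%:C *: (p *c p + q *c q + (e *c e + e *c e)).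
    rewrite pq ye -opprD subrK addxx scalerA -rmorphM /=.
    by rewrite mulVf// scale1r.
  apply: posZ; first by rewrite invr_ge0.
  by do !apply: posD; [exists p|exists q|exists e|exists e].
pose s := (nrm D + 1)^-1.
have s0 : 0 < s by rewrite invr_gt0 ltr_wpDl ?nrm_ge0.
have sD : nrm (cone - s%:C *: D) <= 1.
  have := @pos_ball (s%:C *: D) 1 (posZ (ltW s0) pD); rewrite scale1r; apply.
  rewrite nrmZr gtr0_norm// /s mulrC ler_pdivrMr ?ltr_wpDl ?nrm_ge0//.
  by rewrite mul1r lerDl.
(* [z n] is [(1 + s e^2)^n e^2] and [c n] is [(1 - s D)^n]; they are linked by
   [y^* (c n) y = - z n]. The choice of [s] makes [1 - s D] a contraction. *)
pose z := fix z n := if n is n'.+1 then z n' + s%:C *: (e *c z n' *c e) else e *c e.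
pose c := fix c n := if n is n'.+1 then (cone - s%:C *: D) *c c n' else cone.
have ez n : e *c z n = z n *c e.
  elim: n => [|n IH] /=; first by rewrite cmulA.
  by rewrite cmulDr cmulDl -cscaleAr -cscaleAl IH !cmulA IH.
have zc n : cstar y *c c n *c y = - z n.
  elim: n => [|n IH] /=; first by rewrite cmulx1 ye.
  have -> : cstar y *c ((cone - s%:C *: D) *c c n) *c y =
      cstar y *c c n *c y - s%:C *: ((cstar y *c y) *c (cstar y *c c n *c y)).
    rewrite cmulBl cmul1x cmulBr cmulBl; congr (_ - _).
    by rewrite /D -!cscaleAl -!cscaleAr -!cscaleAl !cmulA.
  by rewrite IH ye cmulNl cmulNr opprK opprD -!cmulA -ez.
have cn n : nrm (c n) <= 1.
  elim: n => [|n IH] /=; first exact: nrm1_le1.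
  by rewrite (le_trans (nrmM _ _))// mulr_ile1 ?nrm_ge0.
have zn n : nrm (z n) <= nrm y ^+ 2.
  rewrite -nrmN -zc (le_trans (nrmM _ _))// expr2 ler_wpM2r ?nrm_ge0//.
  by rewrite (le_trans (nrmM _ _))// nrm_star ler_piMr ?nrm_ge0 ?cn.
(* [Q f] asks that every [e^j f e^j] be positive. It is stable under [f |-> e f e] by construction,
   and so replaces the positivity of products of commuting positive elements. *)
pose Q f := forall j, pos (iter j (fun x => e *c x *c e) f).
have Qee f : Q f -> Q (e *c f *c e) by move=> Qf j; have := Qf j.+1; rewrite iterSr.
have iterD j f g : iter j (fun x => e *c x *c e) (f + g) =
    iter j (fun x => e *c x *c e) f + iter j (fun x => e *c x *c e) g.
  by elim: j => [//|j IH] /=; rewrite IH cmulDr cmulDl.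
have QD f g : Q f -> Q g -> Q (f + g).
  by move=> Qf Qg j; rewrite iterD; apply: posD.
have QZ f : Q f -> Q (s%:C *: f).
  move=> Qf j; have -> : iter j (fun x => e *c x *c e) (s%:C *: f) =
      s%:C *: iter j (fun x => e *c x *c e) f.
    by elim: j => [//|j IH] /=; rewrite IH -cscaleAr -cscaleAl.
  exact: posZ (ltW s0) (Qf j).
have Qq : Q (e *c e).
  move=> j; have [g [gs ge ->]] : exists g, [/\ cstar g = g, g *c e = e *c g
      & iter j (fun x => e *c x *c e) (e *c e) = g *c g].
    elim: j => [|j [g [gs ge IH]]] /=; first by exists e.
    exists (e *c g); split; first by rewrite cstarM gs es.
      by rewrite -cmulA ge.
    by rewrite IH !cmulA -[_ *c g *c e]cmulA ge !cmulA.
  by exists g.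
have Qzq n : Q (z n - e *c e).
  elim: n => [|n IH] /=.
    rewrite subrr => j; have -> : iter j (fun x => e *c x *c e) 0 = 0.
      by elim: j => [//|j /= ->]; rewrite cmulx0 cmul0x.
    exact: pos0.
  rewrite addrAC; apply: (QD _ _ IH); apply: QZ; apply: Qee.
  by rewrite -[z n](subrK (e *c e)); apply: QD.
pose e4 := e *c (e *c e) *c e.
have Qz4 n : Q (z n - (n%:R * s)%:C *: e4).
  elim: n => [|n IH] /=; first by rewrite mul0r scale0r subr0.
  have -> : z n + s%:C *: (e *c z n *c e) - (n.+1%:R * s)%:C *: e4 =
      (z n - (n%:R * s)%:C *: e4) + s%:C *: (e *c (z n - e *c e) *c e).
    rewrite cmulBr cmulBl scalerBr -/e4 -natr1 mulrDl mul1r rmorphD /= scalerDl.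
    by rewrite opprD addrACA.
  by apply: (QD _ _ IH); apply: QZ; apply: Qee.
have e4s : pos e4 by have := Qq 1%N.
have bnd n : n%:R * s * nrm e4 <= nrm y ^+ 2.
  have ns0 : 0 <= n%:R * s by rewrite mulr_ge0// ltW.
  rewrite -[n%:R * s]ger0_norm// -nrmZr (le_trans _ (zn n))//.
  by apply: pos_mono_nrm; [exact: posZ|exact: (Qz4 n 0%N)].
have e40 : nrm e4 = 0.
  apply/eqP; rewrite eq_le nrm_ge0 andbT leNgt; apply/negP => e40.
  have se0 : 0 < s * nrm e4 by rewrite mulr_gt0.
  have := bnd (Num.truncn (nrm y ^+ 2 / (s * nrm e4))).+1.
  rewrite -mulrA -ler_pdivlMr// leNgt => /negP; apply; exact: truncnS_gt.
move/nrm_eq0 : e40; rewrite /e4 cmulA => e40.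
apply: sa2_eq0 => //; apply: sa2_eq0; first by rewrite cstarM es.
by rewrite !cmulA.
Qed.

(* With [n] the negative part of [b], [n b n = - n^3] and [n^3] is a square. *)
Lemma neg_part b : cstar b = b -> exists n e,
  [/\ cstar n = n, cstar e = e, n *c b *c n = - (e *c e) & e = 0 -> pos b].
Proof.
move=> bs.
have [m [pm m2 mc]] : exists m, [/\ pos m, m *c m = b *c b
    & forall z, (b *c b) *c z = z *c (b *c b) -> m *c z = z *c m].
  by apply: pos_sqrt; exists b.
have mb : m *c b = b *c m by apply: mc; rewrite cmulA.
have ms := pos_sa pm.
pose n := (2^-1 : R)%:C *: (m - b).
have ns : cstar n = n by rewrite cstarZr cstarB ms bs.
have mn : m *c n = n *c m.
  by rewrite -cscaleAr -cscaleAl cmulBr cmulBl mb.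
(* Here [m] is [|b|], and [n m = n^2] is shown below. Hence [(k n)^2 = m n^2 = n^3], and [k n] is
   the required [e]. *)
have [k [pk k2 kc]] := pos_sqrt pm; have ks := pos_sa pk.
have kn : k *c n = n *c k by apply: kc.
have n2 : m - b = (2 : R)%:C *: n.
  by rewrite scalerA -rmorphM /= divff// scale1r.
have nbm : n *c b = - (n *c m).
  apply/eqP; rewrite -subr_eq0 opprK addrC -cmulDr -cscaleAl cmulBl !cmulDr.
  by rewrite m2 mb [b *c m + _]addrC subrr scaler0.
have nm : n *c m = n *c n.
  have := congr1 (fun x => (2^-1 : R)%:C *: (n *c x)) n2.
  rewrite cmulBr nbm opprK addxx -cscaleAr !scalerA -rmorphM /=.
  by rewrite mulVf// !scale1r.
exists n, (k *c n); split=> [//|||e0].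
- by rewrite cstarM ks ns kn.
- by rewrite nbm cmulNl -k2 !cmulA -kn.
have n0 : n = 0.
  have n3 : n *c n *c n = 0 by rewrite -nm -k2 -!cmulA e0 !cmulx0.
  apply: sa2_eq0 => //; apply: sa2_eq0; first by rewrite cstarM ns.
  by rewrite cmulA n3 cmul0x.
by move: n2; rewrite n0 scaler0 => /eqP; rewrite subr_eq0 => /eqP <-.
Qed.

(** For [n] the negative part of [x^* x], the element [y = x n] has [y^* y = n (x^* x) n = - e^2].
    This forces [e = 0] by [neg_star_eq0], and then there is no negative part. *)
Theorem pos_cstar x : pos (cstar x *c x).
Proof.
have [|n [e [ns es nbn]]] := @neg_part (cstar x *c x).
  by rewrite cstarM cstarK.
apply; apply: (@neg_star_eq0 (x *c n)) => //.
by rewrite cstarM ns -nbn !cmulA.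
Qed.

Lemma pos_conj x a : pos a -> pos (cstar x *c a *c x).
Proof.
move=> [h hs ->]; rewrite [X in pos X](_ : _ = cstar (h *c x) *c (h *c x)).
  exact: pos_cstar.
by rewrite cstarM hs !cmulA.
Qed.

End Positivity.

(** * Adjointable operators *)

(* The inner product may be degenerate, and [pact] is not required to be an action:
   only its compatibility with the inner product matters. *)
Record premod (R : realType) (A : ucstarType R) := PreMod {
  pm_car :> lmodType R[i];
  pact : pm_car -> A -> pm_car;
  pip : pm_car -> pm_car -> A;
  pip_lin : forall x (a : R[i]) y z, pip x (a *: y + z) = a *: pip x y + pip x z;
  pip_star : forall x y, cstar (pip x y) = pip y x;
  pact_lin : forall x (c : R[i]) a b, pact x (c *: a + b) = c *: pact x a + pact x b;
  pip_act : forall x y a, pip x (pact y a) = pip x y *c a;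
  pip_pos : forall x, pos (pip x x)
}.

Section PreMod.
Context {R : realType} {A : ucstarType R} {V : premod A}.
Implicit Types x y z : V.

Lemma pip0r x : pip x 0 = 0.
Proof. by have := pip_lin x (-1) 0 0; rewrite scaler0 addr0 scaleN1r addNr. Qed.

Lemma pipDr x y z : pip x (y + z) = pip x y + pip x z.
Proof. by have := pip_lin x 1 y z; rewrite !scale1r. Qed.

Lemma pipZr x a y : pip x (a *: y) = a *: pip x y.
Proof. by rewrite -[a *: y]addr0 pip_lin pip0r addr0. Qed.

Lemma pipNr x y : pip x (- y) = - pip x y.
Proof. by rewrite -scaleN1r pipZr scaleN1r. Qed.

Lemma pipDl x y z : pip (x + y) z = pip x z + pip y z.
Proof. by rewrite -pip_star pipDr cstarD !pip_star. Qed.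

Lemma pipZl x a y : pip (a *: x) y = (a^*)%R *: pip x y.
Proof. by rewrite -pip_star pipZr cstarZ pip_star. Qed.

Lemma pipNl x y : pip (- x) y = - pip x y.
Proof. by rewrite -pip_star pipNr cstarN pip_star. Qed.

Lemma pip_actl x y a : pip (pact x a) y = cstar a *c pip x y.
Proof. by rewrite -pip_star pip_act cstarM pip_star. Qed.

Lemma pip_sumr x (I : Type) (r : seq I) (Q : pred I) (F : I -> V) :
  pip x (\sum_(i <- r | Q i) F i) = \sum_(i <- r | Q i) pip x (F i).
Proof. by apply: (big_morph (pip x)); [exact: pipDr|exact: pip0r]. Qed.

Lemma pip_suml x (I : Type) (r : seq I) (Q : pred I) (F : I -> V) :
  pip (\sum_(i <- r | Q i) F i) x = \sum_(i <- r | Q i) pip (F i) x.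
Proof.
by rewrite -pip_star pip_sumr cstar_sum; apply: eq_bigr => i _; rewrite pip_star.
Qed.

(** Positivity of [<z, z>] for [z = y - x (t^-1 <x, y>)], combined with [<x, x> <= t], gives
    [t^-1 <x, y>^* <x, y> <= <y, y>]. Taking [t] strictly above [nrm <x, x>] and letting it decrease
    covers vectors of length zero. *)
Lemma pip_cs2 x y : nrm (pip x y) ^+ 2 <= nrm (pip x x) * nrm (pip y y).
Proof.
set a := pip x x; set b := pip x y; set c := pip y y.
suff H (t : R) : nrm a < t -> nrm b ^+ 2 <= t * nrm c.
  apply/ler_addgt0Pr => e e0.
  have c1 : 0 < nrm c + 1 by rewrite ltr_wpDl ?nrm_ge0.
  have d0 : 0 < e / (nrm c + 1) by rewrite divr_gt0.
  have := H (nrm a + e / (nrm c + 1)); rewrite ltrDl => /(_ d0) /le_trans; apply.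
  rewrite mulrDl lerD2l mulrAC ler_pdivrMr// ler_wpM2l ?lerDl//; exact: ltW.
move=> at_; have t0 : 0 < t by apply: le_lt_trans at_; exact: nrm_ge0.
have pc : pos c by exact: pip_pos.
have pb : pos ((t^-1)%:C *: (cstar b *c b)).
  by apply: posZ; [rewrite invr_ge0 ltW|exact: pos_cstar].
suff pcb : pos (c - (t^-1)%:C *: (cstar b *c b)).
  have := pos_mono_nrm pb pcb; rewrite nrmZr nrm_cstar gtr0_norm ?invr_gt0//.
  by rewrite mulrC ler_pdivrMr// mulrC.
pose z := y - pact x ((t^-1)%:C *: b).
have pz : pos (pip z z) by exact: pip_pos.
have zE : pip z z = c - (t^-1)%:C *: (cstar b *c b) - ((t^-1)%:C *: (cstar b *c b)
   - (t^-1 ^+ 2)%:C *: (cstar b *c a *c b)).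
  rewrite /z pipDl pipNl !pipDr !pipNr !pip_act !pip_actl cstarZr.
  rewrite -(pip_star x y) -/a -/b -/c -!cscaleAl -!cscaleAr scalerA.
  by rewrite -rmorphM -expr2.
have -> : c - (t^-1)%:C *: (cstar b *c b) = pip z z +
    (t^-1 ^+ 2)%:C *: (cstar b *c (t%:C *: cone - a) *c b).
  symmetry; rewrite zE -[RHS]addr0 -addrA; congr (_ + _).
  rewrite cmulBr cmulBl scalerBr -cscaleAr -cscaleAl cmulx1 scalerA.
  have -> : (t^-1 ^+ 2)%:C * t%:C = (t^-1)%:C :> R[i].
    by rewrite -rmorphM expr2 -mulrA mulVf ?gt_eqF// mulr1.
  by rewrite opprB subrKA subrr.
apply: posD => //; apply: posZ; first exact: sqr_ge0.
apply: pos_conj; apply: (@ball_pos _ _ _ t).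
  by rewrite cstarB cstarZr cstar1 (pos_sa (pip_pos x)).
by rewrite opprB addrC subrK; exact: ltW.
Qed.

Definition vn x : R := Num.sqrt (nrm (pip x x)).

Lemma vn_ge0 x : 0 <= vn x.
Proof. exact: sqrtr_ge0. Qed.

Lemma vn_sqr x : vn x ^+ 2 = nrm (pip x x).
Proof. by rewrite sqr_sqrtr// nrm_ge0. Qed.

Lemma pip_cs x y : nrm (pip x y) <= vn x * vn y.
Proof.
rewrite -(@ler_sqr _ (nrm _)) ?nnegrE ?nrm_ge0 ?mulr_ge0 ?vn_ge0//.
by rewrite exprMn !vn_sqr pip_cs2.
Qed.

Lemma vnD x y : vn (x + y) <= vn x + vn y.
Proof.
rewrite -(@ler_sqr _ (vn _)) ?nnegrE ?addr_ge0 ?vn_ge0// vn_sqr.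
rewrite pipDl !pipDr.
have := nrmD (pip x x + pip x y) (pip y x + pip y y).
have := nrmD (pip x x) (pip x y); have := nrmD (pip y x) (pip y y).
have := pip_cs x y; have := pip_cs y x; rewrite -!vn_sqr sqrrD.
lra.
Qed.

Lemma vnZ a x : vn (a *: x) = cabs a * vn x.
Proof.
rewrite /vn pipZr pipZl !nrmZ mulrA.
have -> : cabs (a^*)%R = cabs a by rewrite /cabs norm_conjC.
by rewrite -expr2 sqrtrM ?sqr_ge0// sqrtr_sqr ger0_norm ?cabs_ge0.
Qed.

Lemma vn0 : vn 0 = 0.
Proof. by rewrite /vn pip0r nrm0 sqrtr0. Qed.

End PreMod.

Section Operators.
Context {R : realType} {A : ucstarType R} (V : premod A).
Implicit Types x y z : V.

(* As the inner product may be degenerate, the adjoint is part of the data. *)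
Record bop := Bop {
  bfun :> V -> V;
  badj : V -> V;
  bfun_lin : linear bfun;
  badj_lin : linear badj;
  bfun_adj : forall x y, pip (badj x) y = pip x (bfun y);
  bfun_bnd : exists2 c : R, 0 <= c & forall x, vn (bfun x) <= c * vn x
}.

Implicit Types S T U : bop.

Lemma bop_eq S T : bfun S =1 bfun T -> badj S =1 badj T -> S = T.
Proof.
case: S T => f g fl gl fa fb [f' g' fl' gl' fa' fb'] /= /funext ff /funext gg.
by subst f' g'; congr Bop; exact: Prop_irrelevance.
Qed.

(** An infimum of admissible bounds rather than a supremum of quotients, since [vn] may vanish on
    nonzero vectors. *)
Definition opset T : set R := [set c | 0 <= c /\ forall x, vn (T x) <= c * vn x].
Definition opn T : R := inf (opset T).

Lemma opset_has_inf T : has_inf (opset T).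
Proof.
split; first by have [c c0 H] := bfun_bnd T; exists c.
by exists 0 => c [].
Qed.

Lemma opn_ge0 T : 0 <= opn T.
Proof. by apply: lb_le_inf; [exact: (opset_has_inf T).1|move=> c []]. Qed.

Lemma opn_le T (c : R) : 0 <= c -> (forall x, vn (T x) <= c * vn x) -> opn T <= c.
Proof. by move=> c0 H; apply: ge_inf => //; exact: (opset_has_inf T).2. Qed.

Lemma opnP T x : vn (T x) <= opn T * vn x.
Proof.
have [x0|] := eqVneq (vn x) 0.
  by have [c _ /(_ x)] := bfun_bnd T; rewrite x0 !mulr0.
rewrite neq_lt ltNge vn_ge0 /= => x0.
rewrite -ler_pdivrMr//; apply: lb_le_inf; first exact: (opset_has_inf T).1.
by move=> c [c0 H]; rewrite ler_pdivrMr.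
Qed.

Lemma badj_bnd T x : vn (badj T x) <= opn T * vn x.
Proof.
have [x0|] := eqVneq (vn (badj T x)) 0.
  by rewrite x0 mulr_ge0 ?opn_ge0 ?vn_ge0.
rewrite neq_lt ltNge vn_ge0 /= => x0.
rewrite -(ler_pM2r x0) -expr2 vn_sqr bfun_adj (le_trans (pip_cs _ _))//.
by rewrite [leRHS]mulrAC [leRHS]mulrC ler_wpM2l ?vn_ge0 ?opnP.
Qed.

Lemma badjE T x y : pip (T x) y = pip x (badj T y).
Proof. by rewrite -pip_star -bfun_adj pip_star. Qed.

Lemma bfunD T x y : T (x + y) = T x + T y.
Proof. by have := bfun_lin T 1 x y; rewrite !scale1r. Qed.

Lemma bfun0 T : T 0 = 0.
Proof. by have := bfun_lin T (-1) 0 0; rewrite scaler0 addr0 scaleN1r addNr. Qed.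

Lemma bfunZ T (a : R[i]) x : T (a *: x) = a *: T x.
Proof. by rewrite -[a *: x]addr0 bfun_lin bfun0 addr0. Qed.

Lemma badjD T x y : badj T (x + y) = badj T x + badj T y.
Proof. by have := badj_lin T 1 x y; rewrite !scale1r. Qed.

Lemma badjZ T (a : R[i]) x : badj T (a *: x) = a *: badj T x.
Proof.
have t0 : badj T 0 = 0.
  by have := badj_lin T (-1) 0 0; rewrite scaler0 addr0 scaleN1r addNr.
by rewrite -[a *: x]addr0 badj_lin t0 addr0.
Qed.

Program Definition bop0 := @Bop (fun=> 0) (fun=> 0) _ _ _ _.
Next Obligation. by move=> a x y; rewrite scaler0 addr0. Qed.
Next Obligation. by move=> a x y; rewrite scaler0 addr0. Qed.
Next Obligation. by move=> x y; rewrite pip0r -pip_star pip0r cstar0. Qed.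
Next Obligation. by exists 0 => // x; rewrite vn0 mul0r. Qed.

Program Definition bopD S T :=
  @Bop (fun x => S x + T x) (fun x => badj S x + badj T x) _ _ _ _.
Next Obligation. by move=> S T a x y; rewrite !bfun_lin scalerDr addrACA. Qed.
Next Obligation. by move=> S T a x y; rewrite !badj_lin scalerDr addrACA. Qed.
Next Obligation. by move=> S T x y; rewrite pipDl pipDr !bfun_adj. Qed.
Next Obligation.
move=> S T; exists (opn S + opn T); first by rewrite addr_ge0 ?opn_ge0.
by move=> x; rewrite (le_trans (vnD _ _))// mulrDl lerD ?opnP.
Qed.

Program Definition bopZ (a : R[i]) T :=
  @Bop (fun x => a *: T x) (fun x => (a^*)%R *: badj T x) _ _ _ _.
Next Obligation. by move=> a T b x y; rewrite bfun_lin scalerDr !scalerA mulrC. Qed.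
Next Obligation. by move=> a T b x y; rewrite badj_lin scalerDr !scalerA mulrC. Qed.
Next Obligation. by move=> a T x y; rewrite pipZl pipZr bfun_adj conjCK. Qed.
Next Obligation.
move=> a T; exists (cabs a * opn T); first by rewrite mulr_ge0 ?cabs_ge0 ?opn_ge0.
by move=> x; rewrite vnZ -mulrA ler_wpM2l ?cabs_ge0 ?opnP.
Qed.

Program Definition bop1 := @Bop (fun x => x) (fun x => x) _ _ _ _.
Next Obligation. by []. Qed.
Next Obligation. by []. Qed.
Next Obligation. by []. Qed.
Next Obligation. by exists 1 => // x; rewrite mul1r. Qed.

Program Definition bopM S T :=
  @Bop (fun x => S (T x)) (fun x => badj T (badj S x)) _ _ _ _.
Next Obligation. by move=> S T a x y; rewrite !bfun_lin. Qed.
Next Obligation. by move=> S T a x y; rewrite !badj_lin. Qed.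
Next Obligation. by move=> S T x y; rewrite !bfun_adj. Qed.
Next Obligation.
move=> S T; exists (opn S * opn T); first by rewrite mulr_ge0 ?opn_ge0.
by move=> x; rewrite (le_trans (opnP _ _))// -mulrA ler_wpM2l ?opnP ?opn_ge0.
Qed.

Program Definition bopS T := @Bop (badj T) T _ _ _ _.
Next Obligation. by move=> T; exact: badj_lin. Qed.
Next Obligation. by move=> T; exact: bfun_lin. Qed.
Next Obligation. by move=> T x y; rewrite badjE. Qed.
Next Obligation. by move=> T; exists (opn T); [exact: opn_ge0|exact: badj_bnd]. Qed.

HB.instance Definition _ := gen_eqMixin bop.
HB.instance Definition _ := gen_choiceMixin bop.

Fact bopDA : associative bopD.
Proof. by move=> S T U; apply: bop_eq => x /=; rewrite addrA. Qed.

Fact bopDC : commutative bopD.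
Proof. by move=> S T; apply: bop_eq => x /=; rewrite addrC. Qed.

Fact bop0D : left_id bop0 bopD.
Proof. by move=> S; apply: bop_eq => x /=; rewrite add0r. Qed.

Fact bopND : left_inverse bop0 (bopZ (-1)) bopD.
Proof.
by move=> S; apply: bop_eq => x /=; rewrite ?rmorphN1 scaleN1r addNr.
Qed.

HB.instance Definition _ := GRing.isZmodule.Build bop bopDA bopDC bop0D bopND.

Fact bopZA a b T : bopZ a (bopZ b T) = bopZ (a * b) T.
Proof. by apply: bop_eq => x /=; rewrite scalerA ?rmorphM. Qed.

Fact bopZ1 : left_id 1 bopZ.
Proof. by move=> T; apply: bop_eq => x /=; rewrite ?rmorph1 scale1r. Qed.

Fact bopZDr : right_distributive bopZ +%R.
Proof. by move=> a S T; apply: bop_eq => x /=; rewrite scalerDr. Qed.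

Fact bopZDl T : {morph bopZ^~ T : a b / a + b}.
Proof. by move=> a b; apply: bop_eq => x /=; rewrite ?rmorphD scalerDl. Qed.

HB.instance Definition _ :=
  GRing.Zmodule_isLmodule.Build R[i] bop bopZA bopZ1 bopZDr bopZDl.

Fact opn_S T : opn (bopS T) = opn T.
Proof.
have le U : opn (bopS U) <= opn U by apply: opn_le; [exact: opn_ge0|exact: badj_bnd].
apply/eqP; rewrite eq_le le /=; have := le (bopS T).
by have -> : bopS (bopS T) = T by exact: bop_eq.
Qed.

Fact opnM S T : opn (bopM S T) <= opn S * opn T.
Proof.
apply: opn_le; first by rewrite mulr_ge0 ?opn_ge0.
by move=> x; rewrite (le_trans (opnP S (T x)))// -mulrA ler_wpM2l ?opnP ?opn_ge0.
Qed.

Fact opnD S T : opn (S + T) <= opn S + opn T.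
Proof.
apply: opn_le; first by rewrite addr_ge0 ?opn_ge0.
by move=> x; rewrite (le_trans (vnD (S x) (T x)))// mulrDl lerD ?opnP.
Qed.

Fact opnZ (a : R[i]) T : opn (a *: T) = cabs a * opn T.
Proof.
have le b U : opn (b *: U) <= cabs b * opn U.
  apply: opn_le; first by rewrite mulr_ge0 ?cabs_ge0 ?opn_ge0.
  by move=> x; rewrite vnZ -mulrA ler_wpM2l ?cabs_ge0 ?opnP.
apply/eqP; rewrite eq_le le /=.
have [->|a0] := eqVneq a 0.
  by rewrite (cabs_real 0) normr0 mul0r opn_ge0.
have := le a^-1 (a *: T); rewrite scalerA mulVf// scale1r.
have ca : 0 < cabs a by rewrite -ltcR -cabsE normr_gt0.
have -> : cabs a^-1 = (cabs a)^-1.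
  by apply: complexI; rewrite -cabsE normfV cabsE fmorphV.
by rewrite mulrC ler_pdivlMr// mulrC.
Qed.

Fact opn_star T : opn (bopM (bopS T) T) = opn T ^+ 2.
Proof.
apply/eqP; rewrite eq_le; apply/andP; split.
  by rewrite (le_trans (opnM _ _))// opn_S expr2.
rewrite -[leRHS]sqr_sqrtr ?opn_ge0// ler_sqr ?nnegrE ?opn_ge0 ?sqrtr_ge0//.
apply: opn_le; first exact: sqrtr_ge0.
move=> x; rewrite -(@ler_sqr _ (vn _)) ?nnegrE ?vn_ge0 ?mulr_ge0 ?vn_ge0 ?sqrtr_ge0//.
rewrite exprMn (sqr_sqrtr (opn_ge0 _)) [leLHS]vn_sqr badjE (le_trans (pip_cs _ _))//.
rewrite expr2 mulrA [leRHS]mulrC ler_wpM2l ?vn_ge0//.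
exact: (opnP (bopM (bopS T) T)).
Qed.

Program Definition bops : precstar R :=
  @PreCStar R bop bopM bopS bop1 opn _ _ _ _ _ _ _ _ _ _ _ opnD opnZ opnM opn_star.
Next Obligation. by move=> S T U; exact: bop_eq. Qed.
Next Obligation. by move=> S T U; apply: bop_eq => x //=; rewrite badjD. Qed.
Next Obligation. by move=> S T U; apply: bop_eq => x //=; rewrite bfunD. Qed.
Next Obligation. by move=> a S T; apply: bop_eq => x //=; rewrite badjZ. Qed.
Next Obligation. by move=> a S T; apply: bop_eq => x //=; rewrite bfunZ. Qed.
Next Obligation. by move=> S; exact: bop_eq. Qed.
Next Obligation. by move=> S; exact: bop_eq. Qed.
Next Obligation. by move=> S; exact: bop_eq. Qed.
Next Obligation. by move=> S T; exact: bop_eq. Qed.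
Next Obligation. by move=> a S; apply: bop_eq => x //=; rewrite conjCK. Qed.
Next Obligation. by move=> S T; exact: bop_eq. Qed.

Lemma pactZ x (a : R[i]) b : pact x (a *: b) = a *: pact x b.
Proof.
have p0 : pact x 0 = 0.
  by have := pact_lin x (-1) 0 0; rewrite scaler0 addr0 scaleN1r addNr.
by rewrite -[a *: b]addr0 pact_lin p0 addr0.
Qed.

Fact vn_pact x a : vn (pact x a) <= vn x * nrm a.
Proof.
rewrite -(@ler_sqr _ (vn _)) ?nnegrE ?mulr_ge0 ?vn_ge0 ?nrm_ge0// vn_sqr.
rewrite pip_act pip_actl exprMn vn_sqr.
have := nrmM (cstar a *c pip x x) a; have := nrmM (cstar a) (pip x x).
rewrite nrm_star; have := nrm_ge0 a; have := nrm_ge0 (pip x x).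
by move: (nrm (cstar a *c pip x x *c a)) => ?; nra.
Qed.

Program Definition bop_rank1 x y :=
  @Bop (fun z => pact x (pip y z)) (fun z => pact y (pip x z)) _ _ _ _.
Next Obligation. by move=> x y a u v; rewrite pip_lin pact_lin. Qed.
Next Obligation. by move=> x y a u v; rewrite pip_lin pact_lin. Qed.
Next Obligation. by move=> x y u v; rewrite pip_act pip_actl pip_star. Qed.
Next Obligation.
move=> x y; exists (vn x * vn y); first by rewrite mulr_ge0 ?vn_ge0.
move=> z; rewrite (le_trans (vn_pact _ _))// -mulrA ler_wpM2l ?vn_ge0//.
exact: pip_cs.
Qed.

Lemma bop_rank1M x y u v (a : R[i]) : pip y u = a *: cone ->
  bopM (bop_rank1 x y) (bop_rank1 u v) = a *: bop_rank1 x v.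
Proof.
move=> yu; apply: bop_eq => f /=; rewrite pip_act -pactZ; congr (pact _ _).
  by rewrite yu -cscaleAl cmul1x.
by rewrite -(pip_star y u) yu cstarZ cstar1 -cscaleAl cmul1x.
Qed.

End Operators.

(** * Completion *)

Section Completion.
Context {R : realType} (B : precstar R).
Implicit Types u v w : nat -> B.

Definition peq u v := forall e : R, 0 < e ->
  exists N, forall n, (N <= n)%N -> pnm (u n - v n) < e.

Lemma peq_refl u : peq u u.
Proof. by move=> e e0; exists 0%N => n _; rewrite subrr pnm0. Qed.

Lemma peq_sym u v : peq u v -> peq v u.
Proof. by move=> uv e /uv[N H]; exists N => n /H; rewrite pnmC. Qed.

Lemma peq_trans v u w : peq u v -> peq v w -> peq u w.
Proof.
move=> uv vw e e0; have [N hN] := uv _ (divr_gt0 e0 (ltr0Sn _ 1)).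
have [M hM] := vw _ (divr_gt0 e0 (ltr0Sn _ 1)).
exists (maxn N M) => n; rewrite geq_max => /andP[/hN h1 /hM h2].
by rewrite (le_lt_trans (pnm_tri _ (v n) _))// [ltRHS]splitr ltrD.
Qed.

Lemma pcauchy_bnd u : pcauchy u ->
  exists2 c : R, 0 < c & exists N, forall n, (N <= n)%N -> pnm (u n) <= c.
Proof.
move=> /(_ 1 ltr01)[N uN]; exists (1 + pnm (u N)).
  by rewrite ltr_pwDl// pnm_ge0.
exists N => n Nn; have := uN n N Nn (leqnn N).
by have := pnmD (u n - u N) (u N); rewrite subrK; lra.
Qed.

Lemma pcauchyD u v : pcauchy u -> pcauchy v -> pcauchy (fun n => u n + v n).
Proof.
move=> uc vc e e0; have [N hN] := uc _ (divr_gt0 e0 (ltr0Sn _ 1)).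
have [M hM] := vc _ (divr_gt0 e0 (ltr0Sn _ 1)).
exists (maxn N M) => m n; rewrite !geq_max => /andP[m1 m2] /andP[n1 n2].
rewrite opprD addrACA (le_lt_trans (pnmD _ _))// [ltRHS]splitr ltrD//.
  exact: hN.
exact: hM.
Qed.

Lemma peqD u v u' v' : peq u u' -> peq v v' ->
  peq (fun n => u n + v n) (fun n => u' n + v' n).
Proof.
move=> uc vc e e0; have [N hN] := uc _ (divr_gt0 e0 (ltr0Sn _ 1)).
have [M hM] := vc _ (divr_gt0 e0 (ltr0Sn _ 1)).
exists (maxn N M) => n; rewrite !geq_max => /andP[/hN m1 /hM m2].
by rewrite opprD addrACA (le_lt_trans (pnmD _ _))// [ltRHS]splitr ltrD.
Qed.

Lemma pcauchyZ a u : pcauchy u -> pcauchy (fun n => a *: u n).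
Proof.
have ca : 0 < cabs a + 1 by rewrite ltr_wpDl ?cabs_ge0.
move=> uc e e0; have [N hN] := uc _ (divr_gt0 e0 ca).
exists N => m n Nm Nn; have := hN m n Nm Nn; rewrite ltr_pdivlMr//.
rewrite -scalerBr pnmZ => /(le_lt_trans _); apply.
by rewrite mulrC ler_wpM2l ?pnm_ge0 ?lerDl.
Qed.

Lemma peqZ a u v : peq u v -> peq (fun n => a *: u n) (fun n => a *: v n).
Proof.
have ca : 0 < cabs a + 1 by rewrite ltr_wpDl ?cabs_ge0.
move=> uc e e0; have [N hN] := uc _ (divr_gt0 e0 ca).
exists N => n Nm; have := hN n Nm; rewrite ltr_pdivlMr//.
rewrite -scalerBr pnmZ => /(le_lt_trans _); apply.
by rewrite mulrC ler_wpM2l ?pnm_ge0 ?lerDl.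
Qed.

Lemma pcauchyS u : pcauchy u -> pcauchy (fun n => pstar (u n)).
Proof.
move=> uc e /uc[N hN]; exists N => m n Nm Nn.
by rewrite -pstarN -pstarD pnm_pstar hN.
Qed.

Lemma peqS u v : peq u v -> peq (fun n => pstar (u n)) (fun n => pstar (v n)).
Proof.
move=> uc e /uc[N hN]; exists N => n Nm.
by rewrite -pstarN -pstarD pnm_pstar hN.
Qed.

Lemma pmulB_le (x y x' y' : B) :
  pnm (pmul x y - pmul x' y') <= pnm (x - x') * pnm y + pnm x' * pnm (y - y').
Proof.
have -> : pmul x y - pmul x' y' = pmul (x - x') y + pmul x' (y - y').
  by rewrite pmulDl pmulDr pmulNx pmulxN addrA subrK.
by rewrite (le_trans (pnmD _ _))// lerD ?pnmM.
Qed.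

Lemma pmul_small (e c d : R) (x y x' y' : B) : 0 < e -> 0 < c -> 0 < d ->
  pnm y <= d -> pnm x' <= c -> pnm (x - x') < e / 2 / d -> pnm (y - y') < e / 2 / c ->
  pnm (pmul x y - pmul x' y') < e.
Proof.
move=> e0 c0 d0 yd xc; rewrite !ltr_pdivlMr ?divr_gt0// => xx yy.
apply: (le_lt_trans (pmulB_le _ _ _ _)).
have : pnm (x - x') * pnm y <= pnm (x - x') * d by rewrite ler_wpM2l ?pnm_ge0.
have : pnm x' * pnm (y - y') <= c * pnm (y - y') by rewrite ler_wpM2r ?pnm_ge0.
lra.
Qed.

Lemma pcauchyM u v : pcauchy u -> pcauchy v -> pcauchy (fun n => pmul (u n) (v n)).
Proof.
move=> uc vc e e0; have [c c0 [N1 h1]] := pcauchy_bnd uc.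
have [d d0 [N2 h2]] := pcauchy_bnd vc.
have e2 : 0 < e / 2 by rewrite divr_gt0.
have [N3 h3] := uc _ (divr_gt0 e2 d0); have [N4 h4] := vc _ (divr_gt0 e2 c0).
exists (maxn (maxn N1 N2) (maxn N3 N4)) => m n; rewrite !geq_max.
move=> /andP[/andP[m1 m2] /andP[m3 m4]] /andP[/andP[n1 n2] /andP[n3 n4]].
by apply: (pmul_small e0 c0 d0); [exact: h2|exact: h1|exact: h3|exact: h4].
Qed.

Lemma peqM u v u' v' : pcauchy u' -> pcauchy v -> peq u u' -> peq v v' ->
  peq (fun n => pmul (u n) (v n)) (fun n => pmul (u' n) (v' n)).
Proof.
move=> uc vc uu vv e e0; have [c c0 [N1 h1]] := pcauchy_bnd uc.
have [d d0 [N2 h2]] := pcauchy_bnd vc.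
have e2 : 0 < e / 2 by rewrite divr_gt0.
have [N3 h3] := uu _ (divr_gt0 e2 d0); have [N4 h4] := vv _ (divr_gt0 e2 c0).
exists (maxn (maxn N1 N2) (maxn N3 N4)) => n; rewrite !geq_max.
move=> /andP[/andP[m1 m2] /andP[m3 m4]].
by apply: (pmul_small e0 c0 d0); [exact: h2|exact: h1|exact: h3|exact: h4].
Qed.

Lemma pcauchy_cst x : pcauchy (fun=> x : B).
Proof. by move=> e e0; exists 0%N => m n _ _; rewrite subrr pnm0. Qed.

(* Cauchy sequences up to null sequences, through a choice of representatives. *)
Definition canon u : nat -> B := xget (fun=> 0) [set v | pcauchy v /\ peq u v].

Record completion := Completion {
  crep : nat -> B;
  crepP : pcauchy crep /\ canon crep = crep
}.

Implicit Types x y z : completion.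

Lemma canonP u : pcauchy u -> pcauchy (canon u) /\ peq u (canon u).
Proof.
move=> uc; have : [set v | pcauchy v /\ peq u v] u by split=> //; exact: peq_refl.
exact: xgetI.
Qed.

Lemma canon_eq u v : peq u v -> canon u = canon v.
Proof.
move=> uv; rewrite /canon; congr (xget _ _); apply/seteqP; split=> w /= [wc uw].
  by split=> //; apply: peq_trans uw; exact: peq_sym.
by split=> //; exact: peq_trans uw.
Qed.

Fact canonK u : pcauchy u -> pcauchy (canon u) /\ canon (canon u) = canon u.
Proof. by move=> /canonP[c /canon_eq]. Qed.

Definition cls u (uc : pcauchy u) := Completion (canonK uc).

Lemma crep_cauchy x : pcauchy (crep x).
Proof. by case: (crepP x). Qed.

(** The sequence [u] represents [x], whichever representative was chosen for it. Through [appr_eq],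
    identities in the completion become termwise identities in [B]. *)
Definition appr x u := peq (crep x) u.

Lemma appr_cls u (uc : pcauchy u) : appr (cls uc) u.
Proof. by apply: peq_sym; have [] := canonP uc. Qed.

Lemma appr_crep x : appr x (crep x).
Proof. exact: peq_refl. Qed.

Lemma appr_eq x y u v : appr x u -> appr y v -> u =1 v -> x = y.
Proof.
move=> xu yv /funext uv; subst v.
have : peq (crep x) (crep y) by apply: peq_trans xu _; exact: peq_sym.
move/canon_eq; have [_ ->] := crepP x; have [_ ->] := crepP y.
case: x y {xu yv} => f fP [g gP] /= fg; subst g.
by congr Completion; exact: Prop_irrelevance.
Qed.

Definition compD x y := cls (pcauchyD (crep_cauchy x) (crep_cauchy y)).
Definition comp0 := cls (pcauchy_cst 0).
Definition comp1 := cls (pcauchy_cst (pone B)).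
Definition compZ a x := cls (@pcauchyZ a _ (crep_cauchy x)).
Definition compM x y := cls (pcauchyM (crep_cauchy x) (crep_cauchy y)).
Definition compS x := cls (pcauchyS (crep_cauchy x)).

Lemma apprD x y u v : appr x u -> appr y v -> appr (compD x y) (fun n => u n + v n).
Proof. by move=> xu yv; apply: peq_trans (appr_cls _) _; exact: peqD. Qed.

Lemma appr_pcauchy x u : appr x u -> pcauchy u.
Proof.
move=> xu e e0; have [N hN] := xu _ (divr_gt0 e0 (ltr0Sn _ 2)).
have [M hM] := crep_cauchy x (divr_gt0 e0 (ltr0Sn _ 2)).
exists (maxn N M) => m n; rewrite !geq_max => /andP[m1 m2] /andP[n1 n2].
have := hN m m1; have := hN n n1; have := hM m n m2 n2; rewrite [pnm (_ - u m)]pnmC.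
have := pnm_tri (u m) (crep x m) (u n); have := pnm_tri (crep x m) (crep x n) (u n).
lra.
Qed.

Lemma apprM x y u v : appr x u -> appr y v -> appr (compM x y) (fun n => pmul (u n) (v n)).
Proof.
move=> xu yv; apply: peq_trans (appr_cls _) _; apply: peqM => //.
  exact: appr_pcauchy xu.
exact: crep_cauchy.
Qed.

Lemma apprZ a x u : appr x u -> appr (compZ a x) (fun n => a *: u n).
Proof. by move=> xu; apply: peq_trans (appr_cls _) _; exact: peqZ. Qed.

Lemma apprS x u : appr x u -> appr (compS x) (fun n => pstar (u n)).
Proof. by move=> xu; apply: peq_trans (appr_cls _) _; exact: peqS. Qed.

Lemma appr0 : appr comp0 (fun=> 0).
Proof. exact: appr_cls. Qed.

Lemma appr1 : appr comp1 (fun=> pone B).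
Proof. exact: appr_cls. Qed.

Ltac apprs := lazymatch goal with
  | |- appr (compD _ _) _ => apply: apprD; [apprs | apprs]
  | |- appr (_ + _) _ => apply: apprD; [apprs | apprs]
  | |- appr (compM _ _) _ => apply: apprM; [apprs | apprs]
  | |- appr (compZ _ _) _ => apply: apprZ; apprs
  | |- appr (_ *: _) _ => apply: apprZ; apprs
  | |- appr (compS _) _ => apply: apprS; apprs
  | |- appr comp0 _ => exact: appr0
  | |- appr comp1 _ => exact: appr1
  | |- _ => exact: appr_crep
  end.
Ltac compeq := apply: appr_eq; [apprs|apprs|].

HB.instance Definition _ := gen_eqMixin completion.
HB.instance Definition _ := gen_choiceMixin completion.

Fact compDA : associative compD.
Proof. by move=> x y z; compeq => n /=; rewrite addrA. Qed.

Fact compDC : commutative compD.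
Proof. by move=> x y; compeq => n /=; rewrite addrC. Qed.

Fact comp0D : left_id comp0 compD.
Proof. by move=> x; compeq => n /=; rewrite add0r. Qed.

Fact compND : left_inverse comp0 (compZ (-1)) compD.
Proof. by move=> x; compeq => n /=; rewrite scaleN1r addNr. Qed.

HB.instance Definition _ := GRing.isZmodule.Build completion compDA compDC comp0D compND.

Fact compZA a b x : compZ a (compZ b x) = compZ (a * b) x.
Proof. by compeq => n /=; rewrite scalerA. Qed.

Fact compZ1 : left_id 1 compZ.
Proof. by move=> x; compeq => n /=; rewrite scale1r. Qed.

Fact compZDr : right_distributive compZ +%R.
Proof. by move=> a x y; compeq => n /=; rewrite scalerDr. Qed.

Fact compZDl x : {morph compZ^~ x : a b / a + b}.
Proof. by move=> a b; compeq => n /=; rewrite scalerDl. Qed.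

HB.instance Definition _ :=
  GRing.Zmodule_isLmodule.Build R[i] completion compZA compZ1 compZDr compZDl.

Lemma pnm_cvg u : pcauchy u -> cvg ((fun n => pnm (u n)) @ \oo).
Proof.
move=> uc; apply/cauchy_cvgP/cauchy_ballP => e e0.
have [N hN] := uc _ e0.
exists ([set pnm (u n) | n in [set n | (N <= n)%N]],
        [set pnm (u n) | n in [set n | (N <= n)%N]]).
  by split => /=; exists N => // n /= Nn; exists n.
move=> [_ _] /= [[m mN <-] [n nN <-]].
rewrite -ball_normE /=; apply: le_lt_trans (hN m n mN nN).
rewrite ler_norml; have := pnmD (u m - u n) (u n); have := pnmD (u n - u m) (u m).
by rewrite !subrK [pnm (u n - _)]pnmC; lra.
Qed.

Definition compn x : R := lim ((fun n => pnm (crep x n)) @ \oo).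

Lemma appr_compn x u : appr x u -> (fun n => pnm (u n)) @ \oo --> compn x.
Proof.
move=> xu; have cx : (fun n => pnm (crep x n)) @ \oo --> compn x.
  exact: pnm_cvg (crep_cauchy x).
apply/cvgrPdist_lt => e e0.
have [N hN] := xu _ (divr_gt0 e0 (ltr0Sn _ 1)).
move/cvgrPdist_lt : cx => /(_ _ (divr_gt0 e0 (ltr0Sn _ 1))).
move=> [M _ hM]; exists (maxn N M) => // n /=; rewrite geq_max => /andP[n1 n2].
have := hN n n1; have := hM n n2.
rewrite !ltr_norml; have := pnmD (crep x n - u n) (u n).
have := pnmD (u n - crep x n) (crep x n).
by rewrite !subrK [pnm (u n - _)]pnmC; lra.
Qed.

Lemma compn_le x u (c : R) N : appr x u ->
  (forall n, (N <= n)%N -> pnm (u n) <= c) -> compn x <= c.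
Proof.
move=> /appr_compn xu uc; apply: (ler_cvg_to xu (cvg_cst c)).
by exists N => // n /= /uc.
Qed.

Fact compnD x y : compn (x + y) <= compn x + compn y.
Proof.
have xy : appr (x + y) (fun n => crep x n + crep y n) by apprs.
apply: (ler_cvg_to (appr_compn xy) (cvgD (appr_compn (appr_crep x)) (appr_compn (appr_crep y)))).
by apply: nearW => n /=; exact: pnmD.
Qed.

Fact compnZ a x : compn (a *: x) = cabs a * compn x.
Proof.
have ax : appr (a *: x) (fun n => a *: crep x n) by apprs.
have := appr_compn ax.
have -> : (fun n => pnm (a *: crep x n)) = (fun n => cabs a * pnm (crep x n)).
  by apply/funext => n; rewrite pnmZ.
move=> h; have h2 := cvgM (cvg_cst (cabs a)) (appr_compn (appr_crep x)).
exact: (cvg_unique (@Rhausdorff R) h (h2 _ _)).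
Qed.

Fact compnM x y : compn (compM x y) <= compn x * compn y.
Proof.
have xy : appr (compM x y) (fun n => pmul (crep x n) (crep y n)) by apprs.
apply: (ler_cvg_to (appr_compn xy) (cvgM (appr_compn (appr_crep x)) (appr_compn (appr_crep y)))).
by apply: nearW => n /=; exact: pnmM.
Qed.

Fact compn_star x : compn (compM (compS x) x) = compn x ^+ 2.
Proof.
have xy : appr (compM (compS x) x) (fun n => pmul (pstar (crep x n)) (crep x n)) by apprs.
have := appr_compn xy.
have -> : (fun n => pnm (pmul (pstar (crep x n)) (crep x n))) =
    (fun n => pnm (crep x n) * pnm (crep x n)).
  by apply/funext => n; rewrite pnm_star expr2.
move=> h; have h2 := cvgM (appr_compn (appr_crep x)) (appr_compn (appr_crep x)).
by rewrite expr2; exact: (cvg_unique (@Rhausdorff R) h (h2 _)).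
Qed.

Program Definition comp_pre : precstar R :=
  @PreCStar R completion compM compS comp1 compn _ _ _ _ _ _ _ _ _ _ _
    compnD compnZ compnM compn_star.
Next Obligation. by move=> x y z; compeq => n /=; rewrite pmulA. Qed.
Next Obligation. by move=> x y z; compeq => n /=; rewrite pmulDl. Qed.
Next Obligation. by move=> x y z; compeq => n /=; rewrite pmulDr. Qed.
Next Obligation. by move=> a x y; compeq => n /=; rewrite pscaleAl. Qed.
Next Obligation. by move=> a x y; compeq => n /=; rewrite pscaleAr. Qed.
Next Obligation. by move=> x; compeq => n /=; rewrite pmul1x. Qed.
Next Obligation. by move=> x; compeq => n /=; rewrite pmulx1. Qed.
Next Obligation. by move=> x; compeq => n /=; rewrite pstarK. Qed.
Next Obligation. by move=> x y; compeq => n /=; rewrite pstarD. Qed.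
Next Obligation. by move=> a x; compeq => n /=; rewrite pstarZ. Qed.
Next Obligation. by move=> x y; compeq => n /=; rewrite pstarM. Qed.

Fact comp_sep (x : comp_pre) : pnm x = 0 -> x = 0.
Proof.
move=> x0; apply: (appr_eq (appr_crep x) _ (frefl _)).
apply: peq_trans appr0 _; apply: peq_sym => e e0.
have := appr_compn (appr_crep x); rewrite [compn x]x0 => /cvgrPdist_lt /(_ _ e0)[N _ hN].
exists N => n /hN; rewrite sub0r normrN subr0 ger0_norm//; exact: pnm_ge0.
Qed.

(** Each [f k] lies within [1/(k+1)] of the class of a constant sequence [v k]. The sequence [v] is
    then Cauchy in [B], and its class is the limit. *)
Fact comp_complete (f : nat -> comp_pre) : pcauchy f -> exists x, plims f x.
Proof.
move=> fc.
have nt (x y z : completion) : compn (x - z) <= compn (x - y) + compn (y - z).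
  exact: (@pnm_tri _ comp_pre).
have nC (x y : completion) : compn (x - y) = compn (y - x).
  exact: (@pnmC _ comp_pre).
have sel k : exists b : B, exists N, forall n, (N <= n)%N ->
    pnm (crep (f k) n - b) <= k.+1%:R^-1.
  have [|N hN] := crep_cauchy (f k) (e := k.+1%:R^-1); first by rewrite invr_gt0.
  by exists (crep (f k) N), N => n Nn; exact: ltW (hN _ _ Nn (leqnn N)).
have [v hv] := choice sel.
pose io b : completion := cls (pcauchy_cst b).
have ioP b : appr (io b) (fun=> b) by exact: appr_cls.
have ioB x b : appr (x - io b : completion) (fun n => crep x n - b).
  have -> : (fun n => crep x n - b) = (fun n => crep x n + (-1) *: b).
    by apply/funext => n; rewrite scaleN1r.
  by apply: apprD; [exact: appr_crep|exact: apprZ].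
have d1 k : compn (f k - io (v k)) <= k.+1%:R^-1.
  by have [N hN] := hv k; exact: compn_le (ioB _ _) hN.
have d2 k l : pnm (v k - v l) = compn (io (v k) - io (v l)).
  have h : appr (io (v k) - io (v l)) (fun n => v k - v l).
    have -> : (fun n : nat => v k - v l) = (fun n => v k + (-1) *: v l).
      by apply/funext => n; rewrite scaleN1r.
    by apply: apprD => //; exact: apprZ.
  exact: (cvg_unique (@Rhausdorff R) (cvg_cst _) (appr_compn h)).
have vc : pcauchy v.
  move=> e e0; have e3 : 0 < e / 3 by rewrite divr_gt0.
  have [N hN] := fc _ e3; have [M hM] := inv_small e3.
  exists (maxn N M) => m n; rewrite !geq_max => /andP[m1 m2] /andP[n1 n2].
  rewrite d2; have h0 : compn (f m - f n) < e / 3 := hN m n m1 n1.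
  have h1 := le_lt_trans (d1 m) (hM m m2); have h2 := le_lt_trans (d1 n) (hM n n2).
  have -> : e = e / 3 + (e / 3 + e / 3) by field.
  apply: (le_lt_trans (nt (io (v m)) (f m) (io (v n)))).
  apply: ltrD; first by rewrite nC; exact: h1.
  apply: (le_lt_trans (nt (f m) (f n) (io (v n)))).
  by apply: ltrD; [exact: h0|exact: h2].
exists (cls vc) => e e0; have e3 : 0 < e / 3 by rewrite divr_gt0.
have [N hN] := vc _ e3; have [M hM] := inv_small e3.
exists (maxn N M) => n; rewrite !geq_max => /andP[n1 n2].
have h : appr (cls vc - io (v n)) (fun m => v m - v n).
  have -> : (fun m : nat => v m - v n) = (fun m => v m + (-1) *: v n).
    by apply/funext => m; rewrite scaleN1r.
  by apply: apprD; [exact: appr_cls|apply: apprZ].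
have h2 : compn (cls vc - io (v n)) <= e / 3.
  by apply: (compn_le h (N := N)) => m Nm; exact: ltW (hN m n Nm n1).
have h3 := le_lt_trans (d1 n) (hM n n2).
apply: (le_lt_trans (nt (f n) (io (v n)) (cls vc))).
rewrite [compn (io (v n) - cls vc)]nC.
apply: (lt_le_trans (ltr_leD h3 h2)); lra.
Qed.

Definition completed : ucstarType R := mkCStar comp_sep comp_complete.

End Completion.

(** * Finite amplifications *)

(* A *-algebra structure on [A^I] whose left multiplications are bounded and
   adjointable on the Hilbert module [A^I], hence define a C*-norm. *)
Record finalg (R : realType) (A : ucstarType R) (I : finType) := FinAlg {
  fmul : {ffun I -> A} -> {ffun I -> A} -> {ffun I -> A};
  fstar : {ffun I -> A} -> {ffun I -> A};
  fone : {ffun I -> A};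
  fmulA : associative fmul;
  fmulDl : left_distributive fmul +%R;
  fmulDr : right_distributive fmul +%R;
  fscaleAl : forall (a : R[i]) x y, a *: fmul x y = fmul (a *: x) y;
  fscaleAr : forall (a : R[i]) x y, a *: fmul x y = fmul x (a *: y);
  fmul1x : left_id fone fmul;
  fmulx1 : right_id fone fmul;
  fstarK : involutive fstar;
  fstarD : {morph fstar : x y / x + y};
  fstarZ : forall (a : R[i]) x, fstar (a *: x) = (a^*)%R *: fstar x;
  fstarM : forall x y, fstar (fmul x y) = fmul (fstar y) (fstar x);
  fadj : forall u z w : {ffun I -> A}, \sum_i cstar (fmul u z i) *c w i =
                       \sum_i cstar (z i) *c fmul (fstar u) w i;
  fbnd : exists2 c : R, 0 <= c & forall (u z : {ffun I -> A}) i,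
    nrm (fmul u z i) <= c * (\sum_j nrm (u j)) * (\sum_j nrm (z j))
}.

Section FinAlg.
Context {R : realType} {A : ucstarType R} {I : finType} (F : finalg A I).
Implicit Types u z w : {ffun I -> A}.

Program Definition fmod : premod A := @PreMod R A {ffun I -> A}
  (fun z a => [ffun i => z i *c a]) (fun z w => \sum_i cstar (z i) *c w i) _ _ _ _ _.
Next Obligation.
move=> x a y z; rewrite scaler_sumr -big_split; apply: eq_bigr => i _ /=.
by rewrite !ffunE cmulDr cscaleAr.
Qed.
Next Obligation.
by move=> x y; rewrite cstar_sum; apply: eq_bigr => i _; rewrite cstarM cstarK.
Qed.
Next Obligation.
by move=> x c a b; apply/ffunP => i; rewrite !ffunE cmulDr cscaleAr.
Qed.
Next Obligation.
by move=> x y a; rewrite cmul_suml; apply: eq_bigr => i _; rewrite ffunE cmulA.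
Qed.
Next Obligation. by move=> x; apply: pos_sum => i; exact: pos_cstar. Qed.

Definition fsum u : R := \sum_i nrm (u i).

Lemma fsum_ge0 u : 0 <= fsum u.
Proof. by apply: sumr_ge0 => i _; exact: nrm_ge0. Qed.

Lemma nrm_coord_vn (z : fmod) i : nrm ((z : {ffun I -> A}) i) <= vn z.
Proof.
rewrite -(@ler_sqr _ (nrm _)) ?nnegrE ?nrm_ge0 ?vn_ge0// vn_sqr -nrm_cstar.
apply: pos_mono_nrm; first exact: pos_cstar.
rewrite /pip /= (bigD1 i)//= addrAC subrr add0r.
by apply: pos_sum => j; exact: pos_cstar.
Qed.

Lemma vn_fsum (z : fmod) : vn z <= fsum z.
Proof.
rewrite -(@ler_sqr _ (vn _)) ?nnegrE ?fsum_ge0 ?vn_ge0// vn_sqr.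
rewrite (le_trans (nrm_sum _ _ _))// expr2 mulr_suml ler_sum// => i _.
rewrite nrm_cstar expr2 ler_wpM2l ?nrm_ge0//.
by rewrite /fsum (bigD1 i)//= lerDl sumr_ge0// => j _; exact: nrm_ge0.
Qed.

Lemma fsum_vn (z : fmod) : fsum z <= #|I|%:R * vn z.
Proof.
rewrite (@le_trans _ _ (\sum_(i : I) vn z))//.
  by apply: ler_sum => i _; exact: nrm_coord_vn.
by rewrite sumr_const mulr_natl.
Qed.

Lemma fmul_vn : exists2 c : R, 0 <= c &
  forall u (z : fmod), vn (fmul F u z : fmod) <= c * fsum u * vn z.
Proof.
have [c c0 H] := fbnd F; pose n : R := #|I|%:R.
exists (n * n * c); first by rewrite !mulr_ge0.
move=> u z; apply: (le_trans (vn_fsum _)).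
apply: (@le_trans _ _ (\sum_(i : I) c * fsum u * (n * vn z))).
  apply: ler_sum => i _; apply: (le_trans (H u z i)).
  by apply: ler_wpM2l; [rewrite mulr_ge0 ?fsum_ge0|exact: fsum_vn].
rewrite sumr_const -[_ *+ #|_|]mulr_natl -/n.
by have -> : n * (c * fsum u * (n * vn z)) = n * n * c * fsum u * vn z by ring.
Qed.

Program Definition fL u : bop fmod := @Bop R A fmod (fmul F u) (fmul F (fstar F u)) _ _ _ _.
Next Obligation. by move=> u a x y; rewrite fmulDr fscaleAr. Qed.
Next Obligation. by move=> u a x y; rewrite fmulDr fscaleAr. Qed.
Next Obligation. by move=> u x y; rewrite /pip /= fadj fstarK. Qed.
Next Obligation.
move=> u; have [c c0 H] := fmul_vn; exists (c * fsum u) => //.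
by rewrite mulr_ge0 ?fsum_ge0.
Qed.

Lemma fL_D u z : fL (u + z) = fL u + fL z.
Proof. by apply: bop_eq => x /=; rewrite ?fstarD fmulDl. Qed.

Lemma fL_Z (a : R[i]) u : fL (a *: u) = a *: fL u.
Proof. by apply: bop_eq => x /=; rewrite ?fstarZ fscaleAl. Qed.

Lemma fL_M u z : fL (fmul F u z) = bopM (fL u) (fL z).
Proof. by apply: bop_eq => x /=; rewrite ?fstarM fmulA. Qed.

Lemma fL_S u : fL (fstar F u) = bopS (fL u).
Proof. by apply: bop_eq => x /=; rewrite ?fstarK. Qed.

Fact fnmD u z : opn (fL (u + z)) <= opn (fL u) + opn (fL z).
Proof. by rewrite fL_D opnD. Qed.

Fact fnmZ (a : R[i]) u : opn (fL (a *: u)) = cabs a * opn (fL u).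
Proof. by rewrite fL_Z opnZ. Qed.

Fact fnmM u z : opn (fL (fmul F u z)) <= opn (fL u) * opn (fL z).
Proof. by rewrite fL_M opnM. Qed.

Fact fnm_star u : opn (fL (fmul F (fstar F u) u)) = opn (fL u) ^+ 2.
Proof. by rewrite fL_M fL_S opn_star. Qed.

Definition fpre : precstar R :=
  @PreCStar R {ffun I -> A} (fmul F) (fstar F) (fone F) (fun u => opn (fL u))
    (@fmulA _ _ _ F) (@fmulDl _ _ _ F) (@fmulDr _ _ _ F) (@fscaleAl _ _ _ F)
    (@fscaleAr _ _ _ F) (@fmul1x _ _ _ F) (@fmulx1 _ _ _ F) (@fstarK _ _ _ F)
    (@fstarD _ _ _ F) (@fstarZ _ _ _ F) (@fstarM _ _ _ F) fnmD fnmZ fnmM fnm_star.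

(** [u] is the image of [fone] under left multiplication by [u]. Together with [opn_fsum] this makes
    the C*-norm equivalent to the sum of the coordinate norms, so definiteness and completeness are
    inherited from [A]. *)
Lemma nrm_coord_opn u i : nrm (u i) <= opn (fL u) * vn (fone F : fmod).
Proof.
apply: (le_trans (nrm_coord_vn u i)).
by have := opnP (fL u) (fone F); rewrite /= fmulx1.
Qed.

Fact fpre_sep (u : fpre) : pnm u = 0 -> u = 0.
Proof.
move=> u0; apply/ffunP => i; rewrite ffunE; apply: nrm_eq0; apply/eqP.
rewrite eq_le nrm_ge0 andbT; have := nrm_coord_opn u i.
by rewrite [opn _]u0 mul0r.
Qed.

Lemma opn_fsum : exists2 c : R, 0 < c & forall u, opn (fL u) <= c * fsum u.
Proof.
have [c c0 H] := fmul_vn; exists (c + 1); first by rewrite ltr_wpDl.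
move=> u; apply: (@le_trans _ _ (c * fsum u)); last first.
  by rewrite ler_wpM2r ?fsum_ge0// lerDl.
by apply: opn_le; [rewrite mulr_ge0 ?fsum_ge0|exact: H].
Qed.

Fact fpre_complete (f : nat -> fpre) : pcauchy f -> exists x, plims f x.
Proof.
move=> fc; have v1 : 0 < vn (fone F : fmod) + 1 by rewrite ltr_wpDl ?vn_ge0.
have cl i : exists x, lims (fun n => (f n : {ffun I -> A}) i) x.
  apply: lims_complete => e e0; have [N hN] := fc _ (divr_gt0 e0 v1).
  exists N => m n Nm Nn; have := hN m n Nm Nn; rewrite ltr_pdivlMr// => h.
  have -> : (f m : {ffun I -> A}) i - (f n : {ffun I -> A}) i =
      ((f m - f n : fpre) : {ffun I -> A}) i by rewrite !ffunE.
  apply: (le_lt_trans (nrm_coord_opn _ i)); apply: le_lt_trans h.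
  by rewrite ler_wpM2l ?opn_ge0// lerDl.
have [x hx] := choice cl.
exists ([ffun i => x i] : {ffun I -> A}) => e e0.
have [c c0 H] := opn_fsum; pose n : R := #|I|%:R + 1.
have n0 : 0 < n by rewrite ltr_wpDl.
have d0 : 0 < e / c / n by rewrite !divr_gt0.
have [N hN] : exists N, forall m, (N <= m)%N -> forall i,
    nrm ((f m : {ffun I -> A}) i - x i) < e / c / n.
  have [N hN] := choice (fun i => hx i _ d0).
  exists (\max_i N i) => m Nm i; apply: hN; apply: leq_trans Nm.
  exact: leq_bigmax.
exists N => m /hN {}hN; apply: (le_lt_trans (H _)).
rewrite mulrC -ltr_pdivlMr//.
apply: (@le_lt_trans _ _ (\sum_(i : I) e / c / n)).
  by apply: ler_sum => i _; rewrite !ffunE; exact: ltW.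
rewrite sumr_const -[_ *+ #|_|]mulr_natr mulrAC ltr_pdivrMr//.
by rewrite ltr_pM2l ?divr_gt0// ltrDl.
Qed.

Definition fcstar : ucstarType R := mkCStar fpre_sep fpre_complete.

(* In the C*-algebra [fcstar] an element acting as a positive form is positive. *)
Lemma fpos (T : {ffun I -> A}) : fstar F T = T ->
  (forall w, pos (\sum_i cstar (w i) *c fmul F T w i)) ->
  exists h, fstar F h = h /\ T = fmul F h h.
Proof.
move=> Ts Tp.
have [n [e [ns es nTn ep]]] := @neg_part R fcstar T Ts.
have eE w z : \sum_i cstar (fmul F w z i) *c z i =
    \sum_i cstar (z i) *c fmul F (fstar F w) z i by rewrite fadj.
have e0 : e = 0.
  (* The identity [n T n = - e^2], paired with [fone] on both sides, reads [<n, T n> = - <e, e>].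
     The form of [T] is positive, so [<e, e>] vanishes. *)
  have h1 : pos (- \sum_i cstar ((e : {ffun I -> A}) i) *c (e : {ffun I -> A}) i).
    have -> : - \sum_i cstar ((e : {ffun I -> A}) i) *c (e : {ffun I -> A}) i =
        \sum_i cstar ((n : {ffun I -> A}) i) *c fmul F T n i; last exact: Tp.
      rewrite -{1}[e : {ffun I -> A}](fmulx1 F) fadj.
      rewrite -{1}[n : {ffun I -> A}](fmulx1 F) fadj.
      rewrite -sumrN; apply: eq_bigr => i _; rewrite -cmulNr; congr (_ *c _).
      have es' : fstar F e = e := es; have ns' : fstar F n = n := ns.
      rewrite es' ns' fmulA; have := congr1 (fun z : fcstar => (z : {ffun I -> A}) i) nTn.
      by move=> /= ->; rewrite ffunE.
  have h2 := pos_anti (pos_sum (index_enum I) xpredT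
    (fun i => pos_cstar ((e : {ffun I -> A}) i))) h1.
  apply/ffunP => i; rewrite ffunE; apply: cstar_eq0.
  apply: pos_anti; first exact: pos_cstar.
  move: h2; rewrite (bigD1 i)//= => /eqP; rewrite addr_eq0 => /eqP ->; rewrite opprK.
  by apply: pos_sum => j; exact: pos_cstar.
have [h hs ->] := ep e0; by exists h.
Qed.

End FinAlg.

(** * The regular trace *)

Section Matrices.
Context {R : realType}.
Local Notation C := R[i].
Local Open Scope sesquilinear_scope.

Lemma psd_factor n (G : 'M[C]_n) :
  (forall i j, G i j = ((G j i)^*)%R) ->
  (forall v : 'I_n -> C, 0 <= \sum_i \sum_j ((v i)^*)%R * G i j * v j) ->
  exists Z : 'M[C]_n, forall i j, G i j = \sum_l ((Z l i)^*)%R * Z l j.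
Proof.
move=> Gh Gp.
have Gn : G \is normalmx.
  apply/normalmxP; have -> : G ^t* = G; last by [].
  by apply/matrixP => i j; rewrite !mxE -Gh.
move/orthomx_spectralP : Gn; have := spectral_unitarymx G.
move: (spectralmx G) (spectral_diag G) => U D Uu.
rewrite invmx_unitary// => GE.
have UU : U *m U ^t* = 1%:M by exact/unitarymxP.
have GU : U *m G *m U ^t* = diag_mx D.
  by rewrite GE !mulmxA UU mul1mx -mulmxA UU mulmx1.
have D0 l : 0 <= D 0 l.
  have := Gp (fun i => ((U l i)^*)%R).
  have -> : \sum_i \sum_j (((U l i)^*)^*)%R * G i j * ((U l j)^*)%R = D 0 l; last by [].
  have := congr1 (fun M : 'M[C]_n => M l l) GU; rewrite !mxE eqxx mulr1n => <-.
  rewrite exchange_big; apply: eq_bigr => j _; rewrite !mxE mulr_suml.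
  by apply: eq_bigr => i _; rewrite conjCK.
exists (\matrix_(l, j) (sqrtC (D 0 l) * U l j)) => i j.
rewrite [LHS](congr1 (fun M : 'M[C]_n => M i j) GE) !mxE; apply: eq_bigr => l _.
rewrite !mxE rmorphM /= (bigD1 l)//= big1 => [|k kl]; last first.
  by rewrite !mxE (negPf kl) mulr0n mulr0.
rewrite !mxE eqxx mulr1n addr0 (geC0_conj (_ : 0 <= sqrtC (D 0 l))) ?sqrtC_ge0//.
by rewrite [RHS]mulrACA -expr2 sqrtCK mulrA [_ * D 0 l]mulrC.
Qed.

(** In Schur form the diagonal entries are eigenvalues, real by hypothesis, and [\tr (A *m A)] is
    the sum of their squares. If it vanishes, the characteristic polynomial is a power of the
    variable, and Cayley-Hamilton makes [A] nilpotent. Only real spectrum is assumed, because no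
    inner product making left multiplications self-adjoint is available before the trace is known to
    be positive. *)
Lemma real_spectrum_trace n (A : 'M[C]_n) :
  (forall a (v : 'rV[C]_n), v != 0 -> v *m A = a *: v -> (a^*)%R = a) ->
  0 <= \tr (A *m A) /\ (\tr (A *m A) = 0 -> exists k, iter k (mulmx A) 1%:M = 0).
Proof.
case: n A => [|n] A Ar.
  by rewrite /mxtrace big_ord0; split=> // _; exists 0%N; apply/matrixP => [[]].
have [P Pu] := Schur A (ltn0Sn n); rewrite /similar_to /= conjymx//.
set T := P *m A *m _ => Tt.
have PP : P *m P ^t* = 1%:M by exact/unitarymxP.
have PP' : P ^t* *m P = 1%:M by exact: mulmx1C.
have TP : T *m P = P *m A by rewrite /T -!mulmxA PP' mulmx1.
have Tr k : ((T k k)^*)%R = T k k.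
  have /eigenvalueP[v vT v0] : eigenvalue T (T k k).
    rewrite eigenvalue_root_char char_poly_trig//.
    by rewrite rootE horner_prod (bigD1 k)//= hornerXsubC subrr mul0r.
  apply: (Ar _ (v *m P)).
    apply: contra v0 => /eqP vP; rewrite -[v]mulmx1 -PP mulmxA vP mul0mx//.
  by rewrite -mulmxA -TP mulmxA vT scalemxAl.
have trE : \tr (A *m A) = \sum_k T k k ^+ 2.
  transitivity (\tr (T *m T)).
    have -> : T *m T = P *m (A *m A) *m P ^t* by rewrite {2}/T !mulmxA TP.
    by rewrite [RHS]mxtrace_mulC !mulmxA PP' mul1mx.
  apply: eq_bigr => k _; rewrite mxE (bigD1 k)//= big1 ?addr0// => l lk.
  have /is_trig_mxP Tt' := Tt; have [kl|lk'] := ltnP k l.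
    by rewrite (Tt' k l)// mul0r.
  by rewrite (Tt' l k) ?mulr0// ltn_neqAle lk' andbT; apply: contra lk => /eqP/val_inj ->.
have T2 k : 0 <= T k k ^+ 2 by rewrite expr2 -{1}Tr mulrC -normCK exprn_ge0.
split; first by rewrite trE sumr_ge0.
rewrite trE => /eqP; rewrite psumr_eq0// => /allP T0.
have {}T0 k : T k k = 0.
  by have /implyP/(_ isT) := T0 k (mem_index_enum k); rewrite sqrf_eq0 => /eqP.
exists n.+1.
have := Cayley_Hamilton T; rewrite char_poly_trig//.
under eq_bigr do rewrite T0 subr0; rewrite prodr_const card_ord rmorphXn /= horner_mx_X => Tn.
have iE k : P *m iter k (mulmx A) 1%:M = T ^+ k *m P.
  elim: k => [|k IH]; first by rewrite /= mulmx1 expr0 mul1mx.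
  by rewrite iterS mulmxA -TP -mulmxA IH exprS mulmxA.
have := congr1 (mulmx (P ^t*)) (iE n.+1).
by rewrite mulmxA PP' mul1mx Tn mul0mx mulmx0.
Qed.

End Matrices.

Section RegularTrace.
Context {R : realType} (P : finCstarType R).
Local Notation C := R[i].
Local Notation d := (pdim P).
Implicit Types p q h : P.

(** The trace of left multiplication by [p] on the vector space [P]. *)
Definition rtr p : C := \sum_i pcoord i (p *c pbase i).

Lemma rtr_lin (a : C) p q : rtr (a *: p + q) = a * rtr p + rtr q.
Proof.
rewrite /rtr mulr_sumr -big_split; apply: eq_bigr => i _ /=.
by rewrite cmulDl -cscaleAl linearP.
Qed.

Lemma rtr0 : rtr 0 = 0.
Proof. by have := rtr_lin (-1) 0 0; rewrite scaler0 addr0 mulN1r addNr. Qed.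

Lemma rtrD p q : rtr (p + q) = rtr p + rtr q.
Proof. by rewrite -[p]scale1r rtr_lin mul1r scale1r. Qed.

Lemma rtrZ (a : C) p : rtr (a *: p) = a * rtr p.
Proof. by rewrite -[a *: p]addr0 rtr_lin rtr0 addr0. Qed.

Lemma rtr_sum (I : Type) (r : seq I) (Q : pred I) (F : I -> P) :
  rtr (\sum_(i <- r | Q i) F i) = \sum_(i <- r | Q i) rtr (F i).
Proof. by apply: (big_morph rtr); [exact: rtrD|exact: rtr0]. Qed.

Lemma rtrC p q : rtr (p *c q) = rtr (q *c p).
Proof.
have E p' q' : rtr (p' *c q') =
    \sum_i \sum_j (pcoord j (q' *c pbase i) : C) * pcoord i (p' *c pbase j).
  apply: eq_bigr => i _; rewrite -cmulA {1}[q' *c pbase i]pcoordE cmul_sumr.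
  by rewrite linear_sum; apply: eq_bigr => j _; rewrite -cscaleAr linearZ.
rewrite !E exchange_big; apply: eq_bigr => i _; apply: eq_bigr => j _.
by rewrite mulrC.
Qed.

Lemma rtr1 : rtr cone = d%:R.
Proof.
rewrite /rtr; under eq_bigr do rewrite cmul1x pcoord_base eqxx.
by rewrite sumr_const card_ord.
Qed.

(** The matrix acts on row vectors of coordinates from the right, which reverses products. *)
Definition lmx p : 'M[C]_d := \matrix_(i, j) pcoord j (p *c pbase i).
Definition pvec (v : 'rV[C]_d) : P := \sum_i v 0 i *: pbase i.

Lemma pvec_mul p v : p *c pvec v = pvec (v *m lmx p).
Proof.
rewrite /pvec cmul_sumr; under [RHS]eq_bigr do rewrite mxE scaler_suml.
rewrite exchange_big; apply: eq_bigr => i _ /=.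
rewrite -cscaleAr [p *c pbase i]pcoordE scaler_sumr; apply: eq_bigr => j _.
by rewrite mxE scalerA.
Qed.

Lemma pvec_inj v : pvec v = 0 -> v = 0.
Proof.
move=> v0; apply/rowP => i; rewrite mxE.
have := congr1 (fun x => pcoord i x : C) v0; rewrite /pvec linear_sum linear0 => <-.
rewrite (bigD1 i)//= big1 => [|j ji]; rewrite linearZ /= pcoord_base.
  by rewrite eqxx mulr1 addr0.
by rewrite (negPf ji) mulr0.
Qed.

Lemma pvecE p : p = pvec (\row_i pcoord i p).
Proof. by rewrite {1}[p]pcoordE; apply: eq_bigr => i _; rewrite mxE. Qed.

Lemma rtr_tr p q : rtr (p *c q) = \tr (lmx q *m lmx p).
Proof.
apply: eq_bigr => i _; rewrite mxE -cmulA {1}[q *c pbase i]pcoordE cmul_sumr.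
by rewrite linear_sum; apply: eq_bigr => j _; rewrite -cscaleAr linearZ !mxE.
Qed.

(** If [h^(k+2) = 0] then [(h^(k+1))^2 = h^(k+2) h^k = 0], and a self-adjoint element with square
    zero vanishes; the exponent thus descends to one. *)
Lemma iter_sa_eq0 h k : cstar h = h -> iter k (cmul h) cone = 0 -> h = 0.
Proof.
move=> hs; have hc j : h *c iter j (cmul h) cone = iter j (cmul h) cone *c h.
  elim: j => [|j IH] /=; first by rewrite cmul1x cmulx1.
  by rewrite {1}IH cmulA.
have hss j : cstar (iter j (cmul h) cone) = iter j (cmul h) cone.
  by elim: j => [|j IH] /=; [exact: cstar1|rewrite cstarM IH hs hc].
elim: k => [/= p1|[|k] IH hk].
- by rewrite -[h]cmulx1 p1 cmulx0.
- by move: hk; rewrite /= cmulx1.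
- apply: IH; apply: sa2_eq0 => //.
  move: hk; rewrite !iterS; have := hc k; move: (iter k _ _) => x hx hk.
  by rewrite cmulA -[h *c x *c h]cmulA -hx hk cmul0x.
Qed.

(** Eigenvalues of left multiplication by [h] are real: if [h v = a v], then [a v^* v = v^* h v] is
    self-adjoint, while [v^* v] is self-adjoint and nonzero. A vanishing trace makes [h] nilpotent,
    hence zero. *)
Lemma rtr_sa h : cstar h = h -> 0 <= rtr (h *c h) /\ (rtr (h *c h) = 0 -> h = 0).
Proof.
move=> hs; rewrite rtr_tr.
have [|tr0 trn] := @real_spectrum_trace R _ (lmx h); last first.
  split=> // /trn[k hk]; apply: (@iter_sa_eq0 _ k) => //.
  have E v j : iter j (cmul h) (pvec v) = pvec (v *m iter j (mulmx (lmx h)) 1%:M).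
    elim: j => [|j IH]; first by rewrite mulmx1.
    rewrite iterS IH pvec_mul; congr pvec; rewrite -mulmxA; congr (_ *m _).
    by elim: j {IH} => [|j IH]; [rewrite /= mul1mx mulmx1|rewrite !iterS -mulmxA IH].
  rewrite [cone]pvecE E hk mulmx0 /pvec big1// => i _.
  by rewrite mxE scale0r.
move=> a v v0 va.
have hv : h *c pvec v = a *: pvec v.
  rewrite pvec_mul va /pvec scaler_sumr; apply: eq_bigr => i _.
  by rewrite mxE scalerA.
have pv0 : pvec v != 0 by apply: contra v0 => /eqP/pvec_inj ->.
pose c := cstar (pvec v) *c pvec v.
have c0 : c != 0 by apply: contra pv0 => /eqP/cstar_eq0 ->.
have h1 : cstar (pvec v) *c (h *c pvec v) = a *: c by rewrite hv -cscaleAr.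
have h2 : a *: c = (a^*)%R *: c.
  have h3 : cstar (cstar (pvec v) *c (h *c pvec v)) = cstar (pvec v) *c (h *c pvec v).
    by rewrite cstarM cstarK cstarM hs cmulA.
  by move: h3; rewrite h1 cstarZ [cstar c]cstarM cstarK => <-.
apply/eqP; rewrite eq_sym -subr_eq0; apply: contraNT c0 => ac.
have : (a - (a^*)%R) *: c = 0 by rewrite scalerBl h2 subrr.
by move/eqP; rewrite scaler_eq0 (negPf ac).
Qed.

Lemma rtr_ge0 p : 0 <= rtr (cstar p *c p).
Proof. by have [h hs ->] := pos_cstar p; have [] := rtr_sa hs. Qed.

Lemma rtr_faithful p : rtr (cstar p *c p) = 0 -> p = 0.
Proof.
have [h hs ph] := pos_cstar p; rewrite ph => h0.
by apply: cstar_eq0; rewrite ph ((rtr_sa hs).2 h0) cmul0x.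
Qed.

Lemma rtr_star p : rtr (cstar p) = ((rtr p)^*)%R.
Proof.
have sq h : cstar h = h -> ((rtr (h *c h))^*)%R = rtr (h *c h).
  by move=> /rtr_sa[h0 _]; exact: geC0_conj.
have rsa h : cstar h = h -> ((rtr h)^*)%R = rtr h.
  move=> hs; have [g gs] := pos_nrmB hs; move: (nrm h) => t gE.
  have -> : h = (-1) *: (g *c g) + t%:C *: (cone *c cone).
    by rewrite -gE scaleN1r opprB cmul1x subrK.
  rewrite rtr_lin rtrZ rmorphD !rmorphM /= rmorphN1 !sq// ?cstar1//.
  by congr (_ + _ * _); exact: conjc_real.
pose u := p + cstar p; pose v := 'i%C *: (p - cstar p).
have us : cstar u = u by rewrite cstarD cstarK addrC.
have vs : cstar v = v.
  rewrite cstarZ cstarB cstarK -opprB scalerN -scaleNr; congr (_ *: _).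
  by apply/eqP; rewrite eq_complex /= oppr0 opprK !eqxx.
have := rsa _ us; have := rsa _ vs; rewrite /v /u rtrZ !rtrD.
rewrite -scaleN1r rtrZ mulN1r rmorphM rmorphB rmorphD /=.
have -> : ('i%C^*)%R = - 'i%C :> C by apply/eqP; rewrite eq_complex /= oppr0 !eqxx.
rewrite mulNr -mulrN opprB => /mulfI h1 h2.
have {h1} : (rtr (cstar p))^* - (rtr p)^* = rtr p - rtr (cstar p).
  by apply: h1; rewrite eq_complex /= oner_eq0 andbF.
move=> h1; apply: (@mulIf _ (2 : C)); first by rewrite pnatr_eq0.
have -> : ((rtr p)^*)%R * 2 = ((rtr p)^* + (rtr (cstar p))^*)%R -
    ((rtr (cstar p))^* - (rtr p)^*)%R by ring.
by rewrite h2 h1; ring.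
Qed.

(* An orthonormal basis for [rtr (p^* q)]. Its Casimir element is [1] because
   the trace of left multiplication by [p] is [sum_k rtr (b_k^* p b_k)]. *)
Lemma rtr_onb : exists b : 'I_d -> P,
  [/\ forall k l, rtr (cstar (b k) *c b l) = (k == l)%:R,
      forall p, p = \sum_k rtr (cstar (b k) *c p) *: b k
    & \sum_k b k *c cstar (b k) = cone].
Proof.
pose G : 'M[C]_d := \matrix_(i, j) rtr (cstar (pbase i) *c pbase j).
have Gv (v : 'I_d -> C) : \sum_i \sum_j ((v i)^*)%R * G i j * v j =
    rtr (cstar (\sum_i v i *: pbase i) *c (\sum_i v i *: pbase i)).
  rewrite cstar_sum cmul_suml rtr_sum; apply: eq_bigr => i _.
  rewrite cmul_sumr rtr_sum; apply: eq_bigr => j _.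
  by rewrite cstarZ -cscaleAl -cscaleAr !rtrZ mxE mulrAC mulrA.
have [|v|Z GZ] := @psd_factor R _ G.
- by move=> i j; rewrite !mxE -rtr_star cstarM cstarK.
- by rewrite Gv rtr_ge0.
have Gb (x y : 'I_d -> C) : rtr (cstar (\sum_i x i *: pbase i) *c \sum_j y j *: pbase j) =
    \sum_l ((\sum_i Z l i * x i)^*)%R * \sum_j Z l j * y j.
  transitivity (\sum_i \sum_j \sum_l ((Z l i * x i)^*)%R * (Z l j * y j)).
    rewrite cstar_sum cmul_suml rtr_sum; apply: eq_bigr => i _.
    rewrite cmul_sumr rtr_sum; apply: eq_bigr => j _.
    rewrite cstarZ -cscaleAl -cscaleAr !rtrZ.
    have -> : rtr (cstar (pbase i) *c pbase j) = G i j by rewrite mxE.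
    rewrite GZ mulrA mulr_sumr; apply: eq_bigr => l _.
    by rewrite rmorphM /=; ring.
  under eq_bigr do rewrite exchange_big.
  rewrite exchange_big; apply: eq_bigr => l _ /=.
  rewrite rmorph_sum mulr_suml; apply: eq_bigr => i _.
  by rewrite mulr_sumr.
have Zu : Z \in unitmx.
  rewrite -unitmx_tr -row_free_unit -kermx_eq0; apply/rowV0P => v /sub_kermxP vZ.
  apply: pvec_inj; apply: rtr_faithful; rewrite /pvec Gb big1// => l _.
  have -> : \sum_i Z l i * v 0 i = 0; last by rewrite mulr0.
  have := congr1 (fun u : 'rV[C]_d => u 0 l) vZ; rewrite !mxE; apply: etrans.
  by apply: eq_bigr => i _; rewrite mxE mulrC.
(* Since the Gram matrix is [G = Z^* Z], the columns of [Z^-1] are orthonormal for it; they are the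
   coordinates of the [b k]. *)
pose W := invmx Z.
have WZ i j : \sum_k W i k * Z k j = (i == j)%:R.
  by have := congr1 (fun M : 'M[C]_d => M i j) (mulVmx Zu); rewrite !mxE.
have ZW i j : \sum_k Z i k * W k j = (i == j)%:R.
  by have := congr1 (fun M : 'M[C]_d => M i j) (mulmxV Zu); rewrite !mxE.
pose b k := \sum_j W j k *: pbase j.
have bE j : pbase j = \sum_k Z k j *: b k.
  under eq_bigr do rewrite scaler_sumr.
  rewrite exchange_big /=.
  under eq_bigr => i _.
    under eq_bigr do rewrite scalerA mulrC.
    rewrite -scaler_suml WZ; over.
  rewrite (bigD1 j)//= eqxx scale1r big1 ?addr0// => i ij.
  by rewrite (negPf ij) scale0r.
have bb k l : rtr (cstar (b k) *c b l) = (k == l)%:R.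
  rewrite Gb; under eq_bigr do rewrite !ZW.
  rewrite (bigD1 k)//= eqxx conjC1 mul1r big1 ?addr0// => m mk.
  by rewrite (negPf mk) conjC0 mul0r.
have bspan p : p = \sum_k rtr (cstar (b k) *c p) *: b k.
  have [c pc] : exists c : 'I_d -> C, p = \sum_k c k *: b k.
    exists (fun k => \sum_j (pcoord j p : C) * Z k j).
    rewrite {1}[p]pcoordE; under eq_bigr do rewrite bE scaler_sumr.
    rewrite exchange_big; apply: eq_bigr => k _; rewrite scaler_suml.
    by apply: eq_bigr => j _; rewrite scalerA.
  rewrite {1}pc; apply: eq_bigr => k _; congr (_ *: _).
  rewrite pc cmul_sumr rtr_sum (bigD1 k)//= big1 => [|l lk].
    by rewrite -cscaleAr rtrZ bb eqxx mulr1 addr0.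
  by rewrite -cscaleAr rtrZ bb eq_sym (negPf lk) mulr0.
exists b; split=> //.
have bc i k : pcoord i (b k) = W i k :> C.
  rewrite linear_sum (bigD1 i)//= big1 => [|j ji]; rewrite linearZ /= pcoord_base.
    by rewrite eqxx mulr1 addr0.
  by rewrite (negPf ji) mulr0.
have trb p : rtr p = \sum_k rtr (cstar (b k) *c p *c b k).
  transitivity (\sum_i \sum_k rtr (cstar (b k) *c (p *c pbase i)) * W i k).
    apply: eq_bigr => i _; rewrite {1}[p *c pbase i]bspan linear_sum.
    by apply: eq_bigr => k _; rewrite linearZ /= bc.
  rewrite exchange_big; apply: eq_bigr => k _ /=.
  rewrite {3}/b cmul_sumr rtr_sum; apply: eq_bigr => i _.
  by rewrite -cscaleAr rtrZ mulrC cmulA.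
(* By [trb] and traciality [rtr (p q) = 0] for every [p]. Taking [p = q^*] gives [q = 0] by
   faithfulness. *)
apply/eqP; rewrite -subr_eq0; set q := _ - _.
apply/eqP; apply: rtr_faithful.
rewrite {2}/q cmulBr cmulx1 -scaleN1r addrC rtr_lin cmul_sumr rtr_sum [X in _ * X]trb.
apply/eqP; rewrite mulN1r addrC subr_eq0; apply/eqP/eq_bigr => k _.
by rewrite cmulA rtrC !cmulA.
Qed.

End RegularTrace.

(** * Tensoring with a finite-dimensional algebra *)

Section Tensor.
Context {R : realType} (P : finCstarType R) (A : ucstarType R).
Local Notation C := R[i].
Local Notation d := (pdim P).
Variable b : 'I_d -> P.
Hypothesis b_orth : forall k l, rtr (cstar (b k) *c b l) = (k == l)%:R.
Hypothesis b_span : forall p, p = \sum_k rtr (cstar (b k) *c p) *: b k.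

Local Notation F := {ffun 'I_d -> A}.
Implicit Types (p q : P) (x y : A) (u v w z : F).

(** The elementary tensor [p (x) x] in the coordinates of the orthonormal basis [b]. Orthonormality
    turns the inner product of [A^d] into [rtr (p^* q) x^* y] on elementary tensors, for which left
    multiplications have the expected adjoints. *)
Definition ft p x : F := [ffun k => rtr (cstar (b k) *c p) *: x].

Lemma ftDl p q x : ft (p + q) x = ft p x + ft q x.
Proof. by apply/ffunP => k; rewrite !ffunE cmulDr rtrD scalerDl. Qed.

Lemma ftZl a p x : ft (a *: p) x = a *: ft p x.
Proof. by apply/ffunP => k; rewrite !ffunE -cscaleAr rtrZ scalerA. Qed.

Lemma ftDr p x y : ft p (x + y) = ft p x + ft p y.
Proof. by apply/ffunP => k; rewrite !ffunE scalerDr. Qed.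

Lemma ftZr a p x : ft p (a *: x) = a *: ft p x.
Proof. by apply/ffunP => k; rewrite !ffunE !scalerA mulrC. Qed.

Lemma ft0l x : ft 0 x = 0.
Proof. by rewrite -(scale0r (0 : P)) ftZl scale0r. Qed.

Lemma ft0r p : ft p 0 = 0.
Proof. by rewrite -(scale0r (0 : A)) ftZr scale0r. Qed.

Lemma ft_suml (I : Type) (r : seq I) (Q : pred I) (G : I -> P) x :
  ft (\sum_(i <- r | Q i) G i) x = \sum_(i <- r | Q i) ft (G i) x.
Proof. by apply: (big_morph (ft^~ x)) => [p q|]; rewrite ?ftDl ?ft0l. Qed.

Lemma ftE z : z = \sum_k ft (b k) (z k).
Proof.
apply/ffunP => l; rewrite sum_ffunE (bigD1 l)//= big1 => [|k kl].
  by rewrite ffunE b_orth eqxx scale1r addr0.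
by rewrite ffunE b_orth eq_sym (negPf kl) scale0r.
Qed.

Lemma ft_ind (Q : F -> Prop) : (forall p x, Q (ft p x)) ->
  (forall u v, Q u -> Q v -> Q (u + v)) -> forall u, Q u.
Proof.
move=> Qt QD u; rewrite [u]ftE; elim/big_ind: _ => //.
by rewrite -(ft0l 0).
Qed.

Definition tmul u v : F := \sum_i \sum_j ft (b i *c b j) (u i *c v j).
Definition tstar u : F := \sum_i ft (cstar (b i)) (cstar (u i)).

Lemma tmulDl : left_distributive tmul +%R.
Proof.
move=> u v w; rewrite -big_split; apply: eq_bigr => i _ /=.
by rewrite -big_split; apply: eq_bigr => j _ /=; rewrite ffunE cmulDl ftDr.
Qed.

Lemma tmulDr : right_distributive tmul +%R.
Proof.
move=> u v w; rewrite -big_split; apply: eq_bigr => i _ /=.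
by rewrite -big_split; apply: eq_bigr => j _ /=; rewrite ffunE cmulDr ftDr.
Qed.

Lemma tscaleAl (a : C) u v : a *: tmul u v = tmul (a *: u) v.
Proof.
rewrite scaler_sumr; apply: eq_bigr => i _; rewrite scaler_sumr; apply: eq_bigr => j _.
by rewrite ffunE -cscaleAl ftZr.
Qed.

Lemma tscaleAr (a : C) u v : a *: tmul u v = tmul u (a *: v).
Proof.
rewrite scaler_sumr; apply: eq_bigr => i _; rewrite scaler_sumr; apply: eq_bigr => j _.
by rewrite ffunE -cscaleAr ftZr.
Qed.

Lemma tmul_ft p q x y : tmul (ft p x) (ft q y) = ft (p *c q) (x *c y).
Proof.
rewrite [p in RHS]b_span [q in RHS]b_span cmul_suml ft_suml; apply: eq_bigr => i _.
rewrite cmul_sumr ft_suml; apply: eq_bigr => j _; rewrite !ffunE.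
by rewrite -!cscaleAl -!cscaleAr !ftZl !ftZr.
Qed.

Lemma tstarD : {morph tstar : x y / x + y}.
Proof.
by move=> u v; rewrite -big_split; apply: eq_bigr => i _ /=; rewrite ffunE cstarD ftDr.
Qed.

Lemma tstarZ (a : C) u : tstar (a *: u) = (a^*)%R *: tstar u.
Proof. by rewrite scaler_sumr; apply: eq_bigr => i _; rewrite ffunE cstarZ ftZr. Qed.

Lemma tstar_ft p x : tstar (ft p x) = ft (cstar p) (cstar x).
Proof.
rewrite [p in RHS]b_span cstar_sum ft_suml; apply: eq_bigr => i _.
by rewrite ffunE !cstarZ ftZl ftZr.
Qed.

Lemma tmulA : associative tmul.
Proof.
move=> u v w; elim/ft_ind: u => [p x|u1 u2 h1 h2]; last by rewrite !tmulDl h1 h2.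
elim/ft_ind: v => [q y|v1 v2 h1 h2]; last by rewrite tmulDl !tmulDr tmulDl h1 h2.
elim/ft_ind: w => [r z|w1 w2 h1 h2]; last by rewrite !tmulDr h1 h2.
by rewrite !tmul_ft !cmulA.
Qed.

Lemma tmul1x : left_id (ft cone cone) tmul.
Proof.
elim/ft_ind => [p x|u1 u2 h1 h2]; first by rewrite tmul_ft !cmul1x.
by rewrite tmulDr h1 h2.
Qed.

Lemma tmulx1 : right_id (ft cone cone) tmul.
Proof.
elim/ft_ind => [p x|u1 u2 h1 h2]; first by rewrite tmul_ft !cmulx1.
by rewrite tmulDl h1 h2.
Qed.

Lemma tstarK : involutive tstar.
Proof.
elim/ft_ind => [p x|u1 u2 h1 h2]; first by rewrite !tstar_ft !cstarK.
by rewrite !tstarD h1 h2.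
Qed.

Lemma tstarM u v : tstar (tmul u v) = tmul (tstar v) (tstar u).
Proof.
elim/ft_ind: u => [p x|u1 u2 h1 h2]; last by rewrite tmulDl !tstarD tmulDr h1 h2.
elim/ft_ind: v => [q y|v1 v2 h1 h2]; last by rewrite tmulDr !tstarD tmulDl h1 h2.
by rewrite tmul_ft !tstar_ft tmul_ft !cstarM.
Qed.

Lemma rtr_parseval p q : rtr (cstar p *c q) =
  \sum_k ((rtr (cstar (b k) *c p))^*)%R * rtr (cstar (b k) *c q).
Proof.
rewrite {1}[p]b_span cstar_sum cmul_suml rtr_sum; apply: eq_bigr => k _.
by rewrite cstarZ -cscaleAl rtrZ.
Qed.

Definition tip u v := \sum_i cstar (u i) *c v i.

Lemma tip_ft p q x y : tip (ft p x) (ft q y) = rtr (cstar p *c q) *: (cstar x *c y).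
Proof.
rewrite rtr_parseval scaler_suml; apply: eq_bigr => k _.
by rewrite !ffunE cstarZ -cscaleAl -cscaleAr scalerA.
Qed.

Lemma tipDl u v w : tip (u + v) w = tip u w + tip v w.
Proof.
by rewrite -big_split; apply: eq_bigr => i _ /=; rewrite ffunE cstarD cmulDl.
Qed.

Lemma tipDr u v w : tip u (v + w) = tip u v + tip u w.
Proof. by rewrite -big_split; apply: eq_bigr => i _ /=; rewrite ffunE cmulDr. Qed.

Lemma tadj u z w : tip (tmul u z) w = tip z (tmul (tstar u) w).
Proof.
elim/ft_ind: u => [p x|u1 u2 h1 h2]; last by rewrite tstarD !tmulDl tipDl tipDr h1 h2.
elim/ft_ind: z => [q y|v1 v2 h1 h2]; last by rewrite !tmulDr !tipDl h1 h2.
elim/ft_ind: w => [r t|w1 w2 h1 h2]; last by rewrite !tmulDr !tipDr h1 h2.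
by rewrite tstar_ft !tmul_ft !tip_ft !cstarM !cmulA.
Qed.

Lemma tbnd : exists2 c : R, 0 <= c & forall u z i,
  nrm (tmul u z i) <= c * (\sum_j nrm (u j)) * (\sum_j nrm (z j)).
Proof.
pose a k i j := cabs (rtr (cstar (b k) *c (b i *c b j))).
have a0 k i j : 0 <= a k i j by exact: cabs_ge0.
exists (\sum_k \sum_i \sum_j a k i j).
  by do 3!(apply: sumr_ge0 => ? _).
have ac k i j : a k i j <= \sum_k \sum_i \sum_j a k i j.
  have le1 (G : 'I_d -> R) l : (forall m, 0 <= G m) -> G l <= \sum_m G m.
    by move=> G0; rewrite (bigD1 l)//= lerDl sumr_ge0.
  apply: (le_trans (le1 (a k i) j (a0 k i))).
  apply: (le_trans (le1 (fun i => \sum_j a k i j) i _)).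
    by move=> m; apply: sumr_ge0.
  apply: (le1 (fun k => \sum_i \sum_j a k i j)).
  by move=> m; do 2!(apply: sumr_ge0 => ? _).
move: (\sum_k \sum_i \sum_j a k i j) ac => c ac u z k.
apply: (@le_trans _ _ (\sum_i \sum_j c * (nrm (u i) * nrm (z j)))); last first.
  rewrite -mulrA mulr_suml mulr_sumr ler_sum// => i _.
  by rewrite mulr_sumr mulr_sumr.
rewrite /tmul sum_ffunE (le_trans (nrm_sum _ _ _))// ler_sum// => i _.
rewrite sum_ffunE (le_trans (nrm_sum _ _ _))// ler_sum// => j _.
rewrite ffunE nrmZ -/(a k i j); apply: ler_pM => //; first exact: nrm_ge0.
exact: nrmM.
Qed.

Definition tensor_alg : finalg A 'I_d :=
  FinAlg tmulA tmulDl tmulDr tscaleAl tscaleAr tmul1x tmulx1 tstarK tstarD tstarZ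
    tstarM tadj tbnd.

Definition tensor_cstar : ucstarType R := fcstar tensor_alg.

Definition tensor_coord (z : tensor_cstar) (i : 'I_d) : A :=
  \sum_k (pcoord i (b k) : C) *: (z : F) k.

Fact tensor_coordK (z : tensor_cstar) :
  \sum_i (ft (pbase i) (tensor_coord z i) : tensor_cstar) = z.
Proof.
rewrite -[RHS]/(z : F) [in RHS](ftE z).
under eq_bigr do rewrite /tensor_coord.
transitivity (\sum_i \sum_k ft ((pcoord i (b k) : C) *: pbase i) ((z : F) k)).
  apply: eq_bigr => i _.
  rewrite (big_morph (ft (pbase i)) (ftDr _) (ft0r _)).
  by apply: eq_bigr => k _; rewrite ftZr ftZl.
rewrite exchange_big; apply: eq_bigr => k _ /=.
by rewrite -ft_suml -pcoordE.
Qed.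

Fact tensor_ftK (f : 'I_d -> A) :
  tensor_coord (\sum_i (ft (pbase i) (f i) : tensor_cstar)) = f.
Proof.
apply/funext => j; rewrite /tensor_coord.
transitivity (\sum_k \sum_i ((pcoord j (b k) : C) * rtr (cstar (b k) *c pbase i)) *: f i).
  apply: eq_bigr => k _; rewrite -[X in _ *: X]/((\sum_i ft (pbase i) (f i) : F) k).
  rewrite sum_ffunE scaler_sumr; apply: eq_bigr => i _.
  by rewrite ffunE scalerA.
rewrite exchange_big /=; transitivity (\sum_i ((i == j)%:R : C) *: f i).
  apply: eq_bigr => i _; rewrite -[(_ == _)%:R](pcoord_base j i) [in RHS](b_span (pbase i)).
  rewrite linear_sum scaler_suml; apply: eq_bigr => k _.
  by rewrite linearZ /= mulrC.
rewrite (bigD1 j)//= eqxx scale1r big1 ?addr0// => i ij.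
by rewrite (negPf ij) scale0r.
Qed.

Definition the_tensor : tensor P A tensor_cstar := @Tensor R P A tensor_cstar
  ft tensor_coord
  (fun a p q x => etrans (ftDl (a *: p) q x) (congr2 +%R (ftZl a p x) (erefl _)))
  (fun a p x y => etrans (ftDr p (a *: x) y) (congr2 +%R (ftZr a p x) (erefl _)))
  tmul_ft tstar_ft tensor_coordK tensor_ftK.

End Tensor.

Theorem tensor_exists (R : realType) (P : finCstarType R) (A : ucstarType R) :
  exists T : ucstarType R, inhabited (tensor P A T).
Proof.
have [b [b_orth b_span _]] := rtr_onb P.
by exists (tensor_cstar A b_orth b_span); split; exact: the_tensor.
Qed.

(** * Positive matrices over a C*-algebra *)

Section MatrixPositivity.
Context {R : realType} {A : ucstarType R}.

Lemma form_gram (n k : nat) (a : 'I_k -> A) (Y : 'I_n -> 'I_k -> A) :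
  \sum_i \sum_j cstar (a i) *c (\sum_l cstar (Y l i) *c Y l j) *c a j =
  \sum_l cstar (\sum_j Y l j *c a j) *c (\sum_j Y l j *c a j).
Proof.
transitivity (\sum_i \sum_j \sum_l cstar (Y l i *c a i) *c (Y l j *c a j)).
  apply: eq_bigr => i _; apply: eq_bigr => j _.
  rewrite cmul_sumr cmul_suml; apply: eq_bigr => l _.
  by rewrite cstarM !cmulA.
under eq_bigr do rewrite exchange_big.
rewrite exchange_big; apply: eq_bigr => l _ /=.
rewrite cstar_sum cmul_suml; apply: eq_bigr => i _.
by rewrite cmul_sumr.
Qed.

Lemma pos_form_gram (n k : nat) (a : 'I_k -> A) (Y : 'I_n -> 'I_k -> A) :
  pos (\sum_i \sum_j cstar (a i) *c (\sum_l cstar (Y l i) *c Y l j) *c a j).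
Proof. by rewrite form_gram; apply: pos_sum => l; exact: pos_cstar. Qed.

Lemma pos_form_scalar (k : nat) (G : 'M[R[i]]_k) (w : 'I_k -> A) :
  (forall i j, G i j = ((G j i)^*)%R) ->
  (forall v : 'I_k -> R[i], 0 <= \sum_i \sum_j ((v i)^*)%R * G i j * v j) ->
  pos (\sum_i \sum_j G i j *: (cstar (w i) *c w j)).
Proof.
move=> Gh Gp; have [Z GZ] := psd_factor Gh Gp.
have -> : \sum_i \sum_j G i j *: (cstar (w i) *c w j) =
  \sum_l cstar (\sum_j Z l j *: w j) *c (\sum_j Z l j *: w j); last first.
  by apply: pos_sum => l; exact: pos_cstar.
transitivity (\sum_i \sum_j \sum_l cstar (Z l i *: w i) *c (Z l j *: w j)).
  apply: eq_bigr => i _; apply: eq_bigr => j _.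
  rewrite GZ scaler_suml; apply: eq_bigr => l _.
  by rewrite cstarZ -cscaleAl -cscaleAr scalerA.
under eq_bigr do rewrite exchange_big.
rewrite exchange_big; apply: eq_bigr => l _ /=.
rewrite cstar_sum cmul_suml; apply: eq_bigr => i _.
by rewrite cmul_sumr.
Qed.

Variable k : nat.
Local Notation F := {ffun 'I_k * 'I_k -> A}.
Implicit Types u v w z : F.

Definition mmul u v : F := [ffun ij => \sum_l u (ij.1, l) *c v (l, ij.2)].
Definition mstar u : F := [ffun ij => cstar (u (ij.2, ij.1))].
Definition mone : F := [ffun ij => if ij.1 == ij.2 then cone else 0].

Lemma mmulA : associative mmul.
Proof.
move=> u v w; apply/ffunP => -[i j]; rewrite !ffunE /=.
under eq_bigr do rewrite ffunE cmul_sumr.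
under [RHS]eq_bigr do rewrite ffunE cmul_suml.
rewrite exchange_big; apply: eq_bigr => l _; apply: eq_bigr => m _ /=.
by rewrite cmulA.
Qed.

Lemma mmulDl : left_distributive mmul +%R.
Proof.
move=> u v w; apply/ffunP => -[i j]; rewrite !ffunE -big_split.
by apply: eq_bigr => l _ /=; rewrite ffunE cmulDl.
Qed.

Lemma mmulDr : right_distributive mmul +%R.
Proof.
move=> u v w; apply/ffunP => -[i j]; rewrite !ffunE -big_split.
by apply: eq_bigr => l _ /=; rewrite ffunE cmulDr.
Qed.

Lemma mscaleAl (a : R[i]) u v : a *: mmul u v = mmul (a *: u) v.
Proof.
apply/ffunP => -[i j]; rewrite !ffunE scaler_sumr.
by apply: eq_bigr => l _ /=; rewrite ffunE cscaleAl.
Qed.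

Lemma mscaleAr (a : R[i]) u v : a *: mmul u v = mmul u (a *: v).
Proof.
apply/ffunP => -[i j]; rewrite !ffunE scaler_sumr.
by apply: eq_bigr => l _ /=; rewrite ffunE cscaleAr.
Qed.

Lemma mmul1x : left_id mone mmul.
Proof.
move=> u; apply/ffunP => -[i j]; rewrite ffunE (bigD1 i)//= big1 => [|l li].
  by rewrite ffunE eqxx cmul1x addr0.
by rewrite ffunE /= eq_sym (negPf li) cmul0x.
Qed.

Lemma mmulx1 : right_id mone mmul.
Proof.
move=> u; apply/ffunP => -[i j]; rewrite ffunE (bigD1 j)//= big1 => [|l li].
  by rewrite ffunE eqxx cmulx1 addr0.
by rewrite ffunE /= (negPf li) cmulx0.
Qed.

Lemma mstarK : involutive mstar.
Proof. by move=> u; apply/ffunP => -[i j]; rewrite !ffunE cstarK. Qed.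

Lemma mstarD : {morph mstar : x y / x + y}.
Proof. by move=> u v; apply/ffunP => -[i j]; rewrite !ffunE cstarD. Qed.

Lemma mstarZ (a : R[i]) u : mstar (a *: u) = (a^*)%R *: mstar u.
Proof. by apply/ffunP => -[i j]; rewrite !ffunE cstarZ. Qed.

Lemma mstarM u v : mstar (mmul u v) = mmul (mstar v) (mstar u).
Proof.
apply/ffunP => -[i j]; rewrite !ffunE cstar_sum.
by apply: eq_bigr => l _; rewrite !ffunE cstarM.
Qed.

Lemma madj u z w : \sum_i cstar (mmul u z i) *c w i =
  \sum_i cstar (z i) *c mmul (mstar u) w i.
Proof.
transitivity (\sum_i \sum_j \sum_l cstar (z (l, j)) *c (cstar (u (i, l)) *c w (i, j))).
  rewrite pair_bigA; apply: eq_bigr => -[i j] _ /=.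
  rewrite ffunE cstar_sum cmul_suml; apply: eq_bigr => l _ /=.
  by rewrite cstarM cmulA.
transitivity (\sum_l \sum_j \sum_i cstar (z (l, j)) *c (cstar (u (i, l)) *c w (i, j))).
  under eq_bigr do rewrite exchange_big.
  rewrite exchange_big; apply: eq_bigr => l _ /=.
  by rewrite exchange_big.
rewrite pair_bigA; apply: eq_bigr => -[l j] _ /=.
rewrite ffunE cmul_sumr; apply: eq_bigr => i _.
by rewrite ffunE.
Qed.

Lemma mbnd : exists2 c : R, 0 <= c & forall u z i,
  nrm (mmul u z i) <= c * (\sum_j nrm (u j)) * (\sum_j nrm (z j)).
Proof.
have le1 (G : 'I_k * 'I_k -> R) l : (forall m, 0 <= G m) -> G l <= \sum_m G m.
  by move=> G0; rewrite (bigD1 l)//= lerDl sumr_ge0.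
exists k%:R => // u z ij; rewrite ffunE (le_trans (nrm_sum _ _ _))//.
rewrite (@le_trans _ _ (\sum_(l < k) (\sum_j nrm (u j)) * (\sum_j nrm (z j))))//.
  apply: ler_sum => l _; apply: (le_trans (nrmM _ _)).
  apply: ler_pM; rewrite ?nrm_ge0//.
    by apply: (le1 (fun j => nrm (u j))) => m; exact: nrm_ge0.
  by apply: (le1 (fun j => nrm (z j))) => m; exact: nrm_ge0.
by rewrite sumr_const card_ord -mulrA mulr_natl.
Qed.

Definition matrix_alg : finalg A ('I_k * 'I_k)%type :=
  FinAlg mmulA mmulDl mmulDr mscaleAl mscaleAr mmul1x mmulx1 mstarK mstarD mstarZ
    mstarM madj mbnd.

(** Left multiplication by [X] on [M_k(A)] acts on each column separately, so the hypothesis says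
    that its form is positive. The self-adjoint square root given by [fpos] then serves as the
    factor. *)
Theorem mx_nneg_form (X : 'M[A]_k) :
  (forall i j, cstar (X i j) = X j i) ->
  (forall a : 'I_k -> A, pos (\sum_i \sum_j cstar (a i) *c X i j *c a j)) ->
  mx_nneg X.
Proof.
move=> Xh Xp; pose T : F := [ffun ij => X ij.1 ij.2].
have [||h [hs Th]] := @fpos R A _ matrix_alg T.
- by apply/ffunP => -[i j]; rewrite !ffunE Xh.
- move=> w; have -> : \sum_i cstar (w i) *c fmul matrix_alg T w i =
      \sum_j \sum_i \sum_l cstar (w (i, j)) *c X i l *c w (l, j).
    rewrite exchange_big pair_bigA; apply: eq_bigr => -[i j] _ /=.
    rewrite ffunE cmul_sumr; apply: eq_bigr => l _.
    by rewrite ffunE cmulA.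
  by apply: pos_sum => j; exact: Xp.
exists (\matrix_(i, j) h (i, j)); apply/matrixP => i j.
have := congr1 (fun f : F => f (i, j)) Th; rewrite mxE !ffunE /= => ->.
apply: eq_bigr => l _; rewrite !mxE; congr (_ *c _).
by rewrite -{1}hs ffunE.
Qed.

End MatrixPositivity.

(** * States *)

Section HahnBanach.
Context {R : realType} {V : lmodType R[i]}.
Implicit Types (q : V -> R) (x y z : V).

Definition sublin q := (forall x y, q (x + y) <= q x + q y) /\
  (forall (t : R) x, 0 < t -> q (t%:C *: x) <= t * q x).

Lemma sublin0 q : sublin q -> q 0 = 0.
Proof.
move=> [qD qZ]; have := qD 0 0; have := qZ (2^-1) 0 ltac:(by rewrite invr_gt0).
rewrite scaler0 addr0; lra.
Qed.

Lemma sublinZ q (t : R) x : sublin q -> 0 <= t -> q (t%:C *: x) = t * q x.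
Proof.
move=> qs; rewrite le_eqVlt => /predU1P[<-|t0].
  by rewrite scale0r mul0r sublin0.
have [_ qZ] := qs; apply/eqP; rewrite eq_le qZ//=.
have := qZ t^-1 (t%:C *: x); rewrite invr_gt0 => /(_ t0).
rewrite scalerA -rmorphM /= mulVf ?gt_eqF// scale1r.
by rewrite mulrC ler_pdivlMr// mulrC.
Qed.

Lemma sublinN q x : sublin q -> - q (- x) <= q x.
Proof. by move=> qs; have := qs.1 x (- x); rewrite subrr sublin0//; lra. Qed.

(** The infimum over [t >= 0] of [q (x + t y) - t q y] is a sublinear functional below [q] whose
    value at [- y] is at most [- q y]. A minimal [q] is therefore odd, and an odd sublinear
    functional is additive. *)
Definition dropset q y x : set R :=
  [set q (x + t%:C *: y) - t * q y | t in [set t : R | 0 <= t]].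
Definition drop_sublin q y x : R := inf (dropset q y x).

Lemma dropset_has_inf q y x : sublin q -> has_inf (dropset q y x).
Proof.
move=> qs; split; first by exists (q (x + 0%:C *: y) - 0 * q y), 0 => /=.
exists (- q (- x)) => _ [t /= t0 <-].
rewrite -(sublinZ y qs t0).
by have := qs.1 (x + t%:C *: y) (- x); rewrite addrAC subrr add0r; lra.
Qed.

Lemma drop_sublin_le q y x (t : R) : sublin q -> 0 <= t ->
  drop_sublin q y x <= q (x + t%:C *: y) - t * q y.
Proof.
by move=> qs t0; apply: ge_inf; [exact: (dropset_has_inf y x qs).2|exists t].
Qed.

Lemma drop_sublinP q y : sublin q -> sublin (drop_sublin q y).
Proof.
move=> qs; split=> [x z|t x t0].
  rewrite -lerBlDr; apply: lb_le_inf; first exact: (dropset_has_inf y x qs).1.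
  move=> _ [s /= s0 <-]; rewrite lerBlDr -lerBlDl.
  apply: lb_le_inf; first exact: (dropset_has_inf y z qs).1.
  move=> _ [t /= t0 <-]; rewrite lerBlDl.
  apply: (le_trans (drop_sublin_le y (x + z) qs (addr_ge0 s0 t0))).
  rewrite rmorphD /= scalerDl addrACA.
  by have := qs.1 (x + s%:C *: y) (z + t%:C *: y); lra.
rewrite mulrC -ler_pdivrMr//; apply: lb_le_inf; first exact: (dropset_has_inf y x qs).1.
move=> _ [s /= s0 <-]; rewrite ler_pdivrMr//.
apply: (le_trans (drop_sublin_le y _ qs (mulr_ge0 (ltW t0) s0))).
rewrite rmorphM /= -scalerA -scalerDr.
by have := qs.2 t (x + s%:C *: y) t0; lra.
Qed.

Lemma drop_le q y x : sublin q -> drop_sublin q y x <= q x.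
Proof.
by move=> qs; have := drop_sublin_le y x qs (lexx 0); rewrite scale0r addr0 mul0r subr0.
Qed.

Lemma drop_opp q y : sublin q -> drop_sublin q y (- y) <= - q y.
Proof.
move=> qs; have := drop_sublin_le y (- y) qs ler01.
by rewrite scale1r addNr sublin0// mul1r sub0r.
Qed.

(* A minimal sublinear functional is linear: it is not decreased by [drop_sublin]. *)
Lemma sublin_linear_below p : sublin p -> exists f : V -> R,
  [/\ forall x, f x <= p x, forall x y, f (x + y) = f x + f y
    & forall (t : R) x, f (t%:C *: x) = t * f x].
Proof.
move=> ps; pose T := {q : V -> R | sublin q /\ forall x, q x <= p x}.
pose le (q r : T) := `[< forall x, sval r x <= sval q x >].
have p0 : T by exists p; split.
have [| | |[m [ms mp]] mmin] := @ZL_preorder T p0 le.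
- by move=> q; apply/asboolP => x.
- by move=> q r s /asboolP qr /asboolP rs; apply/asboolP => x; exact: le_trans (rs x) (qr x).
- move=> D Dtot; have [[q0 Dq0]|D0] := pselect (exists q : T, D q); last first.
    by exists p0 => q Dq; exfalso; apply: D0; exists q.
  (* The lower bound of a chain is its pointwise infimum. Comparability of two members gives
     subadditivity, and the bound [- p (- x)] keeps the infimum finite. *)
  pose S x := [set sval q x | q in D].
  have S0 x : has_inf (S x).
    split; first by exists (sval q0 x), q0.
    exists (- p (- x)) => _ [q Dq <-].
    have [qs qp] := svalP q; have := sublinN x qs; have := qp (- x).
    by move=> /=; lra.
  pose n x := inf (S x).
  have nle (q : T) x : D q -> n x <= sval q x.
    by move=> Dq; apply: ge_inf; [exact: (S0 x).2|exists q].
  have ns : sublin n.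
    split=> [x y|t x t0].
      rewrite -lerBlDr; apply: lb_le_inf; first exact: (S0 x).1.
      move=> _ [q Dq <-]; rewrite lerBlDr -lerBlDl.
      apply: lb_le_inf; first exact: (S0 y).1.
      move=> _ [r Dr <-]; rewrite lerBlDl.
      have [/asboolP qr|/asboolP rq] := Dtot _ _ Dq Dr.
        apply: (le_trans (nle r _ Dr)); have [rs _] := svalP r.
        by apply: (le_trans (rs.1 x y)); apply: lerD.
      apply: (le_trans (nle q _ Dq)); have [qs _] := svalP q.
      by apply: (le_trans (qs.1 x y)); apply: lerD.
    rewrite mulrC -ler_pdivrMr//; apply: lb_le_inf; first exact: (S0 x).1.
    move=> _ [q Dq <-]; rewrite ler_pdivrMr//; apply: (le_trans (nle q _ Dq)).
    by have [qs _] := svalP q; rewrite mulrC; exact: qs.2.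
  have np x : n x <= p x.
    by apply: (le_trans (nle q0 x Dq0)); have [_] := svalP q0; exact.
  by exists (exist _ n (conj ns np)) => q Dq; apply/asboolP => x; exact: nle.
have mN y : m (- y) = - m y.
  have dp x : drop_sublin m y x <= p x by apply: le_trans (mp x); exact: drop_le.
  have /asboolP /= := mmin (exist _ _ (conj (drop_sublinP y ms) dp))
    ltac:(by apply/asboolP => x /=; exact: drop_le).
  move=> /(_ (- y)) h; apply/eqP; rewrite eq_le.
  rewrite (le_trans h (drop_opp y ms))/=.
  by have := sublinN y ms; lra.
have mD x y : m (x + y) = m x + m y.
  apply/eqP; rewrite eq_le ms.1 /= -lerBrDr -mN.
  by have := ms.1 (x + y) (- y); rewrite addrK.
exists m; split=> // t x; have [t0|t0] := leP 0 t; first exact: sublinZ.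
rewrite -[t]opprK rmorphN scaleNr mN sublinZ//; last by rewrite oppr_ge0 ltW.
by rewrite !mulNr.
Qed.

End HahnBanach.

Section States.
Context {R : realType} (A : ucstarType R).
Local Notation C := R[i].
Hypothesis A1 : (cone : A) != 0.

Lemma nrm1 : nrm (cone : A) = 1.
Proof.
have := nrm_cstar (cone : A); rewrite cstar1 cmul1x => h.
have n0 : nrm (cone : A) != 0.
  by apply: contra A1 => /eqP/nrm_eq0 ->.
by apply: (mulfI n0); rewrite mulr1 -expr2.
Qed.

(** The linear functional is taken below [drop_sublin nrm cone] instead of below the norm itself:
    this imposes [f (- cone) <= - nrm cone], which fixes its value at the unit. *)
Lemma real_state : exists f : A -> R,
  [/\ forall x, f x <= nrm x, forall x y, f (x + y) = f x + f y,
      forall (t : R) x, f (t%:C *: x) = t * f x & f cone = 1].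
Proof.
have ns : sublin (@nrm R A).
  by split=> [x y|t x t0]; [exact: nrmD|rewrite nrmZr gtr0_norm].
have [f [fp fD fZ]] := sublin_linear_below (drop_sublinP cone ns).
have fn x : f x <= nrm x by apply: le_trans (fp x) _; exact: drop_le.
exists f; split=> //.
have fN : f (- cone) = - f cone.
  by rewrite -scaleN1r -(rmorphN1 (real_complex R)) fZ mulN1r.
apply/eqP; rewrite eq_le; have := fn cone; rewrite nrm1 => -> /=.
have := le_trans (fp (- cone)) (drop_opp cone ns).
by rewrite fN nrm1 lerN2.
Qed.

(** Evaluating [f] on the real and imaginary parts makes [s] hermitian; positivity follows from
    [nrm (nrm a - a) <= nrm a]. The crude constant 2 is enough, as only boundedness is needed
    later. *)
Lemma state_exists : exists s : A -> C,
  [/\ forall (a : C) x y, s (a *: x + y) = a * s x + s y, s cone = 1,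
      forall x, s (cstar x) = ((s x)^*)%R, forall a, pos a -> 0 <= s a
    & forall x, cabs (s x) <= 2 * nrm x].
Proof.
have [f [fn fD fZ f1]] := real_state.
have fN x : f (- x) = - f x.
  by rewrite -scaleN1r -(rmorphN1 (real_complex R)) fZ mulN1r.
pose re x : A := (2^-1 : R)%:C *: (x + cstar x).
pose im x : A := (2^-1 : R)%:C *: ('i%C *: (cstar x - x)).
have reD x y : re (x + y) = re x + re y by rewrite /re cstarD addrACA scalerDr.
have imD x y : im (x + y) = im x + im y.
  by rewrite /im cstarD opprD addrACA !scalerDr.
have reZ (t : R) x : re (t%:C *: x) = t%:C *: re x.
  by rewrite /re cstarZr -scalerDr !scalerA mulrC.
have imZ (t : R) x : im (t%:C *: x) = t%:C *: im x.
  by rewrite /im cstarZr -scalerBr !scalerA; congr (_ *: _); ring.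
have conji : ('i%C^*)%R = - 'i%C :> C by apply/eqP; rewrite eq_complex /= oppr0 !eqxx.
have rei x : re ('i%C *: x) = - im x.
  by rewrite /re /im cstarZ conji scaleNr -scalerBr -scalerN -scalerN opprB.
have imi x : im ('i%C *: x) = re x.
  rewrite /re /im cstarZ conji scaleNr -opprD -scalerDr scalerN scalerA -expr2.
  by rewrite sqr_i scaleN1r opprK addrC.
pose s x : C := (f (re x))%:C + 'i%C * (f (im x))%:C.
have sD x y : s (x + y) = s x + s y.
  by rewrite /s reD imD !fD !rmorphD mulrDr addrACA.
have sZ (t : R) x : s (t%:C *: x) = t%:C * s x.
  by rewrite /s reZ imZ !fZ !rmorphM; ring.
have si x : s ('i%C *: x) = 'i%C * s x.
  rewrite /s rei imi fN rmorphN mulrDr [in RHS]mulrA -expr2 sqr_i mulN1r addrC.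
  by [].
have sS x : s (cstar x) = ((s x)^*)%R.
  have -> : s (cstar x) = (f (re x))%:C - 'i%C * (f (im x))%:C.
    rewrite /s; have -> : re (cstar x) = re x by rewrite /re cstarK addrC.
    have -> : im (cstar x) = - im x by rewrite /im cstarK -scalerN -scalerN opprB.
    by rewrite fN rmorphN mulrN.
  by apply/eqP; rewrite eq_complex /= !(mul0r, mulr0, mul1r, subr0, addr0, add0r, oppr0) !eqxx.
have sre x : cstar x = x -> s x = (f x)%:C.
  move=> xs; rewrite /s /re /im xs subrr !scaler0.
  have -> : f 0 = 0 by have := fZ 0 0; rewrite scale0r mul0r.
  by rewrite mulr0 addr0 addxx scalerA -rmorphM /= mulVf// scale1r.
exists s; split.
- move=> a x y; rewrite sD [a in LHS]complexE scalerDl sD sZ -scalerA si sZ.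
  by rewrite mulrA -mulrDl -complexE.
- by rewrite sre ?cstar1// f1.
- exact: sS.
- move=> a pa; rewrite sre ?pos_sa// ler0c.
  have := pos_ball pa (lexx _); have := fn ((nrm a)%:C *: cone - a).
  by rewrite fD fZ f1 fN mulr1; lra.
- move=> x; rewrite -lecR -cabsE (le_trans (ler_normD _ _))//.
  have ni : `|'i%C : C| = 1.
    by apply/eqP; rewrite normc_def eq_complex /= expr0n add0r expr1n sqrtr1 !eqxx.
  rewrite normrM ni mul1r !cabsE !cabs_real -rmorphD lecR.
  have fa y : `|f y| <= nrm y.
    by rewrite ler_norml fn andbT; have := fn (- y); rewrite fN nrmN; lra.
  have rx : nrm (re x) <= nrm x.
    rewrite /re nrmZr ger0_norm ?invr_ge0//; have := nrmD x (cstar x).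
    by rewrite nrm_star; lra.
  have ix : nrm (im x) <= nrm x.
    rewrite /im nrmZr ger0_norm ?invr_ge0// nrmZ.
    have -> : cabs 'i = 1 :> R by apply: complexI; rewrite -cabsE ni.
    by have := nrmB (cstar x) x; rewrite nrm_star; lra.
  by have := fa (re x); have := fa (im x); lra.
Qed.

End States.

(** * Vector functionals *)

Section VectorFunctionals.
Context {R : realType} {A : ucstarType R} (V : premod A).
Local Notation X := (completed (bops V)).
Local Notation appr := (@appr R (bops V)).
Implicit Types (x y z : V) (S T : X).

Definition emb (B : bops V) : X := cls (pcauchy_cst B).

Lemma emb_appr B : appr (emb B) (fun=> B).
Proof. exact: appr_cls. Qed.

Lemma emb_lin (a : R[i]) B D : emb (a *: B + D) = a *: emb B + emb D.
Proof.
apply: (appr_eq (emb_appr _) _ (frefl _)).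
by apply: apprD; [apply: apprZ; exact: emb_appr|exact: emb_appr].
Qed.

Lemma emb0 : emb 0 = 0.
Proof. by have := emb_lin (-1) 0 0; rewrite scaler0 addr0 scaleN1r addNr. Qed.

Lemma embZ (a : R[i]) B : emb (a *: B) = a *: emb B.
Proof. by rewrite -[a *: B]addr0 emb_lin emb0 addr0. Qed.

Lemma embM B D : emb (pmul B D) = emb B *c emb D.
Proof.
apply: (appr_eq (emb_appr _) _ (frefl _)).
by apply: apprM; exact: emb_appr.
Qed.

Lemma embS B : emb (pstar B) = cstar (emb B).
Proof.
by apply: (appr_eq (emb_appr _) _ (frefl _)); apply: apprS; exact: emb_appr.
Qed.

Lemma emb1 : emb (pone _) = cone.
Proof. exact: (appr_eq (emb_appr _) (@appr1 _ (bops V)) (frefl _)). Qed.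

Lemma vec_lims_exists x y T : exists a, forall u, appr T u -> lims (fun n => pip x (u n y)) a.
Proof.
have H u : appr T u -> exists a, lims (fun n => pip x (u n y)) a.
  move=> Tu; have uc := appr_pcauchy Tu.
  apply: lims_complete => e e0; pose c := vn x * vn y + 1.
  have c0 : 0 < c by rewrite ltr_wpDl// mulr_ge0 ?vn_ge0.
  have [N hN] := uc _ (divr_gt0 e0 c0); exists N => m n Nm Nn.
  have := hN m n Nm Nn; rewrite ltr_pdivlMr// => h.
  have -> : pip x (u m y) - pip x (u n y) = pip x ((u m - u n : bops V) y).
    by rewrite -pipNr -pipDr /= scaleN1r.
  apply: (le_lt_trans (pip_cs _ _)); apply: le_lt_trans h.
  apply: (le_trans (ler_wpM2l (vn_ge0 _) (opnP (u m - u n) y))).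
  rewrite mulrCA ler_wpM2l ?opn_ge0//; rewrite /c; lra.
have [a ha] := H _ (appr_crep T); exists a => u Tu.
have [b hb] := H _ Tu; have -> // : a = b.
apply: lims_uniq ha _ => e e0; pose c := vn x * vn y + 1.
have c0 : 0 < c by rewrite ltr_wpDl// mulr_ge0 ?vn_ge0.
have [N hN] := hb _ (divr_gt0 e0 (ltr0Sn _ 1)).
have [M hM] := Tu _ (divr_gt0 (divr_gt0 e0 (ltr0Sn _ 1)) c0).
exists (maxn N M) => n; rewrite geq_max => /andP[/hN h1 /hM].
rewrite ltr_pdivlMr// => h2; apply: (le_lt_trans (nrm_tri _ (pip x (u n y)) _)).
rewrite [ltRHS]splitr ltrD//.
have -> : pip x (crep T n y) - pip x (u n y) = pip x ((crep T n - u n : bops V) y).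
  by rewrite -pipNr -pipDr /= scaleN1r.
apply: (le_lt_trans (pip_cs _ _)); apply: le_lt_trans h2.
apply: (le_trans (ler_wpM2l (vn_ge0 _) (opnP (crep T n - u n) y))).
rewrite mulrCA ler_wpM2l ?opn_ge0//; rewrite /c; lra.
Qed.

(** The functional [<x, T y>] extended from operators to the completion by continuity; [vfun_lims]
    evaluates it along any representative. *)
Definition vfun x y T : A := sval (cid (vec_lims_exists x y T)).

Lemma vfun_lims x y T u : appr T u -> lims (fun n => pip x (u n y)) (vfun x y T).
Proof. by rewrite /vfun; case: cid => a /= h /h. Qed.

Lemma vfun_emb x y B : vfun x y (emb B) = pip x (B y).
Proof. exact: lims_uniq (vfun_lims x y (emb_appr B)) (lims_cst _). Qed.

Lemma vfun_lin x y (a : R[i]) S T : vfun x y (a *: S + T) = a *: vfun x y S + vfun x y T.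
Proof.
have h : appr (a *: S + T) (fun n => a *: crep S n + crep T n).
  by apply: apprD; [apply: apprZ|]; exact: appr_crep.
apply: lims_uniq (vfun_lims x y h) _.
have -> : (fun n => pip x ((a *: crep S n + crep T n : bops V) y)) =
    (fun n => a *: pip x (crep S n y) + pip x (crep T n y)).
  by apply/funext => n; rewrite pipDr pipZr.
by apply: limsD; [apply: limsZ|]; apply: vfun_lims; exact: appr_crep.
Qed.

Lemma vfun_linl (a : R[i]) x x' y T :
  vfun (a *: x + x') y T = (a^*)%R *: vfun x y T + vfun x' y T.
Proof.
apply: lims_uniq (vfun_lims _ _ (appr_crep T)) _.
have -> : (fun n => pip (a *: x + x') (crep T n y)) =
    (fun n => (a^*)%R *: pip x (crep T n y) + pip x' (crep T n y)).
  by apply/funext => n; rewrite pipDl pipZl.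
by apply: limsD; [apply: limsZ|]; apply: vfun_lims; exact: appr_crep.
Qed.

Lemma vfun_star x y T : vfun x y (cstar T) = cstar (vfun y x T).
Proof.
have h : appr (cstar T) (fun n => pstar (crep T n)) by apply: apprS; exact: appr_crep.
apply: lims_uniq (vfun_lims x y h) _.
have -> : (fun n => pip x ((pstar (crep T n) : bops V) y)) =
    (fun n => cstar (pip y (crep T n x))).
  by apply/funext => n; rewrite -badjE pip_star.
by apply: lims_star; apply: vfun_lims; exact: appr_crep.
Qed.

Lemma vfun_rank1l x y u v T :
  vfun x y (emb (bop_rank1 u v) *c T) = pip x u *c vfun v y T.
Proof.
have h : appr (emb (bop_rank1 u v) *c T)
    (fun n => pmul (bop_rank1 u v : bops V) (crep T n)).
  by apply: apprM; [exact: emb_appr|exact: appr_crep].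
apply: lims_uniq (vfun_lims x y h) _.
have -> : (fun n => pip x ((pmul (bop_rank1 u v : bops V) (crep T n)) y)) =
    (fun n => pip x u *c pip v (crep T n y)).
  by apply/funext => n; rewrite /= pip_act.
by apply: limsM; [exact: lims_cst|apply: vfun_lims; exact: appr_crep].
Qed.

Lemma vfun_nrm x y T : nrm (vfun x y T) <= nrm T * (vn x * vn y).
Proof.
apply/ler_addgt0Pr => e e0; pose c := vn x * vn y + 1.
have c0 : 0 < c by rewrite ltr_wpDl// mulr_ge0 ?vn_ge0.
have := appr_compn (appr_crep T); move/cvgrPdist_lt => /(_ _ (divr_gt0 e0 c0))[N _ hN].
apply: (lims_bound_ev (N := N) (vfun_lims x y (appr_crep T))) => n /hN {}hN.
apply: (le_trans (pip_cs _ _)); apply: (le_trans (ler_wpM2l (vn_ge0 _) (opnP (crep T n) y))).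
rewrite mulrCA; have h : opn (crep T n) <= nrm T + e / c.
  move: hN; rewrite ltr_norml => /andP[h _]; rewrite -[nrm T]/(compn T).
  by move: h; rewrite /=; lra.
apply: (le_trans (ler_wpM2r _ h)); first by rewrite mulr_ge0 ?vn_ge0.
rewrite mulrDl lerD2l mulrAC ler_pdivrMr// ler_wpM2l ?ltW//; rewrite /c; lra.
Qed.

(** On operators the form equals [<v, v>] for [v = sum_j (Y_j x) a_j]; positivity survives the
    limit. *)
Lemma vfun_cp (k : nat) x (Y : 'I_k -> X) (a : 'I_k -> A) :
  pos (\sum_i \sum_j cstar (a i) *c vfun x x (cstar (Y i) *c Y j) *c a j).
Proof.
pose u n := \sum_i \sum_j cstar (a i) *c
  pip x ((pmul (pstar (crep (Y i) n)) (crep (Y j) n) : bops V) x) *c a j.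
apply: (@pos_lims _ _ u) => [n|]; last first.
  apply: lims_sum => i; apply: lims_sum => j.
  apply: limsM; last exact: lims_cst.
  apply: limsM; first exact: lims_cst.
  by apply: vfun_lims; apply: apprM; [apply: apprS|]; exact: appr_crep.
have -> : u n = pip (\sum_j pact (crep (Y j) n x) (a j)) (\sum_j pact (crep (Y j) n x) (a j)).
  rewrite pip_suml; apply: eq_bigr => i _; rewrite pip_sumr; apply: eq_bigr => j _.
  by rewrite pip_act pip_actl /= badjE.
exact: pip_pos.
Qed.

End VectorFunctionals.

(** * Slicing by the trace *)

Section TraceSlice.
Context {R : realType} {P : finCstarType R} {A T : ucstarType R}.
Variable t : tensor P A T.
Local Notation C := R[i].
Implicit Types (p q : P) (x y : A) (u v w z : T).

Lemma tens_addl p q x : tens t (p + q) x = tens t p x + tens t q x.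
Proof. by rewrite -[p in LHS]scale1r tensDl scale1r. Qed.

Lemma tens_addr p x y : tens t p (x + y) = tens t p x + tens t p y.
Proof. by rewrite -[x in LHS]scale1r tensDr scale1r. Qed.

Lemma tens_sumr (I : Type) (r : seq I) (Q : pred I) (F : I -> A) p :
  tens t p (\sum_(i <- r | Q i) F i) = \sum_(i <- r | Q i) tens t p (F i).
Proof. by apply: (big_morph (tens t p)); [exact: tens_addr|exact: tens0r]. Qed.

Lemma tens_ind (Q : T -> Prop) : (forall p x, Q (tens t p x)) ->
  (forall u v, Q u -> Q v -> Q (u + v)) -> forall u, Q u.
Proof.
move=> Qt QD u; rewrite -[u](tcoordK t); elim/big_ind: _ => //.
by rewrite -(tens0l t 0).
Qed.

(** The slice map [rtr (x) id]. *)
Definition trs z : A := \sum_i rtr (pbase i) *: tcoord t z i.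

Lemma trs_lin (a : C) u v : trs (a *: u + v) = a *: trs u + trs v.
Proof.
rewrite /trs scaler_sumr -big_split; apply: eq_bigr => i _ /=.
by rewrite tcoord_lin scalerDr !scalerA mulrC.
Qed.

Lemma trs0 : trs 0 = 0.
Proof. by have := trs_lin (-1) 0 0; rewrite scaler0 addr0 scaleN1r addNr. Qed.

Lemma trsD u v : trs (u + v) = trs u + trs v.
Proof. by rewrite -[u in LHS]scale1r trs_lin scale1r. Qed.

Lemma trsZ (a : C) u : trs (a *: u) = a *: trs u.
Proof. by rewrite -[a *: u]addr0 trs_lin trs0 addr0. Qed.

Lemma trs_sum (I : Type) (r : seq I) (Q : pred I) (F : I -> T) :
  trs (\sum_(i <- r | Q i) F i) = \sum_(i <- r | Q i) trs (F i).
Proof. by apply: (big_morph trs); [exact: trsD|exact: trs0]. Qed.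

Lemma trs_tens p x : trs (tens t p x) = rtr p *: x.
Proof.
rewrite /trs; under eq_bigr do rewrite tcoord_tens scalerA.
rewrite -scaler_suml; congr (_ *: _); rewrite [p in RHS]pcoordE rtr_sum.
by apply: eq_bigr => i _; rewrite rtrZ mulrC.
Qed.

Lemma trs_star z : trs (cstar z) = cstar (trs z).
Proof.
elim/tens_ind: z => [p x|u v hu hv]; last by rewrite cstarD !trsD hu hv cstarD.
by rewrite tens_star !trs_tens rtr_star cstarZ.
Qed.

Lemma trs_mulr z x : trs (z *c tens t cone x) = trs z *c x.
Proof.
elim/tens_ind: z => [p y|u v hu hv]; last by rewrite cmulDl !trsD hu hv cmulDl.
by rewrite tensM !trs_tens cmulx1 -cscaleAl.
Qed.

(** Writing [h = sum_k b_k (x) c_k] in the orthonormal basis gives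
    [trs (h^* h) = sum_k c_k^* c_k]. *)
Lemma trs_pos z : pos z -> pos (trs z).
Proof.
move=> [h hs ->]; rewrite -{1}hs.
have [b [b_orth b_span _]] := rtr_onb P.
pose c k := trs (tens t (cstar (b k)) cone *c h).
have hE : h = \sum_k tens t (b k) (c k).
  rewrite /c; elim/tens_ind: (h) => [p x|u v hu hv].
    rewrite [p in LHS]b_span tens_suml; apply: eq_bigr => k _.
    by rewrite tensM trs_tens cmul1x tensZl tensZr.
  rewrite [u in LHS]hu [v in LHS]hv -big_split; apply: eq_bigr => k _ /=.
  by rewrite cmulDr trsD tens_addr.
have -> : trs (cstar h *c h) = \sum_k cstar (c k) *c c k; last first.
  by apply: pos_sum => k; exact: pos_cstar.
rewrite hE cstar_sum cmul_suml trs_sum; apply: eq_bigr => k _.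
rewrite cmul_sumr trs_sum (bigD1 k)//= big1 => [|l lk].
  by rewrite tens_star tensM trs_tens b_orth eqxx scale1r addr0.
by rewrite tens_star tensM trs_tens b_orth eq_sym (negPf lk) scale0r.
Qed.

End TraceSlice.

(** * The reproducing kernel module *)

Section Kernel.
Context {R : realType} {P : finCstarType R} {O A PA : ucstarType R}.
Variables (t : tensor P A PA) (psi : O -> PA).
Local Notation C := R[i].

(** Complete positivity as positivity of forms with coefficients in [PA], exactly what the inner
    product of the kernel module requires. Compatibility with the involution is recorded
    alongside. *)
Record cpmap : Prop := CPMap {
  cp_lin : forall (a : C) x y, psi (a *: x + y) = a *: psi x + psi y;
  cp_one : psi cone = cone;
  cp_star : forall x, psi (cstar x) = cstar (psi x);
  cp_pos : forall (n : nat) (y : 'I_n -> O) (w : 'I_n -> PA),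
    pos (\sum_i \sum_j cstar (w i) *c psi (cstar (y i) *c y j) *c w j)
}.

Hypothesis cp : cpmap.

Lemma cpD x y : psi (x + y) = psi x + psi y.
Proof. by have := cp_lin cp 1 x y; rewrite !scale1r. Qed.

Lemma cp0 : psi 0 = 0.
Proof. by have := cp_lin cp (-1) 0 0; rewrite scaler0 addr0 scaleN1r addNr. Qed.

Lemma cpZ a x : psi (a *: x) = a *: psi x.
Proof. by rewrite -[a *: x]addr0 (cp_lin cp) cp0 addr0. Qed.

Implicit Types (s r : seq (O * PA)).

(* The element [sum_(y, w) y (x) w] of [O (x)_psi PA], as the antilinear function
   [x |-> <x, sum y (x) w> = sum psi (x^* y) w]. *)
Definition kfun s : O -> PA := fun x => \sum_(u <- s) psi (cstar x *c u.1) *c u.2.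

Definition kset : set (O -> PA) := [set f | exists s, f = kfun s].

Definition kpred : {pred O -> PA} := fun f => f \in kset.

Lemma kpredP f : reflect (exists s, f = kfun s) (f \in kpred).
Proof. by apply: (iffP idP) => [/set_mem|/mem_set]. Qed.

Definition kscale (a : C) s := [seq (u.1, a *: u.2) | u <- s].

Lemma kfun_cat s r : kfun (s ++ r) = kfun s + kfun r.
Proof. by apply/funext => x; rewrite /kfun big_cat. Qed.

Lemma kfun_scale a s : kfun (kscale a s) = a *: kfun s.
Proof.
apply/funext => x; rewrite /kfun big_map [RHS]scaler_sumr.
by apply: eq_bigr => u _ /=; rewrite cscaleAr.
Qed.

Fact kpred_submod : submod_closed kpred.
Proof.
split=> [|a f g /kpredP[s ->] /kpredP[r ->]]; apply/kpredP.
  by exists [::]; apply/funext => x; rewrite /kfun big_nil.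
by exists (kscale a s ++ r); rewrite kfun_cat kfun_scale.
Qed.

HB.instance Definition _ := GRing.isSubmodClosed.Build C (O -> PA) kpred kpred_submod.

Definition kmod := {f : O -> PA | f \in kpred}.

HB.instance Definition _ := SubChoice.on kmod.
HB.instance Definition _ := [SubChoice_isSubLmodule of kmod by <:].

Implicit Types f g h : kmod.

Lemma kmodP f : exists s, val f = kfun s.
Proof. exact/kpredP/(valP f). Qed.

Definition krep f := sval (cid (kmodP f)).

Lemma krepE f : val f = kfun (krep f).
Proof. by rewrite /krep; case: cid. Qed.

Definition kin s : kmod := exist _ (kfun s) (introT (kpredP _) (ex_intro _ s erefl)).

Lemma kmod_eq f g : (forall x, val f x = val g x) -> f = g.
Proof. by move=> fg; apply: val_inj; apply/funext. Qed.

Definition kip f g : PA := \sum_(u <- krep f) cstar u.2 *c val g u.1.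

Lemma kip_sym s r : \sum_(u <- s) cstar u.2 *c kfun r u.1 =
  \sum_(v <- r) cstar (cstar v.2 *c kfun s v.1).
Proof.
under eq_bigr do rewrite cmul_sumr.
rewrite exchange_big; apply: eq_bigr => v _ /=.
rewrite cmul_sumr cstar_sum; apply: eq_bigr => u _.
by rewrite !cstarM cstarK -(cp_star cp) cstarM cstarK cmulA.
Qed.

(** The sum in [kip] uses a chosen representative of [f]. By [kip_sym] it can be rewritten with a
    representative of [g] and the values of [f], so the choice does not matter. *)
Lemma kipE f g s : val f = kfun s -> kip f g = \sum_(u <- s) cstar u.2 *c val g u.1.
Proof.
move=> fs; rewrite /kip (krepE g) !kip_sym.
by apply: eq_bigr => v _; rewrite -krepE fs.
Qed.

Lemma kip_star f g : cstar (kip f g) = kip g f.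
Proof.
rewrite (kipE g (krepE f)) (krepE g) kip_sym cstar_sum.
rewrite (kipE f (krepE g)); apply: eq_bigr => v _.
by rewrite cstarK -krepE.
Qed.

Lemma kip_lin f (a : C) g h : kip f (a *: g + h) = a *: kip f g + kip f h.
Proof.
rewrite /kip scaler_sumr -big_split; apply: eq_bigr => u _.
transitivity (cstar u.2 *c (a *: val g u.1 + val h u.1)); first by [].
by rewrite cmulDr cscaleAr.
Qed.

Lemma kip_pos f : pos (kip f f).
Proof.
rewrite (kipE f (krepE f)) (krepE f).
move: (krep f) => s; rewrite big_tnth.
have -> : \sum_(i < size s) cstar (tnth (in_tuple s) i).2 *c kfun s (tnth (in_tuple s) i).1 =
  \sum_(i < size s) \sum_(j < size s) cstar (tnth (in_tuple s) i).2 *c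
     psi (cstar (tnth (in_tuple s) i).1 *c (tnth (in_tuple s) j).1) *c (tnth (in_tuple s) j).2.
  apply: eq_bigr => i _; rewrite /kfun big_tnth cmul_sumr.
  by apply: eq_bigr => j _; rewrite cmulA.
exact: (cp_pos cp (fun i => (tnth (in_tuple s) i).1) (fun i => (tnth (in_tuple s) i).2)).
Qed.

Lemma kact_proof f (a : A) : (fun x => val f x *c tens t cone a) \in kpred.
Proof.
apply/kpredP; exists [seq (u.1, u.2 *c tens t cone a) | u <- krep f].
apply/funext => x; rewrite krepE /kfun big_map cmul_suml.
by apply: eq_bigr => u _; rewrite cmulA.
Qed.

Definition kact f a : kmod := @exist (O -> PA) (fun u : O -> PA => u \in kpred) _ (kact_proof f a).

Program Definition kpremod : premod A :=
  @PreMod R A kmod kact (fun f g => trs t (kip f g)) _ _ _ _ _.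
Next Obligation. by move=> f a g h /=; rewrite kip_lin trs_lin. Qed.
Next Obligation. by move=> f g /=; rewrite -trs_star kip_star. Qed.
Next Obligation.
move=> f c a a'; apply: kmod_eq => x /=.
by rewrite tensDr cmulDr -cscaleAr.
Qed.
Next Obligation.
move=> f g a /=; rewrite -trs_mulr; congr trs.
rewrite /kip cmul_suml; apply: eq_bigr => u _.
by rewrite /= cmulA.
Qed.
Next Obligation. by move=> f; apply: trs_pos; exact: kip_pos. Qed.

Local Notation V := kpremod.

Lemma kfunD s x y : kfun s (x + y) = kfun s x + kfun s y.
Proof.
rewrite /kfun -big_split; apply: eq_bigr => u _ /=.
by rewrite cstarD cmulDl cpD cmulDl.
Qed.

Lemma kfunZ s (a : C) x : kfun s (a *: x) = (a^*)%R *: kfun s x.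
Proof.
rewrite /kfun scaler_sumr; apply: eq_bigr => u _ /=.
by rewrite cstarZ -cscaleAl cpZ -cscaleAl.
Qed.

Lemma kshift_proof (z : O) f : (fun x => val f (cstar z *c x)) \in kpred.
Proof.
apply/kpredP; exists [seq (z *c u.1, u.2) | u <- krep f].
apply/funext => x; rewrite krepE /kfun big_map; apply: eq_bigr => u _ /=.
by rewrite cstarM cstarK !cmulA.
Qed.

(** Left multiplication by [z] on the first tensor factor, that is, the GNS representation. *)
Definition kshift z f : kmod := @exist (O -> PA) (fun u : O -> PA => u \in kpred) _ (kshift_proof z f).

Lemma kshift_adj z f g : kip (kshift (cstar z) f) g = kip f (kshift z g).
Proof.
have fE : val (kshift (cstar z) f) = kfun [seq (cstar z *c u.1, u.2) | u <- krep f].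
  apply/funext => x /=; rewrite krepE /kfun big_map; apply: eq_bigr => u _ /=.
  by rewrite cstarK cstarM !cmulA.
by rewrite (kipE g fE) big_map.
Qed.

Lemma kshift_lin z : linear (kshift z).
Proof. by move=> a f g; apply: kmod_eq. Qed.

Lemma kshiftM z z' f : kshift (z *c z') f = kshift z (kshift z' f).
Proof. by apply: kmod_eq => x /=; rewrite cstarM cmulA. Qed.

Lemma kshift_add (a : C) z z' f : kshift (a *: z + z') f = a *: kshift z f + kshift z' f.
Proof.
apply: kmod_eq => x.
transitivity (a *: val f (cstar z *c x) + val f (cstar z' *c x)); last by [].
transitivity (val f (cstar (a *: z + z') *c x)); first by [].
by rewrite cstarD cstarZ cmulDl krepE kfunD -cscaleAl kfunZ conjCK.
Qed.

Lemma kshift1 f : kshift cone f = f.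
Proof. by apply: kmod_eq => x /=; rewrite cstar1 cmul1x. Qed.

(** [nrm z ^ 2 - z^* z] is a square [h^2] with [h] self-adjoint, and [<f, h^2 f> = <h f, h f>] is
    positive. *)
Lemma kshift_bnd z (f : V) : vn (kshift z f : V) <= nrm z * vn f.
Proof.
rewrite -(@ler_sqr _ (vn _)) ?nnegrE ?mulr_ge0 ?vn_ge0 ?nrm_ge0// exprMn !vn_sqr.
have zs : cstar (cstar z *c z) = cstar z *c z by rewrite cstarM cstarK.
have [h hs hE] := pos_nrmB zs.
have e1 : pip (kshift z f : V) (kshift z f) = pip f (kshift (cstar z *c z) f : V).
  by rewrite /= -{1}[z]cstarK kshift_adj kshiftM.
have e2 : pip f (kshift (h *c h) f : V) =
    (nrm z ^+ 2)%:C *: pip f f - pip (kshift z f : V) (kshift z f).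
  rewrite e1 -hE -nrm_cstar addrC -scaleN1r kshift_add.
  have -> : kshift ((nrm (cstar z *c z))%:C *: cone) f = (nrm (cstar z *c z))%:C *: f.
    rewrite -[_ *: cone]addr0 kshift_add kshift1 -[RHS]addr0; congr (_ + _).
    apply: kmod_eq => x /=; rewrite cstar0 cmul0x krepE -(scale0r (0 : O)) kfunZ.
    by rewrite conjC0 scale0r.
  by rewrite (pipDr (V := V)) !(pipZr (V := V)) scaleN1r addrC.
have p2 : pos (pip f (kshift (h *c h) f : V)).
  rewrite kshiftM /= -kshift_adj hs; exact: (pip_pos (p := V)).
have := pos_mono_nrm (pip_pos (kshift z f : V)).
move=> /(_ ((nrm z ^+ 2)%:C *: pip f f)); rewrite -e2 => /(_ p2).
by rewrite nrmZr ger0_norm// exprn_ge0// nrm_ge0.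
Qed.

Program Definition kpi (z : O) : bops V := @Bop R A V (kshift z) (kshift (cstar z)) _ _ _ _.
Next Obligation. by move=> z; exact: kshift_lin. Qed.
Next Obligation. by move=> z; exact: kshift_lin. Qed.
Next Obligation. by move=> z f g; rewrite /= kshift_adj. Qed.
Next Obligation. by move=> z; exists (nrm z); [exact: nrm_ge0|exact: kshift_bnd]. Qed.

Lemma kpi_lin (a : C) z z' : kpi (a *: z + z') = a *: kpi z + kpi z'.
Proof.
by apply: bop_eq => f /=; rewrite ?cstarD ?cstarZ kshift_add.
Qed.

Lemma kpiM z z' : kpi (z *c z') = pmul (kpi z) (kpi z').
Proof. by apply: bop_eq => f /=; rewrite ?cstarM kshiftM. Qed.

Lemma kpiS z : kpi (cstar z) = pstar (kpi z).
Proof. by apply: bop_eq => f /=; rewrite ?cstarK. Qed.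

Lemma kpi1 : kpi cone = pone _.
Proof. by apply: bop_eq => f /=; rewrite ?cstar1 kshift1. Qed.

Definition kvec p : V := kin [:: (cone, tens t p cone)].

Lemma kvecE p x : val (kvec p) x = psi (cstar x) *c tens t p cone.
Proof. by rewrite /= /kfun big_seq1 /= cmulx1. Qed.

Lemma pip_kvec p f : pip (kvec p) f = trs t (tens t (cstar p) cone *c val f cone).
Proof.
rewrite /= (@kipE (kvec p) f [:: (cone, tens t p cone)])// big_seq1 /=.
by rewrite tens_star cstar1.
Qed.

Lemma pip_kvec_kpi p q x :
  pip (kvec p) (kpi x (kvec q)) = trs t (tens t (cstar p) cone *c psi x *c tens t q cone).
Proof.
rewrite pip_kvec -cmulA; congr (trs t (_ *c _)).
by rewrite -[LHS]/(val (kvec q) (cstar x *c cone)) kvecE cmulx1 cstarK.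
Qed.

Lemma pip_kvec2 p q : pip (kvec p) (kvec q) = rtr (cstar p *c q) *: cone.
Proof.
have := pip_kvec_kpi p q cone; rewrite kpi1 /= => ->.
by rewrite (cp_one cp) cmulx1 tensM cmulx1 trs_tens.
Qed.

Lemma kvec_lin (a : C) p q : kvec (a *: p + q) = a *: kvec p + kvec q.
Proof.
apply: kmod_eq => x; rewrite kvecE tensDl cmulDr -cscaleAr.
by rewrite [RHS]/(a *: val (kvec p) x + val (kvec q) x) !kvecE.
Qed.

End Kernel.

(** * Dilation *)

Section IdTensor.
Context {R : realType} {P : finCstarType R} {X PX A PA : ucstarType R}.
Variables (tX : tensor P X PX) (tA : tensor P A PA).
Local Notation C := R[i].

Definition idt (f : X -> A) (z : PX) : PA := \sum_i tens tA (pbase i) (f (tcoord tX z i)).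

Variable f : X -> A.
Hypothesis f_lin : forall (a : C) x y, f (a *: x + y) = a *: f x + f y.

Lemma idtf0 : f 0 = 0.
Proof. by have := f_lin (-1) 0 0; rewrite scaler0 addr0 scaleN1r addNr. Qed.

Lemma idtfZ a x : f (a *: x) = a *: f x.
Proof. by rewrite -[a *: x]addr0 f_lin idtf0 addr0. Qed.

Lemma idt_lin (a : C) u v : idt f (a *: u + v) = a *: idt f u + idt f v.
Proof.
rewrite /idt scaler_sumr -big_split; apply: eq_bigr => i _ /=.
by rewrite tcoord_lin f_lin tensDr.
Qed.

Lemma idtD u v : idt f (u + v) = idt f u + idt f v.
Proof. by rewrite -[u]scale1r idt_lin !scale1r. Qed.

Lemma idt0 : idt f 0 = 0.
Proof. by have := idt_lin (-1) 0 0; rewrite scaler0 addr0 scaleN1r addNr. Qed.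

Lemma idtZ (a : C) u : idt f (a *: u) = a *: idt f u.
Proof. by rewrite -[a *: u]addr0 idt_lin idt0 addr0. Qed.

Lemma idtB u v : idt f (u - v) = idt f u - idt f v.
Proof. by rewrite idtD -scaleN1r idtZ scaleN1r. Qed.

Lemma idt_sum (I : Type) (r : seq I) (Q : pred I) (F : I -> PX) :
  idt f (\sum_(i <- r | Q i) F i) = \sum_(i <- r | Q i) idt f (F i).
Proof. by apply: (big_morph (idt f)); [exact: idtD|exact: idt0]. Qed.

Lemma idt_tens p x : idt f (tens tX p x) = tens tA p (f x).
Proof.
rewrite /idt [p in RHS]pcoordE tens_suml; apply: eq_bigr => i _.
by rewrite tcoord_tens idtfZ tensZl tensZr.
Qed.

Lemma tcoord_idt z i : tcoord tA (idt f z) i = f (tcoord tX z i).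
Proof. by rewrite /idt (tensK tA (fun i => f (tcoord tX z i))). Qed.

End IdTensor.

Section Householder.
Context {R : realType} {P : finCstarType R} {O A PA : ucstarType R}.
Variables (t : tensor P A PA) (psi : O -> PA).
Hypothesis P1 : (cone : P) != 0.
Hypothesis cp : cpmap psi.
Local Notation C := R[i].
Local Notation d := (pdim P).
Variable b : 'I_d -> P.
Hypothesis b_orth : forall k l, rtr (cstar (b k) *c b l) = (k == l)%:R.
Hypothesis b_span : forall p, p = \sum_k rtr (cstar (b k) *c p) *: b k.
Hypothesis b_casimir : \sum_k b k *c cstar (b k) = cone.

Local Notation V := (kpremod t cp).
Local Notation X := (completed (bops V)).
Variables (PX : ucstarType R) (tX : tensor P X PX).

(* [c^2 = 1 / d] makes [xig] below a unit vector, and [c < 0] makes [1 - c] invertible. *)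
Let c : R := - (Num.sqrt d%:R)^-1.
Let kap : R := (1 - c)^-1.

Lemma pdim_gt0 : (0 < d)%N.
Proof.
case: (posnP d) => // d0; move/eqP: P1; case.
rewrite (pcoordE (cone : P)) big1//.
case=> i id; have : (i < 0)%N by rewrite -d0.
by [].
Qed.

Let c_lt0 : c < 0.
Proof. by rewrite oppr_lt0 invr_gt0 sqrtr_gt0 ltr0n pdim_gt0. Qed.

Let c2 : c ^+ 2 * d%:R = 1.
Proof.
rewrite sqrrN exprVn sqr_sqrtr ?ler0n// mulVf// pnatr_eq0 -lt0n; exact: pdim_gt0.
Qed.

Let kapN : kap * (c - 1) = -1.
Proof.
rewrite -opprB mulrN mulVf// gt_eqF// subr_gt0; exact: lt_trans c_lt0 ltr01.
Qed.

(** The [gam k] are the coordinates of [g] in the basis [b], and the [bet k] are those of the vector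
    [D = sum_k b_k^* (x) xi_k - 1 (x) xig] along which [s] reflects. In these terms [sum_gam_bet]
    computes [<1 (x) xig, D>] and [sum_bet2] computes [<D, D>]. *)
Let g : P := c%:C *: cone.
Let gam k : C := rtr (cstar (b k) *c g).
Let bet k : P := cstar (b k) - gam k *: cone.
Let xi k : V := kvec t cp (b k).
Let xig : V := kvec t cp g.

Let gs : cstar g = g.
Proof. by rewrite cstarZr cstar1. Qed.

Let gam_conj k : ((gam k)^*)%R = rtr (g *c b k).
Proof. by rewrite -rtr_star cstarM cstarK gs. Qed.

Let sum_gam : \sum_k gam k *: b k = g.
Proof. by rewrite [RHS]b_span. Qed.

Let sum_gamC : \sum_k ((gam k)^*)%R *: cstar (b k) = g.
Proof.
rewrite -[RHS]gs -[in RHS]sum_gam cstar_sum.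
by apply: eq_bigr => k _; rewrite cstarZ.
Qed.

Let sum_gam2 : \sum_k ((gam k)^*)%R * gam k = 1.
Proof.
transitivity (rtr (g *c g)).
  rewrite -{2}sum_gam cmul_sumr rtr_sum; apply: eq_bigr => k _.
  by rewrite -cscaleAr rtrZ gam_conj mulrC.
rewrite -cscaleAl cmul1x rtrZ rtrZ rtr1 mulrA -rmorphM -(rmorph_nat (real_complex R)).
by rewrite -rmorphM -expr2 c2.
Qed.

Let sum_gam_bet : \sum_k ((gam k)^*)%R *: bet k = (c - 1)%:C *: cone.
Proof.
under eq_bigr do rewrite scalerBr scalerA.
by rewrite sumrB sum_gamC -scaler_suml sum_gam2 rmorphB scalerBl.
Qed.

Let betS k : cstar (bet k) = b k - ((gam k)^*)%R *: cone.
Proof. by rewrite cstarB cstarK cstarZ cstar1. Qed.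

Let sum_bet2 : \sum_k cstar (bet k) *c bet k = (2 * (1 - c))%:C *: cone.
Proof.
transitivity (\sum_k (b k *c cstar (b k) - gam k *: b k -
   (((gam k)^*)%R *: cstar (b k) - (((gam k)^*)%R * gam k) *: cone))).
  apply: eq_bigr => k _; rewrite betS cmulBl !cmulBr -!cscaleAl -!cscaleAr.
  by rewrite cmul1x cmulx1 cmul1x scalerA.
have -> : 2 * (1 - c) = 2 - 2 * c :> R by ring.
rewrite !sumrB b_casimir sum_gam sum_gamC -scaler_suml sum_gam2 scale1r.
rewrite /g opprB addrACA -opprD addxx (addxx (c%:C *: cone)) scalerA -rmorphM.
by rewrite -scalerBl -rmorphB.
Qed.

Let Theta i j : X := emb (bop_rank1 (xi i) (xi j) : bops V).

Let pip_xi i j : pip (xi i) (xi j) = ((i == j)%:R : C) *: cone.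
Proof. by rewrite pip_kvec2 b_orth. Qed.

Let ThetaM i j k l : Theta i j *c Theta k l = ((j == k)%:R : C) *: Theta i l.
Proof.
rewrite /Theta -embM -embZ; congr emb.
by apply: bop_rank1M; exact: pip_xi.
Qed.

Let ThetaS i j : cstar (Theta i j) = Theta j i.
Proof. by rewrite /Theta -embS; congr emb; exact: bop_eq. Qed.

(** [Q] is the rank-one operator [|D><D|], and [s = 1 - 2 |D><D| / <D, D>]: the factor
    [kap = 1 / (1 - c)] is 2 over the scalar value [2 (1 - c)] of [<D, D>]. *)
Let Q : PX := \sum_i \sum_j tens tX (bet i *c cstar (bet j)) (Theta i j).
Let s : PX := cone - kap%:C *: Q.

Let QS : cstar Q = Q.
Proof.
rewrite /Q cstar_sum exchange_big; apply: eq_bigr => i _; rewrite cstar_sum.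
apply: eq_bigr => j _.
by rewrite tens_star ThetaS cstarM cstarK.
Qed.

Let sS : cstar s = s.
Proof. by rewrite cstarB cstar1 cstarZr QS. Qed.

Let QQ : Q *c Q = (2 * (1 - c))%:C *: Q.
Proof.
transitivity (\sum_i \sum_j \sum_l
    tens tX (bet i *c (cstar (bet j) *c bet j) *c cstar (bet l)) (Theta i l)).
  rewrite /Q cmul_suml; apply: eq_bigr => i _; rewrite cmul_suml; apply: eq_bigr => j _.
  rewrite cmul_sumr (bigD1 j)//= [X in _ + X]big1 => [|k kj]; rewrite cmul_sumr.
    rewrite addr0; apply: eq_bigr => l _.
    by rewrite tensM ThetaM eqxx scale1r !cmulA.
  rewrite big1// => l _.
  by rewrite tensM ThetaM eq_sym (negPf kj) scale0r tens0r.
rewrite /Q scaler_sumr; apply: eq_bigr => i _; rewrite exchange_big scaler_sumr.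
apply: eq_bigr => l _ /=.
rewrite -tens_suml -cmul_suml -cmul_sumr sum_bet2.
by rewrite -cscaleAr cmulx1 -cscaleAl tensZl.
Qed.

Let ss : s *c s = cone.
Proof.
rewrite /s cmulBl !cmulBr cmul1x cmulx1 cmul1x -cscaleAl -cscaleAr QQ !scalerA.
have -> : kap%:C * kap%:C * (2 * (1 - c))%:C = (2 * kap)%:C :> C.
  have -> : 2 * kap = kap * kap * (2 * (1 - c)); last by rewrite !rmorphM.
  have -> : kap * kap * (2 * (1 - c)) = - (2 * kap * (kap * (c - 1))) by ring.
  by rewrite kapN mulrN1 opprK.
by rewrite rmorphM -scalerA -addxx opprB addrK subrK.
Qed.

Lemma idt_vfun_star x y z : idt tX t (vfun x y) (cstar z) = cstar (idt tX t (vfun y x) z).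
Proof.
elim/(@tens_ind _ _ _ _ tX): z => [p T|u v hu hv].
  rewrite (tens_star tX) (idt_tens tX t (vfun_lin x y)) (idt_tens tX t (vfun_lin y x)).
  by rewrite (tens_star t) -vfun_star.
rewrite [cstar (u + v)]cstarD (idtD tX t (vfun_lin x y)) (idtD tX t (vfun_lin y x)).
by rewrite hu hv cstarD.
Qed.

Let xigE : xig = \sum_k gam k *: xi k.
Proof.
rewrite /xig -sum_gam.
have kvec0 : kvec t cp 0 = 0.
  by have := kvec_lin t cp (-1) 0 0; rewrite scaler0 addr0 scaleN1r addNr.
apply: (big_ind2 (fun p (x : V) => kvec t cp p = x)) => // [p x q y <- <-|k _].
  by rewrite -[p]scale1r kvec_lin !scale1r.
by rewrite -[_ *: b k]addr0 kvec_lin kvec0 addr0.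
Qed.

Let vfun_xig y T : vfun xig y T = \sum_k ((gam k)^*)%R *: vfun (xi k) y T.
Proof.
rewrite xigE.
have v0 : vfun (0 : V) y T = 0.
  by have := vfun_linl (-1) (0 : V) 0 y T; rewrite scaler0 addr0 rmorphN1 scaleN1r addNr.
apply: (big_ind2 (fun x a => vfun x y T = a)) => // [p x q z <- <-|k _].
  by rewrite -[p]scale1r vfun_linl rmorph1 !scale1r.
by rewrite -[_ *: xi k]addr0 vfun_linl v0 addr0.
Qed.

(* [s] maps [1 (x) xig] to [sum_j b_j^* (x) xi_j]. *)
Let idt_s y z : idt tX t (vfun xig y) (s *c z) =
  \sum_j tens t (b j) cone *c idt tX t (vfun (xi j) y) z.
Proof.
elim/(@tens_ind _ _ _ _ tX): z => [p T|u v hu hv]; last first.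
  rewrite cmulDr idtD ?hu ?hv -?big_split; last exact: vfun_lin.
  apply: eq_bigr => j _ /=; rewrite idtD ?cmulDr//; exact: vfun_lin.
rewrite cmulBl cmul1x idtB ?idt_tens; try exact: vfun_lin.
rewrite -cscaleAl idtZ; last exact: vfun_lin.
have -> : idt tX t (vfun xig y) (Q *c tens tX p T) =
    (c - 1)%:C *: \sum_j tens t (cstar (bet j) *c p) (vfun (xi j) y T).
  rewrite /Q cmul_suml idt_sum; last exact: vfun_lin.
  transitivity (\sum_i \sum_j tens t (((gam i)^*)%R *: bet i *c (cstar (bet j) *c p))
       (vfun (xi j) y T)).
    apply: eq_bigr => i _; rewrite cmul_suml idt_sum; last exact: vfun_lin.
    apply: eq_bigr => j _; rewrite tensM idt_tens; last exact: vfun_lin.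
    rewrite /Theta vfun_rank1l pip_kvec2 gs -gam_conj -!cscaleAl cmul1x.
    by rewrite tensZr tensZl cmulA.
  rewrite exchange_big scaler_sumr; apply: eq_bigr => j _ /=.
  by rewrite -tens_suml -cmul_suml sum_gam_bet -cscaleAl cmul1x tensZl.
rewrite scalerA -rmorphM kapN rmorphN1 scaleN1r opprK vfun_xig tens_sumr -big_split.
apply: eq_bigr => j _ /=; rewrite idt_tens; last exact: vfun_lin.
rewrite tensM cmul1x betS cmulBl -cscaleAl cmul1x -[_ - _]addrC tens_addl.
by rewrite -scaleNr tensZl tensZr scaleNr addrA addrN add0r.
Qed.

Let idt_s_r x z : idt tX t (vfun x xig) (z *c s) =
  \sum_j idt tX t (vfun x (xi j)) z *c tens t (cstar (b j)) cone.
Proof.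
rewrite -[z *c s]cstarK idt_vfun_star cstarM sS idt_s cstar_sum.
apply: eq_bigr => j _; rewrite cstarM tens_star cstar1.
by rewrite -idt_vfun_star cstarK.
Qed.

Lemma pip_xig : pip xig xig = cone.
Proof.
rewrite pip_kvec2 gs -cscaleAl cmul1x rtrZ rtrZ rtr1.
rewrite mulrA -rmorphM -(rmorph_nat (real_complex R)).
by rewrite -rmorphM -expr2 c2 rmorph1 scale1r.
Qed.

Definition dilation (x : O) : PX := s *c tens tX cone (emb (kpi t cp x)) *c s.

Lemma dilation_starhom : is_unital_starhom dilation.
Proof.
split.
- move=> a x y.
  have D (r u v : PX) : r *c (a *: u + v) *c r = a *: (r *c u *c r) + r *c v *c r.
    by rewrite cmulDr cmulDl -cscaleAr -cscaleAl.
  by rewrite /dilation kpi_lin emb_lin tensDr D.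
- move=> x y; rewrite /dilation kpiM embM.
  rewrite -[X in tens tX X _](cmul1x (cone : P)) -tensM.
  rewrite -!cmulA; congr (_ *c (_ *c _)).
  by rewrite [in RHS]cmulA ss cmul1x.
- move=> x.
  have D (r u : PX) : cstar (r *c u *c r) = cstar r *c cstar u *c cstar r.
    by rewrite !cstarM cmulA.
  by rewrite /dilation kpiS embS D sS (tens_star tX) cstar1.
- by rewrite /dilation kpi1 emb1 tens11 cmulx1 ss.
Qed.

(** Moving [s] out on both sides leaves the sum over [j] and [k] of
    [b_j b_k^* (x) trs (b_j^* psi(x) b_k)]. For [psi x = p (x) a] the sum over [j] rebuilds [p b_k],
    and the sum over [k] is absorbed by the Casimir identity. *)
Lemma dilation_compress x : idt tX t (vfun xig xig) (dilation x) = psi x.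
Proof.
rewrite /dilation -cmulA idt_s.
under eq_bigr do rewrite idt_s_r.
transitivity (\sum_j \sum_k tens t (b j *c cstar (b k))
  (trs t (tens t (cstar (b j)) cone *c psi x *c tens t (b k) cone))).
  apply: eq_bigr => j _; rewrite cmul_sumr; apply: eq_bigr => k _.
  rewrite idt_tens; last exact: vfun_lin.
  by rewrite vfun_emb pip_kvec_kpi !tensM !cmul1x !cmulx1.
elim/(@tens_ind _ _ _ _ t): (psi x) => [p a|u v hu hv]; last first.
  rewrite -[in RHS]hu -[in RHS]hv -big_split; apply: eq_bigr => j _ /=.
  rewrite -big_split; apply: eq_bigr => k _ /=.
  by rewrite cmulDr cmulDl trsD tens_addr.
rewrite exchange_big /=.
transitivity (\sum_k tens t (p *c b k *c cstar (b k)) a).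
  apply: eq_bigr => k _; rewrite [p *c b k]b_span cmul_suml tens_suml.
  apply: eq_bigr => j _.
  by rewrite !tensM trs_tens cmul1x cmulx1 -cscaleAl tensZr tensZl cmulA.
rewrite -tens_suml; congr tens.
under eq_bigr do rewrite -cmulA.
by rewrite -cmul_sumr b_casimir cmulx1.
Qed.

Definition compression (T : X) : A := vfun xig xig T.

End Householder.

Theorem dilation_exists {R : realType} {P : finCstarType R} {O A PA : ucstarType R}
    (t : tensor P A PA) (psi : O -> PA) : (cone : P) != 0 -> cpmap psi ->
  exists (X PX : ucstarType R) (tX : tensor P X PX) (Psi : O -> PX) (E : X -> A),
  [/\ is_unital_starhom Psi,
      forall (a : R[i]) x y, E (a *: x + y) = a *: E x + E y,
      E cone = cone /\ forall x, E (cstar x) = cstar (E x),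
      (forall x, nrm (E x) <= nrm x) /\ forall (k : nat) (Y : 'I_k -> X) (a : 'I_k -> A),
        pos (\sum_i \sum_j cstar (a i) *c E (cstar (Y i) *c Y j) *c a j)
    & forall x i, E (tcoord tX (Psi x) i) = tcoord t (psi x) i].
Proof.
move=> P1 cp; have [b [b_orth b_span b_cas]] := rtr_onb P.
have [PX [tX]] := tensor_exists P (completed (bops (kpremod t cp))).
exists (completed (bops (kpremod t cp))), PX, tX, (dilation b tX), (@compression _ _ _ _ _ t psi cp).
have E1 := pip_xig t P1 cp.
split.
- exact: dilation_starhom.
- exact: vfun_lin.
- by split=> [|x]; rewrite /compression; [rewrite -emb1 vfun_emb|exact: vfun_star].
- split=> [x|k Y a]; last exact: vfun_cp.
  apply: (le_trans (vfun_nrm _ _ _)); rewrite ler_piMr ?nrm_ge0//.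
  by rewrite -expr2 vn_sqr E1 nrm1_le1.
- by move=> x i; rewrite -(tcoord_idt tX t) [idt _ _ _ _]dilation_compress.
Qed.

(** * The universal property for unital targets *)

Section Morphisms.
Context {R : realType}.

Lemma multiplier_eq (B : cstarType R) (m n : multiplier B) :
  mulL m =1 mulL n -> mulR m =1 mulR n -> m = n.
Proof.
case: m n => f g fg [f' g' fg'] /= /funext ff /funext gg; subst f' g'.
by congr Multiplier; exact: Prop_irrelevance.
Qed.

(** [nrm x ^ 2 - x^* x] is a square and is sent to a square, so [f(x)^* f(x) <= nrm x ^ 2]. *)
Lemma starhom_nrm (A B : ucstarType R) (f : A -> B) x :
  is_unital_starhom f -> nrm (f x) <= nrm x.
Proof.
move=> [fl fM fS f1].
have fD u v : f (u + v) = f u + f v.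
  by have := fl 1 u v; rewrite !scale1r.
have fZ (a : R[i]) (u : A) : f (a *: u) = a *: f u.
  have f0 : f 0 = 0 by have := fl (-1) 0 0; rewrite scaler0 addr0 scaleN1r addNr.
  by rewrite -[a *: u]addr0 fl f0 addr0.
have fN u : f (- u) = - f u by rewrite -scaleN1r fZ scaleN1r.
have xs : cstar (cstar x *c x) = cstar x *c x by rewrite cstarM cstarK.
have [h hs hE] := pos_nrmB xs.
have p : pos ((nrm x ^+ 2)%:C *: (cone : B) - cstar (f x) *c f x).
  exists (f h); first by rewrite -fS hs.
  rewrite -fM -hE nrm_cstar fD fZ f1 fN.
  by rewrite fM fS.
rewrite -(@ler_sqr _ (nrm _)) ?nnegrE ?nrm_ge0// -nrm_cstar.
by apply: pos_nrm_le p; [exact: sqr_ge0|exact: pos_cstar].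
Qed.

Section OfStarhom.
Context {A B : ucstarType R} (f : A -> B).
Hypothesis f_hom : is_unital_starhom f.

Fact mor_of_subproof x y z : y *c (f x *c z) = (y *c f x) *c z.
Proof. by rewrite cmulA. Qed.

Definition mor_of (x : A) : multiplier B := Multiplier (mor_of_subproof x).

Lemma mor_of_mor : is_mor mor_of.
Proof.
have [fl fM fS f1] := f_hom; split.
- move=> a x y; apply: multiplier_eq => z /=.
    by rewrite fl cmulDl -cscaleAl.
  by rewrite fl cmulDr -cscaleAr.
- move=> x y; apply: multiplier_eq => z /=; rewrite fM cmulA//.
- move=> x; apply: multiplier_eq => z /=; rewrite fS cstarM cstarK//.
- move=> U [x Ux] _; exists x; split=> //; apply: sub_lspan.
  by exists cone, x; rewrite /= f1 cmul1x.
Qed.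

End OfStarhom.

Section ToStarhom.
Context {A B : ucstarType R} (L : A -> multiplier B).
Hypothesis L_mor : is_mor L.

Definition hom_of (x : A) : B := mulL (L x) cone.

Lemma hom_ofR x : mulR (L x) cone = hom_of x.
Proof. by have := mulLR (L x) cone cone; rewrite cmul1x cmulx1. Qed.

Lemma mulL_hom x y : mulL (L x) y = hom_of x *c y.
Proof. by rewrite -hom_ofR -mulLR cmul1x. Qed.

(** Unitality is extracted from non-degeneracy: some [z] in the span of the range is at distance
    less than 1/2 from the unit. For [e = 1 - hom_of 1] one has [e z = 0], so [e = e (1 - z)] and
    [e = 0]. *)
Lemma hom_of_starhom : is_unital_starhom hom_of.
Proof.
have [Ll LM LS Ld] := L_mor.
have hM : {morph hom_of : x y / x *c y}.
  by move=> x y; rewrite /hom_of LM /= mulL_hom.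
have hl : linear hom_of by move=> a x y; rewrite /hom_of Ll.
split=> //; first by move=> x; rewrite /hom_of LS /= cstar1 hom_ofR.
have [|z [Bz [n [c [v [vP zE]]]]]] := Ld (ball (cone : B) (2^-1 : R)%:C) _ (ball_open _ _).
  by exists cone; apply: ballxx; rewrite ltcR invr_gt0.
have ez : hom_of cone *c z = z.
  rewrite zE cmul_sumr; apply: eq_bigr => i _; rewrite -cscaleAr; congr (_ *: _).
  have [x [y ->]] := vP i.
  by rewrite mulL_hom cmulA -hM cmul1x.
move: Bz; rewrite -ball_normE /= nrmE ltcR => Bz.
apply/eqP; rewrite eq_sym -subr_eq0; apply/eqP/nrm_eq0.
set e := _ - _; have ee : e = e *c (cone - z).
  by rewrite cmulBr cmulx1 /e cmulBl cmul1x ez subrr subr0.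
have := nrmM e (cone - z); rewrite -ee; have := nrm_ge0 e.
by move: Bz; nra.
Qed.

End ToStarhom.

End Morphisms.

Section Core.
Context {R : realType} {P : finCstarType R} {O M PM : ucstarType R}.
Variables (tM : tensor P M PM) (Phi : O -> PM).
Hypothesis P1 : (cone : P) != 0.
Hypothesis Phi_univ : all_maps_universal tM Phi.

(** Evaluating the multipliers at [cone] turns the factorisation into an identity between
    coordinates. *)
Lemma universal_unital (X PX : ucstarType R) (tX : tensor P X PX) (Psi : O -> PX) :
  is_unital_starhom Psi -> exists L : M -> X, is_unital_starhom L /\
    forall x i, tcoord tX (Psi x) i = L (tcoord tM (Phi x) i).
Proof.
move=> Psi_hom; have [L [[Lmor LE] _]] := Phi_univ tX (mor_of_mor Psi_hom).
exists (hom_of L); split; first exact: hom_of_starhom.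
move=> x i; have := congr1 (fun f : O -> multiplier PX => mulL (f x) cone) LE.
rewrite /= cmulx1 => ->.
have -> : \sum_i \sum_j tens tX (pbase i *c pbase j)
      (mulL (L (tcoord tM (Phi x) i)) (tcoord tX cone j)) =
    \sum_i tens tX (pbase i) (hom_of L (tcoord tM (Phi x) i)).
  apply: eq_bigr => k _; rewrite -[RHS]cmulx1 -[X in _ *c X](tcoordK tX) cmul_sumr.
  by apply: eq_bigr => j _; rewrite mulL_hom tensM.
by rewrite (tensK tX (fun i => hom_of L (tcoord tM (Phi x) i))).
Qed.

Theorem ucp_extension (A PA : ucstarType R) (t : tensor P A PA) (psi : O -> PA) :
  cpmap psi -> exists lam : M -> A,
  [/\ forall (a : R[i]) x y, lam (a *: x + y) = a *: lam x + lam y,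
      lam cone = cone /\ forall x, lam (cstar x) = cstar (lam x),
      forall x, nrm (lam x) <= nrm x,
      forall (k : nat) (Y : 'I_k -> M) (a : 'I_k -> A),
        pos (\sum_i \sum_j cstar (a i) *c lam (cstar (Y i) *c Y j) *c a j)
    & forall x i, lam (tcoord tM (Phi x) i) = tcoord t (psi x) i].
Proof.
move=> cp; have [X [PX [tX [Psi [E [Psi_hom El [E1 ES] [En Ecp] EPsi]]]]]] :=
  dilation_exists t P1 cp.
have [L [Lhom LE]] := universal_unital tX Psi_hom; have [Ll LM LS L1] := Lhom.
exists (E \o L); split=> /=.
- by move=> a x y; rewrite Ll El.
- by rewrite L1; split=> // x; rewrite LS ES.
- by move=> x; apply: le_trans (En _) _; exact: starhom_nrm.
- move=> k Y a; have := Ecp k (L \o Y) a; congr pos.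
  apply: eq_bigr => i _; apply: eq_bigr => j _.
  by rewrite /= LM LS.
- by move=> x i; rewrite -LE EPsi.
Qed.

End Core.

(** * The span of the slices is closed *)

Section SliceBound.
Context {R : realType} {P : finCstarType R} {A T : ucstarType R}.
Variable t : tensor P A T.

Program Definition trs_premod : premod A :=
  @PreMod R A T (fun z a => z *c tens t cone a) (fun u v => trs t (cstar u *c v)) _ _ _ _ _.
Next Obligation. by move=> x a y z /=; rewrite cmulDr -cscaleAr trs_lin. Qed.
Next Obligation. by move=> x y /=; rewrite -trs_star cstarM cstarK. Qed.
Next Obligation. by move=> x c a b /=; rewrite tensDr cmulDr -cscaleAr. Qed.
Next Obligation. by move=> x y a /=; rewrite cmulA trs_mulr. Qed.
Next Obligation. by move=> x /=; apply: trs_pos; exact: pos_cstar. Qed.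

(** Cauchy-Schwarz for [<1, z>] in the module [T] with inner product [trs (u^* v)], whose length is
    controlled by the norm of [T] because [trs] preserves positivity. *)
Lemma trs_bnd : exists2 c : R, 0 <= c & forall z : T, nrm (trs t z) <= c * nrm z.
Proof.
pose K := nrm (trs t cone); have K0 : 0 <= K by exact: nrm_ge0.
have vb (z : trs_premod) : vn z <= Num.sqrt K * nrm (z : T).
  rewrite -(@ler_sqr _ (vn _)) ?nnegrE ?mulr_ge0 ?vn_ge0 ?sqrtr_ge0 ?nrm_ge0//.
  rewrite exprMn (sqr_sqrtr K0) [leLHS]vn_sqr /pip /=.
  have zs : cstar (cstar (z : T) *c (z : T)) = cstar (z : T) *c (z : T).
    by rewrite cstarM cstarK.
  have := trs_pos t (pos_nrmB zs).
  rewrite -[_ - _]/(_ + - _) -[- (_ *c _)]scaleN1r addrC trs_lin trsZ scaleN1r addrC.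
  move=> h; apply: (le_trans (pos_mono_nrm (trs_pos t (pos_cstar (z : T))) h)).
  by rewrite nrmZr ger0_norm ?nrm_ge0// nrm_cstar mulrC.
exists (vn (cone : trs_premod) * Num.sqrt K).
  by rewrite mulr_ge0 ?vn_ge0 ?sqrtr_ge0.
move=> z; have := pip_cs (cone : trs_premod) (z : trs_premod).
rewrite {1}/pip /= cstar1 cmul1x => /le_trans; apply.
by rewrite -mulrA ler_wpM2l ?vn_ge0.
Qed.

(** Each coordinate is a combination of the traces [trs ((b_k^* (x) 1) z)]. *)
Lemma tcoord_bnd i : exists2 c : R, 0 <= c & forall z : T, nrm (tcoord t z i) <= c * nrm z.
Proof.
have [b [_ b_span _]] := rtr_onb P; have [c c0 H] := trs_bnd.
pose a k := cabs (pcoord i (b k) : R[i]) * (c * nrm (tens t (cstar (b k)) cone)).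
exists (\sum_k a k).
  by apply: sumr_ge0 => k _; rewrite mulr_ge0 ?cabs_ge0// mulr_ge0 ?nrm_ge0.
move=> z; have -> : tcoord t z i =
    \sum_k (pcoord i (b k) : R[i]) *: trs t (tens t (cstar (b k)) cone *c z).
  elim/(@tens_ind _ _ _ _ t): z => [p x|u v hu hv]; last first.
    rewrite -[u]scale1r tcoord_lin scale1r hu hv scale1r -big_split.
    by apply: eq_bigr => k _ /=; rewrite cmulDr trsD scalerDr.
  rewrite tcoord_tens [p in LHS]b_span linear_sum scaler_suml.
  apply: eq_bigr => k _; rewrite linearZ /= tensM trs_tens cmul1x scalerA.
  by rewrite mulrC.
rewrite (le_trans (nrm_sum _ _ _))// mulr_suml ler_sum// => k _.
rewrite nrmZ -mulrA ler_wpM2l ?cabs_ge0// (le_trans (H _))//.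
by rewrite -mulrA ler_wpM2l// nrmM.
Qed.

End SliceBound.

Section MixedMap.
Context {R : realType} {P : finCstarType R} {O PO : ucstarType R}.
Variables (t : tensor P O PO) (s : O -> R[i]).
Hypothesis s_lin : forall (a : R[i]) x y, s (a *: x + y) = a * s x + s y.
Hypothesis s1 : s cone = 1.
Hypothesis s_star : forall x, s (cstar x) = ((s x)^*)%R.
Hypothesis s_pos : forall a, pos a -> 0 <= s a.
Variables h k : P.
Hypothesis hs : cstar h = h.
Hypothesis ks : cstar k = k.
Hypothesis hk : h *c h + k *c k = cone.

(** The weights are written as squares [h^2] and [k^2] so that they can be split between the two
    sides of a form. *)
Definition mixed (x : O) : PO := tens t (h *c h) x + tens t (k *c k) (s x *: cone).

(** The first summand contributes the square of [sum_i (h (x) y_i) w_i]. The second contributes a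
    form whose scalar matrix [s (y_i^* y_j)] is positive because [s] is a state. *)
Lemma mixed_cp : cpmap mixed.
Proof.
have sD x y : s (x + y) = s x + s y.
  by have := s_lin 1 x y; rewrite scale1r mul1r.
have s0 : s 0 = 0 by have := s_lin (-1) 0 0; rewrite scaler0 addr0 mulN1r addNr.
have sZ (a : R[i]) x : s (a *: x) = a * s x by rewrite -[a *: x]addr0 s_lin s0 addr0.
split.
- move=> a x y; rewrite /mixed s_lin tensDr scalerDl -scalerA tensDr.
  by rewrite scalerDr addrACA.
- by rewrite /mixed s1 scale1r -tens_addl hk tens11.
- move=> x; rewrite /mixed s_star cstarD !tens_star !cstarM hs ks.
  by rewrite cstarZ cstar1.
move=> n y w.
have -> : \sum_i \sum_j cstar (w i) *c mixed (cstar (y i) *c y j) *c w j =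
    cstar (\sum_i tens t h (y i) *c w i) *c (\sum_i tens t h (y i) *c w i) +
    \sum_i \sum_j s (cstar (y i) *c y j) *:
      (cstar (tens t k cone *c w i) *c (tens t k cone *c w j)).
  rewrite cstar_sum cmul_suml -big_split; apply: eq_bigr => i _ /=.
  rewrite cmul_sumr -big_split; apply: eq_bigr => j _ /=.
  rewrite /mixed tensZr -[in X in _ *: tens t _ X](cmul1x (cone : O)).
  rewrite cmulDr cmulDl -!tensM !cstarM !tens_star hs ks cstar1; congr (_ + _).
    by rewrite !cmulA.
  by rewrite -cscaleAr -cscaleAl !cmulA.
apply: posD; first exact: pos_cstar.
have := @pos_form_scalar R PO n (\matrix_(i, j) s (cstar (y i) *c y j))
  (fun i => tens t k cone *c w i).
rewrite (_ : (\sum_i \sum_j _) = \sum_i \sum_j s (cstar (y i) *c y j) *: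
   (cstar (tens t k cone *c w i) *c (tens t k cone *c w j))); last first.
  by apply: eq_bigr => i _; apply: eq_bigr => j _; rewrite mxE.
apply=> [i j|v]; first by rewrite !mxE -s_star cstarM cstarK.
have sS (I : Type) (r : seq I) (Q : pred I) (F : I -> O) :
    s (\sum_(i <- r | Q i) F i) = \sum_(i <- r | Q i) s (F i).
  by apply: (big_morph s); [exact: sD|exact: s0].
have := s_pos (pos_cstar (\sum_i v i *: y i)).
rewrite cstar_sum cmul_suml sS; congr (0 <= _).
apply: eq_bigr => i _; rewrite cmul_sumr sS; apply: eq_bigr => j _.
by rewrite mxE cstarZ -cscaleAl -cscaleAr !sZ; ring.
Qed.

End MixedMap.

Lemma pcoord1_neq0 {R : realType} (P : finCstarType R) :
  (cone : P) != 0 -> exists i : 'I_(pdim P), pcoord i (cone : P) != 0.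
Proof.
move=> P1; apply: contrapT => /forallNP H; move/eqP: P1; apply.
rewrite (pcoordE (cone : P)) big1// => i _.
by have /negP/negPn/eqP -> := H i; rewrite scale0r.
Qed.

Section Closed.
Context {R : realType} {P : finCstarType R} {O M PM : ucstarType R}.
Variables (tM : tensor P M PM) (Phi : O -> PM).
Hypothesis P1 : (cone : P) != 0.
Hypothesis Phi_hom : is_unital_starhom Phi.
Hypothesis Phi_univ : all_maps_universal tM Phi.
Local Notation C := R[i].

Let phi i x : M := tcoord tM (Phi x) i.

Lemma phi_lin i (a : C) x y : phi i (a *: x + y) = a *: phi i x + phi i y.
Proof. by have [Pl _ _ _] := Phi_hom; rewrite /phi Pl tcoord_lin. Qed.

Lemma phi0 i : phi i 0 = 0.
Proof. by have := phi_lin i (-1) 0 0; rewrite scaler0 addr0 scaleN1r addNr. Qed.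

Lemma phiD i x y : phi i (x + y) = phi i x + phi i y.
Proof. by have := phi_lin i 1 x y; rewrite !scale1r. Qed.

Lemma phiZ i (a : C) x : phi i (a *: x) = a *: phi i x.
Proof. by rewrite -[a *: x]addr0 phi_lin phi0 addr0. Qed.

Lemma phi1 i : phi i cone = (pcoord i cone : C) *: cone.
Proof. by have [_ _ _ P_1] := Phi_hom; rewrite /phi P_1 -(tens11 tM) tcoord_tens. Qed.

Lemma phi_bnd i : exists2 c : R, 0 <= c & forall x, nrm (phi i x) <= c * nrm x.
Proof.
have [c c0 H] := tcoord_bnd tM i; exists c => // x.
by rewrite (le_trans (H _))// ler_wpM2l//; exact: starhom_nrm.
Qed.

Section WithState.
Variable s : O -> C.
Hypothesis s_lin : forall (a : C) x y, s (a *: x + y) = a * s x + s y.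
Hypothesis s1 : s cone = 1.
Hypothesis s_star : forall x, s (cstar x) = ((s x)^*)%R.
Hypothesis s_pos : forall a, pos a -> 0 <= s a.
Hypothesis s_bnd : forall x, cabs (s x) <= 2 * nrm x.

Let s0 : s 0 = 0.
Proof. by have := s_lin (-1) 0 0; rewrite scaler0 addr0 mulN1r addNr. Qed.

Let sD x y : s (x + y) = s x + s y.
Proof. by have := s_lin 1 x y; rewrite scale1r mul1r. Qed.

Let sZ (a : C) x : s (a *: x) = a * s x.
Proof. by rewrite -[a *: x]addr0 s_lin s0 addr0. Qed.

(** For [q = pbase i] the map [nu] recovers the [i]-th term of [sum_j phi j (x_j)] up to scalars.
    The correction by [s x] is forced: every [phi j cone] is a multiple of [cone], so scalars cannot
    be attributed to an index. *)
Definition dual_to (q : P) := exists nu : M -> O,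
  [/\ forall (a : C) x y, nu (a *: x + y) = a *: nu x + nu y,
      exists c : R, forall x, nrm (nu x) <= c * nrm x
    & forall j x, nu (phi j x) = (pcoord j q : C) *: (x - s x *: cone)].

Lemma dual_to_lin (a : C) p q : dual_to p -> dual_to q -> dual_to (a *: p + q).
Proof.
move=> [nu [nl [c nb] nE]] [mu [ml [d mb] mE]].
exists (fun x => a *: nu x + mu x); split.
- by move=> e x y; rewrite nl ml !scalerDr !scalerA addrACA [a * e]mulrC.
- exists (cabs a * c + d) => x; rewrite (le_trans (nrmD _ _))// mulrDl lerD//.
  by rewrite nrmZ -mulrA ler_wpM2l ?cabs_ge0.
- by move=> j x; rewrite nE mE linearP scalerA -scalerDl.
Qed.

(* For [-1 <= q <= 1], the ucp map [(1 + q)/2 (x) x + (1 - q)/2 (x) s x] extends. *)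
Lemma mixed_extension (q : P) : cstar q = q -> nrm q <= 1 ->
  dual_to ((2^-1 : R)%:C *: (cone + q)) /\
  exists kappa : M -> C,
  [/\ forall (a : C) x y, kappa (a *: x + y) = a * kappa x + kappa y,
      exists c : R, forall x, cabs (kappa x) <= c * nrm x
    & forall j x, kappa (phi j x) = (pcoord j cone : C) * s x].
Proof.
move=> qs q1.
have [PO [t]] := tensor_exists P O.
have [h [hs h2]] : exists h : P, cstar h = h /\ h *c h = (2^-1 : R)%:C *: (cone + q).
  have [||h hs hE] := @posZ R P 2^-1 (cone + q); rewrite ?invr_ge0//.
    apply: (@ball_pos _ _ _ 1); first by rewrite cstarD cstar1 qs.
    by rewrite scale1r opprD addrA subrr sub0r nrmN.
  by exists h.
have [k [ks k2]] : exists k : P, cstar k = k /\ k *c k = (2^-1 : R)%:C *: (cone - q).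
  have [||k ks kE] := @posZ R P 2^-1 (cone - q); rewrite ?invr_ge0//.
    apply: (@ball_pos _ _ _ 1); first by rewrite cstarB cstar1 qs.
    by rewrite scale1r opprB addrC subrK.
  by exists k.
have hk : h *c h + k *c k = cone.
  rewrite h2 k2 -scalerDr addrACA subrr addr0 addxx scalerA -rmorphM /=.
  by rewrite mulVf// scale1r.
have mcp := mixed_cp t s_lin s1 s_star s_pos hs ks hk.
have [lam [ll [l1 lS] lb _ lE]] := ucp_extension P1 Phi_univ t mcp.
have lphi j x : lam (phi j x) =
    (pcoord j (h *c h) : C) *: x + ((pcoord j (k *c k) : C) * s x) *: cone.
  rewrite lE /mixed -[X in X + _]scale1r tcoord_lin scale1r !tcoord_tens.
  by rewrite scalerA.
(* The weights add up to the unit, so [s \o lam] no longer depends on them. It serves as [kappa],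
   and the rest of [lam] as [nu]. *)
have slphi j x : s (lam (phi j x)) = (pcoord j cone : C) * s x.
  by rewrite lphi s_lin sZ s1 mulr1 -mulrDl -hk linearD.
split; last first.
  exists (s \o lam); split=> //=; first by move=> a x y; rewrite ll s_lin.
  exists 2 => x; apply: (le_trans (s_bnd _)).
  by rewrite ler_wpM2l.
rewrite -h2; exists (fun x => lam x - s (lam x) *: cone); split.
- move=> a x y; rewrite ll s_lin scalerDl scalerBr scalerA opprD addrACA//.
- exists 3 => x; rewrite (le_trans (nrmB _ _))// nrmZ.
  have := lb x; have := s_bnd (lam x); have := nrm1_le1 (A := O).
  have := nrm_ge0 (cone : O); have := cabs_ge0 (s (lam x)); have := nrm_ge0 x.
  by move: (nrm x) (nrm (lam x)) (cabs _) (nrm cone) => u v w e; nra.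
- move=> j x; rewrite slphi lphi scalerBr scalerA -addrA -scalerBl; congr (_ + _).
  rewrite -scaleNr; congr (_ *: _).
  by rewrite -{1}hk linearD mulrDl opprD addrCA subrr addr0.
Qed.

(** The elements [(1 + q)/2], for self-adjoint contractions [q], span [P]. *)
Lemma dual_to_all q : dual_to q.
Proof.
have d0 : dual_to 0.
  exists (fun=> 0); split.
  - by move=> a x y; rewrite scaler0 addr0.
  - by exists 0 => x; rewrite nrm0 mul0r.
  - by move=> j x; rewrite linear0 scale0r.
have dZ (a : C) p : dual_to p -> dual_to (a *: p).
  by move=> dp; rewrite -[_ *: _]addr0; exact: dual_to_lin.
have d1 : dual_to cone.
  have [|d _] := mixed_extension (cstar1 P); first exact: nrm1_le1.
  by move: d; rewrite addxx scalerA -rmorphM /= mulVf// scale1r.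
have dc p : cstar p = p -> nrm p <= 1 -> dual_to p.
  move=> ps p1; have [d _] := mixed_extension ps p1.
  have -> : p = (-1) *: cone + (2 : R)%:C *: ((2^-1 : R)%:C *: (cone + p)).
    by rewrite scalerA -rmorphM /= divff// scale1r scaleN1r addrA addNr add0r.
  by apply: dual_to_lin => //; exact: dZ.
have ds p : cstar p = p -> dual_to p.
  move=> ps; pose r := nrm p + 1; have r0 : 0 < r by rewrite ltr_wpDl ?nrm_ge0.
  have -> : p = r%:C *: ((r^-1)%:C *: p).
    by rewrite scalerA -rmorphM /= divff ?gt_eqF// scale1r.
  apply: dZ; apply: dc; first by rewrite cstarZr ps.
  rewrite nrmZr gtr0_norm ?invr_gt0// mulrC ler_pdivrMr// mul1r.
  by rewrite lerDl.
have -> : q = ((2^-1 : R)%:C * - 'i%C) *: ('i%C *: (q - cstar q)) +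
    (2^-1 : R)%:C *: (q + cstar q).
  rewrite scalerA -mulrA mulNr -expr2 sqr_i opprK mulr1 -scalerDr addrACA.
  by rewrite addNr addr0 addxx scalerA -rmorphM /= mulVf// scale1r.
apply: dual_to_lin; last first.
  by apply: dZ; apply: ds; rewrite cstarD cstarK addrC.
apply: ds; rewrite cstarZ cstarB cstarK -opprB scalerN -scaleNr; congr (_ *: _).
by apply/eqP; rewrite eq_complex /= oppr0 opprK !eqxx.
Qed.

(* [D = sum_i phi_i nu_i + kappa 1 - id] is bounded and vanishes on the slices. *)
Lemma slices_closed_state y : slices_set tM Phi y ->
  exists x : 'I_(pdim P) -> O, y = \sum_i phi i (x i).
Proof.
move=> Xy.
have [nu nuP] := choice (fun i => dual_to_all (pbase i)).
have [_ [kappa [kl [ck kb] kE]]] := mixed_extension (cstar1 P) nrm1_le1.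
pose D z := \sum_i phi i (nu i z) + kappa z *: cone - z.
have Dl (a : C) u v : D (a *: u + v) = a *: D u + D v.
  rewrite /D kl scalerBr scalerDr scaler_sumr.
  rewrite (eq_bigr (fun i => a *: phi i (nu i u) + phi i (nu i v))) => [|i _]; last first.
    by have [nl _ _] := nuP i; rewrite nl phi_lin.
  by rewrite big_split scalerDl scalerA /= opprD [RHS]addrACA [X in _ = X + _]addrACA.
have D0 : D 0 = 0 by have := Dl (-1) 0 0; rewrite scaler0 addr0 scaleN1r addNr.
have DZ (a : C) u : D (a *: u) = a *: D u by rewrite -[a *: u]addr0 Dl D0 addr0.
have DD u v : D (u + v) = D u + D v by rewrite -[u]scale1r Dl !scale1r.
have DS (I : Type) (r : seq I) (Q : pred I) (F : I -> M) :
    D (\sum_(i <- r | Q i) F i) = \sum_(i <- r | Q i) D (F i).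
  by apply: (big_morph D).
have Dphi j x : D (phi j x) = 0.
  have -> : D (phi j x) = phi j (x - s x *: cone) + ((pcoord j cone : C) * s x) *: cone - phi j x.
    rewrite /D kE; congr (_ + _ - _); rewrite (bigD1 j)//= big1 => [|i ij].
      by have [_ _ ->] := nuP j; rewrite pcoord_base eqxx scale1r addr0.
    by have [_ _ ->] := nuP i; rewrite pcoord_base (negPf ij) scale0r phi0.
  by rewrite -scaleNr phiD phiZ phi1 scalerA mulNr scaleNr mulrC subrK subrr.
have Db : exists2 K : R, 0 < K & forall z, nrm (D z) <= K * nrm z.
  have fb i : exists2 c : R, 0 <= c & forall z, nrm (phi i (nu i z)) <= c * nrm z.
    have [_ [c cb] _] := nuP i; have [d d0 db] := phi_bnd i.
    exists (d * `|c|); first by rewrite mulr_ge0.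
    move=> z; rewrite (le_trans (db _))// -mulrA ler_wpM2l// (le_trans (cb _))//.
    by rewrite ler_wpM2r ?nrm_ge0// ler_norm.
  have fb' i : exists c : R, 0 <= c /\ forall z, nrm (phi i (nu i z)) <= c * nrm z.
    by have [e e0 eb] := fb i; exists e.
  have [c cP] := choice fb'.
  exists (\sum_i c i + `|ck| + 1).
    by rewrite ltr_wpDl// addr_ge0// sumr_ge0// => i _; have [] := cP i.
  move=> z; rewrite (le_trans (nrmB _ _))// mulrDl mul1r lerD2r.
  rewrite (le_trans (nrmD _ _))// mulrDl lerD//.
    rewrite (le_trans (nrm_sum _ _ _))// mulr_suml ler_sum// => i _.
    by have [] := cP i.
  rewrite nrmZ; have := kb z; have := nrm1_le1 (A := M).
  have := nrm_ge0 (cone : M); have := cabs_ge0 (kappa z); have := nrm_ge0 z.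
  have := ler_norm ck.
  by move: (nrm z) (cabs _) (nrm cone) => u v w; nra.
have Dy : D y = 0.
  have [K K0 KD] := Db; apply: nrm_eq0; apply/eqP; rewrite eq_le nrm_ge0 andbT.
  apply/ler_addgt0Pr => e e0; rewrite add0r.
  move/closure_normP : Xy => /(_ (e / K)%:C); rewrite ltcR divr_gt0// => /(_ isT).
  move=> [y0 [n [a [v [vP y0E]]]]]; rewrite nrmE ltcR ltr_pdivlMr// mulrC => yy.
  have Dy0 : D y0 = 0.
    rewrite y0E DS big1// => i _; rewrite DZ; have [w [x ->]] := vP i.
    rewrite /slice DS big1 ?scaler0// => j _.
    by rewrite DZ Dphi scaler0.
  rewrite -[D y]subr0 -Dy0 -scaleN1r -DZ -DD scaleN1r.
  exact: le_trans (KD _) (ltW yy).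
(* The remaining scalar [kappa y] is itself a value of [phi i0] at a multiple of the unit, so it is
   absorbed into the term of index [i0]. *)
have [i0 ci0] := pcoord1_neq0 P1.
exists (fun i => nu i y + (if i == i0 then (kappa y / (pcoord i0 cone : C)) *: cone else 0)).
transitivity (\sum_i phi i (nu i y) + kappa y *: cone).
  by apply/eqP; rewrite eq_sym -subr_eq0; apply/eqP.
rewrite [RHS](eq_bigr (fun i => phi i (nu i y) +
   phi i (if i == i0 then (kappa y / (pcoord i0 cone : C)) *: cone else 0))); last first.
  by move=> i _; rewrite phiD.
rewrite big_split; congr (_ + _); rewrite (bigD1 i0)//= eqxx big1 => [|i ii].
  by rewrite addr0 phiZ phi1 scalerA divfK.
by rewrite (negPf ii) phi0.
Qed.

End WithState.

(** States exist only on a nonzero algebra. If [O] is zero, unitality of [Phi] makes [P (x) M] zero,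
    hence [M] as well. *)
Theorem slices_closed y : slices_set tM Phi y ->
  exists x : 'I_(pdim P) -> O, y = \sum_i tcoord tM (Phi (x i)) i.
Proof.
have [zO|nzO] := eqVneq (cone : O) 0; last first.
  have [s [sl s1 ss sp sb]] := state_exists nzO.
  exact: (slices_closed_state sl s1 ss sp sb).
move=> _; exists (fun=> 0); rewrite big1 => [|i _]; last exact: phi0.
have PM0 : (cone : PM) = 0.
  have [_ _ _ <-] := Phi_hom; rewrite zO.
  have [Pl _ _ _] := Phi_hom.
  by have := Pl (-1) 0 0; rewrite scaler0 addr0 scaleN1r addNr.
have [i0 ci0] := pcoord1_neq0 P1.
have := tcoord_tens tM cone y i0.
have -> : tens tM cone y = tens tM cone cone *c tens tM cone y by rewrite tensM !cmul1x.
rewrite tens11 PM0 cmul0x tcoord0 => /esym/eqP.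
by rewrite scaler_eq0 (negPf ci0) => /eqP.
Qed.

End Closed.

(** * From positivity of matrices to positivity of forms *)

Section UcpMaps.
Context {R : realType} {P : finCstarType R} {O A PA : ucstarType R}.
Variables (t : tensor P A PA) (S : opSystem A) (psi : os_full O -> os_tensor t S).
Hypothesis psi_ucp : is_ucp psi.

Definition full_in (x : O) : os_full O := @os_in R O (os_full O) x I.
Definition ucp_fun (x : O) : PA := val (psi (full_in x)).

Lemma ucp_fun_val (x : os_full O) : ucp_fun (val x) = val (psi x).
Proof. by congr (val (psi _)); exact: val_inj. Qed.

Lemma ucp_fun_cp : cpmap ucp_fun.
Proof.
have [pl p1 pp] := psi_ucp.
have fl (a : R[i]) x y : ucp_fun (a *: x + y) = a *: ucp_fun x + ucp_fun y.
  have -> : ucp_fun (a *: x + y) = val (psi (a *: full_in x + full_in y)).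
    by congr (val (psi _)); exact: val_inj.
  by rewrite pl.
have f1 : ucp_fun cone = cone.
  have -> : ucp_fun cone = val (psi (os_one (os_full O))).
    by congr (val (psi _)); exact: val_inj.
  by rewrite p1.
have fD x y : ucp_fun (x + y) = ucp_fun x + ucp_fun y.
  by have := fl 1 x y; rewrite !scale1r.
have f0 : ucp_fun 0 = 0 by have := fl (-1) 0 0; rewrite scaler0 addr0 scaleN1r addNr.
have fZ (a : R[i]) x : ucp_fun (a *: x) = a *: ucp_fun x.
  by rewrite -[a *: x]addr0 fl f0 addr0.
have fcp (n : nat) (y : 'I_n -> O) (w : 'I_n -> PA) :
    pos (\sum_i \sum_j cstar (w i) *c ucp_fun (cstar (y i) *c y j) *c w j).
  case: n y w => [|n] y w; first by rewrite big_ord0; exact: pos0.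
  have [|Z ZE] := pp n.+1 (\matrix_(i, j) full_in (cstar (y i) *c y j)).
    (* The matrix [y_i^* y_j] factors through a square matrix with [y] as row [ord0] and zeros
       elsewhere; the empty case was split off so that this row exists. *)
    exists (\matrix_(l, j) (if l == ord0 then y j else 0)); apply/matrixP => i j.
    rewrite !mxE (bigD1 ord0)//= big1 => [|l l0]; rewrite !mxE ?eqxx ?addr0//.
    by rewrite (negPf l0) cmulx0.
  have := pos_form_gram w (fun l j => Z l j); congr pos.
  apply: eq_bigr => i _; apply: eq_bigr => j _; congr (_ *c _ *c _).
  by have := congr1 (fun X : 'M[PA]_n.+1 => X i j) ZE; rewrite !mxE.
have fpos a : pos a -> pos (ucp_fun a).
  move=> [h hs ->]; have := fcp 1%N (fun=> h) (fun=> cone).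
  by rewrite !big_ord1 cstar1 cmul1x cmulx1 hs.
have fsa h : cstar h = h -> cstar (ucp_fun h) = ucp_fun h.
  move=> hs; have := pos_sa (fpos _ (pos_nrmB hs)).
  rewrite fl -[- h]scaleN1r fZ f1 cstarD cstarZr cstar1 => /addrI.
  by rewrite scaleN1r cstarN => /oppr_inj.
split=> // x.
pose u := x + cstar x; pose v := 'i%C *: (x - cstar x).
have us : cstar u = u by rewrite cstarD cstarK addrC.
have conji : ('i%C^*)%R = - 'i%C :> R[i] by apply/eqP; rewrite eq_complex /= oppr0 !eqxx.
have vs : cstar v = v.
  by rewrite cstarZ cstarB cstarK -opprB scalerN -scaleNr conji opprK.
have fN y : ucp_fun (- y) = - ucp_fun y by rewrite -scaleN1r fZ scaleN1r.
have e1 : cstar (ucp_fun x) + cstar (ucp_fun (cstar x)) = ucp_fun (cstar x) + ucp_fun x.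
  by have := fsa u us; rewrite /u fD cstarD [RHS]addrC.
have e2 : cstar (ucp_fun x) - cstar (ucp_fun (cstar x)) = ucp_fun (cstar x) - ucp_fun x.
  have := congr1 (fun z => 'i%C *: z) (fsa v vs).
  rewrite /v fZ cstarZ conji fD fN cstarB !scalerA mulrN -expr2 sqr_i opprK scale1r.
  by rewrite scaleN1r opprB.
have := congr2 +%R e1 e2; rewrite addrACA subrr addr0 [RHS]addrACA subrr addr0 !addxx.
by move/(scalerI (_ : (2 : R)%:C != 0)) => -> //; rewrite eq_complex /= pnatr_eq0.
Qed.

End UcpMaps.

(** * The universal property for operator systems *)

Theorem theorem3p3 (R : realType) (P : finCstarType R) (O : ucstarType R)
    (P_neq0 : (cone : P) != 0) (O_sep : separable_space O)
    (M PM : ucstarType R) (tM : tensor P M PM) (Phi : O -> PM)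
    (Phi_hom : is_unital_starhom Phi) (Phi_univ : all_maps_universal tM Phi)
    (A PA : ucstarType R) (tA : tensor P A PA) (S : opSystem A)
    (psi : os_full O -> os_tensor tA S) (psi_ucp : is_ucp psi) :
  exists! lambda : slices_system tM P_neq0 Phi_hom -> S,
    is_ucp lambda /\
    psi = os_id_tensor tM tA lambda \o slices_map tM P_neq0 Phi_hom.
Proof.
set SS := slices_system tM P_neq0 Phi_hom.
have cp := ucp_fun_cp psi_ucp.
have [lam [ll [l1 lS] _ lcp lE]] := ucp_extension P_neq0 Phi_univ tA cp.
have lamE x i : lam (tcoord tM (Phi (val x)) i) = tcoord tA (val (psi x)) i.
  by rewrite lE ucp_fun_val.
have span (y : SS) : exists x : 'I_(pdim P) -> O, val y = \sum_i tcoord tM (Phi (x i)) i.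
  by apply: (slices_closed P_neq0 Phi_hom Phi_univ); exact: (os_valP y).
have l0 : lam 0 = 0 by have := ll (-1) 0 0; rewrite scaler0 addr0 scaleN1r addNr.
have lD x y : lam (x + y) = lam x + lam y by have := ll 1 x y; rewrite !scale1r.
have lsum (I : Type) (r : seq I) (F : I -> M) :
    lam (\sum_(i <- r) F i) = \sum_(i <- r) lam (F i) by apply: (big_morph lam).
(* A limit of elements of [S] could leave [S]. By [span], [y] is a finite sum of coordinates of
   [Phi], so [lam] maps it to a finite sum of coordinates of [psi]. *)
have lmem (y : SS) : os_set S (lam (val y)).
  have [x ->] := span y; rewrite lsum; apply: os_sum_mem => i.
  by rewrite -[x i]/(val (full_in (x i))) lamE; exact: (os_valP (psi (full_in (x i))) i).
pose lambda (y : SS) : S := os_in (lmem y).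
have lambda_ucp : is_ucp lambda.
  split.
  - by move=> a x y; apply: val_inj; exact: ll.
  - by apply: val_inj; exact: l1.
  move=> k X [Y XY]; have XE i j : val (X i j) = \sum_l cstar (Y l i) *c Y l j.
    by have := congr1 (fun Z : 'M[M]_k => Z i j) XY; rewrite !mxE.
  apply: mx_nneg_form => [i j|a]; first rewrite !mxE /=.
    rewrite -lS !XE cstar_sum; congr lam; apply: eq_bigr => l _.
    by rewrite cstarM cstarK.
  (* The factor [Y] of [X] has entries in [M], not in the operator system. This is harmless because
     [lam] is defined and completely positive on all of [M]; each row of [Y] gives one positive
     form. *)
  have -> : \sum_i \sum_j cstar (a i) *c (map_mx (val \o lambda) X) i j *c a j =
      \sum_l \sum_i \sum_j cstar (a i) *c lam (cstar (Y l i) *c Y l j) *c a j.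
    rewrite [RHS]exchange_big; apply: eq_bigr => i _ /=.
    rewrite [RHS]exchange_big; apply: eq_bigr => j _ /=.
    by rewrite mxE /= XE lsum cmul_sumr cmul_suml.
  by apply: pos_sum => l; exact: lcp.
have coordE (f : SS -> S) x i : psi = os_id_tensor tM tA f \o slices_map tM P_neq0 Phi_hom ->
    tcoord tA (val (psi x)) i = val (f (os_tcoord (slices_map tM P_neq0 Phi_hom x) i)).
  by move=> ->; rewrite /= (tensK tA (fun i =>
    val (f (os_tcoord (slices_map tM P_neq0 Phi_hom x) i)))).
exists lambda; split.
  split=> //; apply/funext => x; apply: val_inj => /=.
  rewrite -[LHS](tcoordK tA); apply: eq_bigr => i _; congr (tens tA _ _).
  by rewrite -lamE.
(* Both maps are linear and agree on the coordinates of [Phi], whose finite sums exhaust the slice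
   system. *)
move=> mu [[mul mu1 _] muE]; apply/funext => y; apply: val_inj.
have [x yx] := span y.
have -> : y = \sum_i os_tcoord (slices_map tM P_neq0 Phi_hom (full_in (x i))) i.
  by apply: val_inj; rewrite yx; apply/esym; apply: (big_morph val).
have add (nu : SS -> S) : linear nu -> forall r : seq 'I_(pdim P),
    nu (\sum_(i <- r) os_tcoord (slices_map tM P_neq0 Phi_hom (full_in (x i))) i) =
    \sum_(i <- r) nu (os_tcoord (slices_map tM P_neq0 Phi_hom (full_in (x i))) i).
  move=> nul r; apply: (big_morph nu) => [u v|].
    by have := nul 1 u v; rewrite !scale1r.
  by have := nul (-1) 0 0; rewrite scaler0 addr0 scaleN1r addNr.
have [lambda_lin _ _] := lambda_ucp.
rewrite !add//; congr val; apply: eq_bigr => i _; apply: val_inj.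
by rewrite -(coordE mu _ _ muE) /= -lamE.
Qed.
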